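(* Let $0<\alpha\le 1$ and, for $n\ge 1$, let $$A_n(\alpha)=\sum_{k=1}^{n}\binom{n-1}{k-1}\binom{\alpha}{k}2^k .$$ Then for every $f\in\mathcal{SS}^*_{\alpha}$ the logarithmic coefficients $\gamma_n$ of $f$ satisfy $$|\gamma_{n}|\le \frac{\alpha}{n}\quad\text{for all } n\ge 1,$$ and $$\sum_{n=1}^{\infty}|\gamma_{n}|^{2} \leq \frac{1}{4}\sum_{n=1}^{\infty}\frac{|A_n(\alpha)|^2}{n^2}.$$ Both inequalities are sharp: equality in the first inequality for the index $n$ holds for the function $f\in\mathcal{A}$ given by $\frac{zf'(z)}{f(z)}=\left(\frac{1+z^n}{1-z^n}\right)^{\alpha}$, and equality in the second holds for the function $f\in\mathcal{A}$ given by $\frac{zf'(z)}{f(z)}=\left(\frac{1+z}{1-z}\right)^{\alpha}$.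
   Context: $\mathbb{D}=\{z\in\mathbb{C}:|z|<1\}$. $\mathcal{A}$ is the class of analytic functions $f$ on $\mathbb{D}$ with $f(0)=f'(0)-1=0$. For analytic $F,G$ in $\mathbb{D}$, $F\prec G$ ($F$ is subordinate to $G$) means there is an analytic $\phi$ on $\mathbb{D}$ with $\phi(0)=0$, $|\phi(z)|<1$ on $\mathbb{D}$ and $F=G\circ\phi$. The class of strongly starlike functions is, for $0<\alpha\le1$, $$\mathcal{SS}^*_\alpha=\left\{f\in\mathcal{A}:\ \frac{zf'(z)}{f(z)}\prec\left(\frac{1+z}{1-z}\right)^{\alpha},\ z\in\mathbb{D}\right\}$$ (in particular $zf'/f$ is analytic in $\mathbb{D}$, so $f(z)/z$ is nonvanishing). Powers are principal branches (value $1$ at $z=0$); $\binom{\alpha}{k}=\frac{\alpha(\alpha-1)\cdots(\alpha-k+1)}{k!}$. The logarithmic coefficients $\gamma_n=\gamma_n(f)$ are defined by $\log\frac{f(z)}{z}=2\sum_{n=1}^\infty\gamma_n z^n$ for $z\in\mathbb{D}$, with the branch of the logarithm vanishing at $z=0$. *)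

(* Defs.v *)
(* Stdlib real numbers, with Coquelicot for complex numbers, derivatives and
   series. *)
From Stdlib Require Import Reals.
From Coquelicot Require Import Coquelicot.
Open Scope R_scope.

Definition in_disk (z : C) : Prop := Cmod z < 1.

(* Functions on the disk are total functions [C -> C] whose values outside the
   disk are irrelevant.  The disk is open, so complex differentiability at each
   of its points only depends on the values inside. *)
Definition analytic_on_disk (f : C -> C) : Prop :=
  forall z : C, in_disk z -> @ex_derive C_AbsRing C_NormedModule f z.

Definition class_A (f : C -> C) : Prop :=
  analytic_on_disk f /\ f (RtoC 0) = RtoC 0 /\ C_derive f (RtoC 0) = RtoC 1.

Definition subordinate (F G : C -> C) : Prop :=
  analytic_on_disk F /\ analytic_on_disk G /\
  exists phi : C -> C,
    analytic_on_disk phi /\ phi (RtoC 0) = RtoC 0 /\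
    (forall z : C, in_disk z -> Cmod (phi z) < 1) /\
    (forall z : C, in_disk z -> F z = G (phi z)).

Definition Cexp (z : C) : C :=
  (exp (Re z) * cos (Im z), exp (Re z) * sin (Im z)).

(* Principal argument, with values in (-PI, PI]; only meaningful for z <> 0. *)
Definition Carg (z : C) : R :=
  if Rle_dec 0 (Im z) then acos (Re z / Cmod z) else - acos (Re z / Cmod z).

Definition Clog (z : C) : C := (ln (Cmod z), Carg z).

(* Principal power; only meaningful for z <> 0. *)
Definition Cpower (z : C) (alpha : R) : C :=
  Cexp (Cmult (RtoC alpha) (Clog z)).

Definition sector_map (alpha : R) (z : C) : C :=
  Cpower ((RtoC 1 + z) / (RtoC 1 - z))%C alpha.

(* [F] is the analytic function z f'(z) / f(z) on the disk.  The quotient has a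
   removable singularity at 0, where its value is 1 for f in the class A; the
   condition [f z <> RtoC 0] rules out Coquelicot's convention x / 0 = 0. *)
Definition is_starlike_quotient (f F : C -> C) : Prop :=
  analytic_on_disk F /\ F (RtoC 0) = RtoC 1 /\
  forall z : C, in_disk z -> z <> RtoC 0 ->
    f z <> RtoC 0 /\ F z = (z * C_derive f z / f z)%C.

Definition strongly_starlike (alpha : R) (f : C -> C) : Prop :=
  class_A f /\
  exists F : C -> C,
    is_starlike_quotient f F /\ subordinate F (sector_map alpha).

Definition is_log_branch (f L : C -> C) : Prop :=
  analytic_on_disk L /\ L (RtoC 0) = RtoC 0 /\
  forall z : C, in_disk z -> z <> RtoC 0 -> Cexp (L z) = (f z / z)%C.

(* log (f(z)/z) = 2 * (gamma_1 z + gamma_2 z^2 + ...) on the disk; the series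
   starts at index 1, so [gamma 0] plays no role. *)
Definition is_log_coeffs (f : C -> C) (gamma : nat -> C) : Prop :=
  exists L : C -> C,
    is_log_branch f L /\
    forall z : C, in_disk z ->
      exists s : C,
        @is_series C_AbsRing C_NormedModule
          (fun k : nat => (gamma (k + 1)%nat * z ^ (k + 1))%C) s /\
        L z = (RtoC 2 * s)%C.

(* alpha (alpha - 1) ... (alpha - k + 1) *)
Fixpoint falling (alpha : R) (k : nat) : R :=
  match k with
  | O => 1
  | S j => falling alpha j * (alpha - INR j)
  end.

Definition gbinom (alpha : R) (k : nat) : R := falling alpha k / INR (Factorial.fact k).

Definition A_coeff (alpha : R) (n : nat) : R :=
  sum_n_m (fun k : nat =>
    Binomial.C (n - 1) (k - 1) * gbinom alpha k * 2 ^ k) 1 n.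

(* Main.v *)
Require Import Defs.
From Stdlib Require Import Reals Arith Lra Lia Classical ClassicalEpsilon.
From Coquelicot Require Import Coquelicot.
Open Scope R_scope.

(** Write [F = z f'/f] and let [L] be the branch of [log (f/z)].  Differentiating
[Cexp L = f/z] gives [z L' = F - 1], so [2 n gamma_n] is the [n]-th Taylor
coefficient [c_n] of [F] ([log_coeffs_starlike_quotient]).  The theorem is thus
about the coefficients of [F = G o phi], where [G = ((1+z)/(1-z))^alpha] is the
sector map; the coefficients of [G] of positive index are the [A_n]
([sector_map_coefs]), because [G = (1+u)^alpha] with [u = 2z/(1-z)].

First inequality ([sector_coef_bound]).  [F] takes its values in the sector
[|arg w| < alpha pi/2], which is convex for [alpha <= 1].  The mean of [F] over
the rotations by the [n]-th roots of unity therefore stays in the sector, and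
it is [1 + c_n z^n + ...].  Composing it with the inverse of the sector map,
whose derivative at 1 is [1/(2 alpha)], gives a function bounded by 1 whose
[n]-th coefficient is [c_n/(2 alpha)]; and a function bounded by 1 has all its
coefficients bounded by 1.

Second inequality.  The theorem of Rogosinski ([rogosinski]) compares all the
partial sums of [|c_n|^2] with those of [|A_n|^2]; as the weights [1/n^2]
decrease, summation by parts ([weighted_rsum_le]) finishes the argument.
Rogosinski's theorem follows from the Horner scheme
[G o phi = B_0 + phi (B_1 + phi (B_2 + ...))]: multiplication by [phi] does
not increase the truncated square norm of the coefficients
([schur_contraction]), and the constant is orthogonal to a multiple of [phi]
since [phi 0 = 0].

Equality holds for [G (z^n)] because its [n]-th coefficient is
[G'(0) = 2 alpha], and for [G] because its coefficients are the [A_n].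

Functions are only assumed to be complex differentiable, so their power series
have to be produced first.  Bisection shows that the integral of a
differentiable function around a rectangle vanishes ([goursat]).  Read through
the exponential, which wraps a rectangle around an annulus, this says that the
mean of a function over the circle of radius [s] around 0 does not depend on
[s] ([circ_int_annulus]).  For [z] times a difference quotient of [f] the mean
is also continuous across the radius of the exceptional point, so it is 0;
this is Cauchy's formula, and expanding the kernel gives the Taylor series
([taylor_series]).  From then on coefficients of products and compositions are
never computed: two functions whose difference is [o(z^n)] at 0 have the same
coefficients up to the index [n] ([coefs_small_o_eq]). *)

(** * Complex derivatives and the complex exponential *)

Definition cderive (f : C -> C) (z l : C) : Prop :=
  @is_derive C_AbsRing C_NormedModule f z l.

Lemma locally_C_iff (z : C) (P : C -> Prop) :
  @locally (AbsRing_UniformSpace C_AbsRing) z P <->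
  exists d, 0 < d /\ forall w, Cmod (w - z)%C < d -> P w.
Proof.
split.
- intros [d H]. exists d. split. apply cond_pos.
  intros w Hw. apply H. exact Hw.
- intros [d [Hd H]]. exists (mkposreal d Hd). intros w Hw. apply H. exact Hw.
Qed.

(** The form in which derivatives are produced and used by hand: the remainder
is at most [eps] times the increment. *)
Lemma cderive_eps (f : C -> C) (z l : C) :
  cderive f z l <->
  forall eps, 0 < eps -> exists d, 0 < d /\ forall w, Cmod (w - z)%C < d ->
    Cmod (f w - f z - l * (w - z))%C <= eps * Cmod (w - z)%C.
Proof.
split.
- intros [_ H] eps Heps.
  specialize (H z (fun P HP => HP) (mkposreal eps Heps)).
  apply locally_C_iff in H. destruct H as [d [Hd H]].
  exists d; split; auto. intros w Hw. specialize (H w Hw).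
  replace (l * (w - z))%C with ((w - z) * l)%C by ring. exact H.
- intros H. split.
  + apply (@is_linear_scal_l C_AbsRing C_NormedModule).
  + intros x Hx.
    apply (@is_filter_lim_locally_unique C_AbsRing (AbsRing_NormedModule C_AbsRing)) in Hx. subst x.
    intros eps. apply locally_C_iff.
    destruct (H eps (cond_pos eps)) as [d [Hd H']].
    exists d; split; auto. intros w Hw. specialize (H' w Hw).
    replace (l * (w - z))%C with ((w - z) * l)%C in H' by ring. exact H'.
Qed.

Lemma cderive_eq (f : C -> C) (z l l' : C) : cderive f z l -> l = l' -> cderive f z l'.
Proof. intros H <-; exact H. Qed.

(** The chain and product rules of the library want the codomain to be the
scalar ring seen as a module over itself.  Its uniform structure uses balls of
[Cmod], while that of [C_NormedModule] uses products of intervals; a derivative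
only involves the norm of the codomain, so the two notions agree. *)
Lemma cderive_K (f : C -> C) (z l : C) :
  cderive f z l <-> @is_derive C_AbsRing (AbsRing_NormedModule C_AbsRing) f z l.
Proof. split; intros [[H1 H2 H3] H]; (split; [split|]); assumption. Qed.

Lemma cderive_mult f g z a b : cderive f z a -> cderive g z b ->
  cderive (fun w => f w * g w)%C z (a * g z + f z * b)%C.
Proof.
intros Hf Hg. apply cderive_K.
apply (@is_derive_mult C_AbsRing); try (apply cderive_K; assumption).
intros; apply Cmult_comm.
Qed.

Lemma cderive_comp f g z a b : cderive f (g z) a -> cderive g z b ->
  cderive (fun w => f (g w)) z (b * a)%C.
Proof.
intros Hf Hg. 
apply (@is_derive_comp C_AbsRing C_NormedModule f g); auto. apply cderive_K; assumption.
Qed.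

Lemma cderive_plus f g z a b : cderive f z a -> cderive g z b ->
  cderive (fun w => f w + g w)%C z (a + b)%C.
Proof. intros. apply (@is_derive_plus C_AbsRing C_NormedModule); auto. Qed.

Lemma cderive_minus f g z a b : cderive f z a -> cderive g z b ->
  cderive (fun w => f w - g w)%C z (a - b)%C.
Proof. intros. apply (@is_derive_minus C_AbsRing C_NormedModule); auto. Qed.

Lemma cderive_const c z : cderive (fun _ => c) z (RtoC 0).
Proof. apply (@is_derive_const C_AbsRing C_NormedModule). Qed.

Lemma cderive_id z : cderive (fun w : C => w) z (RtoC 1).
Proof. apply cderive_K. apply (@is_derive_id C_AbsRing). Qed.

Lemma cderive_ext_loc f g z l d : 0 < d ->
  (forall w, Cmod (w - z)%C < d -> f w = g w) -> cderive f z l -> cderive g z l.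
Proof.
intros Hd H Hf. apply (@is_derive_ext_loc C_AbsRing C_NormedModule f); auto.
apply locally_C_iff. exists d; split; auto.
Qed.

Lemma cderive_inv z : z <> RtoC 0 -> cderive (fun w => / w)%C z (- / (z * z))%C.
Proof.
intros Hz. apply cderive_eps. intros eps Heps.
assert (Hm : 0 < Cmod z) by (apply Cmod_gt_0; auto).
exists (Rmin (Cmod z / 2) (eps * (Cmod z ^ 3) / 2)). split.
{ apply Rmin_glb_lt. lra. apply Rdiv_lt_0_compat; [|lra].
  apply Rmult_lt_0_compat; auto. apply pow_lt; auto. }
intros w Hw.
assert (Hw1 : Cmod (w - z)%C < Cmod z / 2) by (eapply Rlt_le_trans; [exact Hw|apply Rmin_l]).
assert (Hw2 : Cmod (w - z)%C < eps * (Cmod z ^ 3) / 2) by (eapply Rlt_le_trans; [exact Hw|apply Rmin_r]).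
assert (Hwm : Cmod z / 2 <= Cmod w).
{ pose proof (Cmod_triangle (z - w)%C w) as T. replace (z - w + w)%C with z in T by ring.
  replace (z - w)%C with (- (w - z))%C in T by ring. rewrite Cmod_opp in T. lra. }
assert (Hw0 : w <> RtoC 0) by (apply Cmod_gt_0; lra).
replace (/ w - / z - - / (z * z) * (w - z))%C with ((w - z) * ((w - z) / (w * (z * z))))%C
  by (field; auto).
rewrite Cmod_mult, Rmult_comm. apply Rmult_le_compat_r; [apply Cmod_ge_0|].
assert (Hzz : (z * z)%C <> RtoC 0) by (apply Cmult_neq_0; auto).
rewrite Cmod_div by (apply Cmult_neq_0; auto).
rewrite !Cmod_mult.
apply Rmult_le_reg_r with (Cmod w * (Cmod z * Cmod z)).
{ apply Rmult_lt_0_compat; [lra|]. apply Rmult_lt_0_compat; lra. }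
unfold Rdiv. rewrite Rmult_assoc, Rinv_l, Rmult_1_r.
2: { apply Rgt_not_eq. apply Rmult_lt_0_compat; [lra|]. apply Rmult_lt_0_compat; lra. }
apply Rle_trans with (eps * Cmod z ^ 3 / 2); [lra|].
apply Rle_trans with (eps * (Cmod z / 2 * (Cmod z * Cmod z))). right; field.
apply Rmult_le_compat_l; [lra|]. apply Rmult_le_compat_r; [nra|auto].
Qed.

Lemma cderive_div f g z a b : g z <> RtoC 0 -> cderive f z a -> cderive g z b ->
  cderive (fun w => f w / g w)%C z ((a * g z - f z * b) / (g z * g z))%C.
Proof.
intros H0 Hf Hg.
eapply cderive_eq.
- apply cderive_mult. exact Hf. apply (cderive_comp Cinv g). apply cderive_inv; auto. exact Hg.
- simpl. field; auto.
Qed.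

Lemma cderive_pow n z : cderive (fun w => w ^ n)%C z (INR n * z ^ (pred n))%C.
Proof.
induction n.
- replace (INR 0 * z ^ (pred 0))%C with (RtoC 0). apply (cderive_const (RtoC 1)). simpl; ring.
- replace (INR (S n) * z ^ (pred (S n)))%C with (1 * z ^ n + z * (INR n * z ^ pred n))%C.
  apply (cderive_mult (fun w => w) (fun w => w ^ n)%C); auto. apply cderive_id.
  rewrite S_INR, RtoC_plus. destruct n; simpl; ring.
Qed.

Definition ccont (f : C -> C) (z : C) : Prop :=
  forall eps, 0 < eps -> exists d, 0 < d /\ forall w, Cmod (w - z)%C < d ->
    Cmod (f w - f z)%C < eps.

Lemma cderive_ccont f z l : cderive f z l -> ccont f z.
Proof.
intros H eps Heps. apply cderive_eps with (eps := 1) in H; [|lra].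
destruct H as [d [Hd H]].
assert (Hl := Cmod_ge_0 l).
exists (Rmin d (eps / (Cmod l + 2))). split.
{ apply Rmin_glb_lt; auto. apply Rdiv_lt_0_compat; lra. }
intros w Hw.
assert (Hw1 : Cmod (w - z)%C < d) by (eapply Rlt_le_trans; [exact Hw|apply Rmin_l]).
assert (Hw2 : Cmod (w - z)%C < eps / (Cmod l + 2)) by (eapply Rlt_le_trans; [exact Hw|apply Rmin_r]).
specialize (H w Hw1).
replace (f w - f z)%C with ((f w - f z - l * (w - z)) + l * (w - z))%C by ring.
eapply Rle_lt_trans. apply Cmod_triangle. rewrite Cmod_mult.
apply Rlt_div_r in Hw2; [|lra]. pose proof (Cmod_ge_0 (w - z)%C). nra.
Qed.

Lemma Cmod_le_sum (z : C) : Cmod z <= Rabs (Re z) + Rabs (Im z).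
Proof.
destruct z as [x y]. unfold Cmod, Re, Im; simpl fst; simpl snd.
rewrite <- (sqrt_Rsqr (Rabs x + Rabs y)).
2: { pose proof (Rabs_pos x); pose proof (Rabs_pos y); lra. }
apply sqrt_le_1_alt. rewrite <- (pow2_abs x), <- (pow2_abs y).
unfold Rsqr. pose proof (Rabs_pos x); pose proof (Rabs_pos y). nra.
Qed.

Lemma Re_le_Cmod (z : C) : Rabs (Re z) <= Cmod z.
Proof. eapply Rle_trans; [|apply Rmax_Cmod]. apply Rmax_l. Qed.

Lemma Im_le_Cmod (z : C) : Rabs (Im z) <= Cmod z.
Proof. eapply Rle_trans; [|apply Rmax_Cmod]. apply Rmax_r. Qed.

Lemma Cexp_plus a b : Cexp (a + b)%C = (Cexp a * Cexp b)%C.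
Proof.
destruct a as [a1 a2], b as [b1 b2]. unfold Cexp, Re, Im. simpl.
rewrite exp_plus, cos_plus, sin_plus. unfold Cmult; simpl. f_equal; ring.
Qed.

Lemma Cexp_0 : Cexp (RtoC 0) = RtoC 1.
Proof. unfold Cexp, Re, Im, RtoC; simpl. rewrite exp_0, cos_0, sin_0. f_equal; ring. Qed.

Lemma Cmod_Cexp a : Cmod (Cexp a) = exp (Re a).
Proof.
unfold Cexp, Cmod. simpl fst; simpl snd.
replace ((exp (Re a) * cos (Im a)) ^ 2 + (exp (Re a) * sin (Im a)) ^ 2)
  with (Rsqr (exp (Re a)) * (Rsqr (sin (Im a)) + Rsqr (cos (Im a)))) by (unfold Rsqr; ring).
rewrite sin2_cos2, Rmult_1_r. apply sqrt_Rsqr. left; apply exp_pos.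
Qed.

Lemma Cexp_neq_0 a : Cexp a <> RtoC 0.
Proof. apply Cmod_gt_0. rewrite Cmod_Cexp. apply exp_pos. Qed.

Lemma Cexp_opp a : Cexp (- a)%C = (/ Cexp a)%C.
Proof.
apply Ceq_minus.
assert (H : (Cexp a * (Cexp (- a) - / Cexp a) = 0)%C).
{ replace (Cexp a * (Cexp (- a) - / Cexp a))%C with (Cexp a * Cexp (- a) - 1)%C
    by (field; apply Cexp_neq_0).
  rewrite <- Cexp_plus, Cplus_opp_r, Cexp_0. ring. }
destruct (Ceq_dec (Cexp (- a) - / Cexp a)%C 0) as [E|E]; auto.
exfalso. apply (Cmult_neq_0 _ _ (Cexp_neq_0 a) E H).
Qed.

Lemma derive_at_0_eps (f : R -> R) (l : R) : is_derive f 0 l ->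
  forall eps, 0 < eps -> exists d, 0 < d /\ forall h, Rabs h < d ->
    Rabs (f h - f 0 - l * h) <= eps * Rabs h.
Proof.
intros H eps Heps. apply is_derive_Reals in H.
destruct (H eps Heps) as [d Hd]. exists d; split. apply cond_pos.
intros h Hh. destruct (Req_dec h 0) as [->|Hn].
- rewrite Rmult_0_r, !Rminus_diag, Rabs_R0. lra.
- specialize (Hd h Hn Hh). rewrite Rplus_0_l in Hd.
  replace (f h - f 0 - l * h) with (((f h - f 0) / h - l) * h) by (field; auto).
  rewrite Rabs_mult. apply Rmult_le_compat_r. apply Rabs_pos. lra.
Qed.

(** Componentwise this is the differentiability at 0 of the real functions
[exp], [cos] and [sin]; the functional equation then moves it to every point. *)
Lemma cderive_Cexp_0 : cderive Cexp (RtoC 0) (RtoC 1).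
Proof.
apply cderive_eps. intros eps Heps.
set (e := Rmin 1 (eps / 20)).
assert (He : 0 < e) by (apply Rmin_glb_lt; lra).
assert (He1 : e <= 1) by apply Rmin_l.
assert (He2 : e <= eps / 20) by apply Rmin_r.
destruct (derive_at_0_eps exp 1) with (eps := e) as [d1 [Hd1 H1]]; auto.
{ evar_last. apply is_derive_exp. apply exp_0. }
destruct (derive_at_0_eps cos 0) with (eps := e) as [d2 [Hd2 H2]]; auto.
{ evar_last. apply is_derive_cos. rewrite sin_0. ring. }
destruct (derive_at_0_eps sin 1) with (eps := e) as [d3 [Hd3 H3]]; auto.
{ evar_last. apply is_derive_sin. apply cos_0. }
rewrite exp_0 in H1. rewrite cos_0 in H2. rewrite sin_0 in H3.
exists (Rmin e (Rmin d1 (Rmin d2 d3))). split.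
{ repeat apply Rmin_glb_lt; auto; lra. }
intros w Hw. replace (w - 0)%C with w in * by ring.
rewrite Cexp_0.
assert (Hx := Re_le_Cmod w). assert (Hy := Im_le_Cmod w).
set (x := Re w) in *. set (y := Im w) in *. set (m := Cmod w) in *.
assert (m < e /\ m < d1 /\ m < d2 /\ m < d3) as (Me & M1 & M2 & M3).
{ repeat split; eapply Rlt_le_trans; try exact Hw.
  apply Rmin_l. eapply Rle_trans; [apply Rmin_r|apply Rmin_l].
  eapply Rle_trans; [apply Rmin_r|]. eapply Rle_trans; [apply Rmin_r|apply Rmin_l].
  eapply Rle_trans; [apply Rmin_r|]. eapply Rle_trans; [apply Rmin_r|apply Rmin_r]. }
specialize (H1 x ltac:(lra)). specialize (H2 y ltac:(lra)). specialize (H3 y ltac:(lra)).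
replace (Cexp w - 1 - 1 * w)%C with (exp x * cos y - 1 - x, exp x * sin y - y).
2: { unfold Cexp, x, y. destruct w as [w1 w2]. unfold Re, Im. simpl.
  unfold Cminus, Cplus, Copp, Cmult, RtoC; simpl. f_equal; ring. }
eapply Rle_trans. apply Cmod_le_sum. unfold Re, Im; simpl fst; simpl snd.
assert (Hm : 0 <= m) by apply Cmod_ge_0.
assert (Hc : Rabs (cos y) <= 1) by (apply Rabs_le; pose proof (COS_bound y); lra).
assert (E1 : Rabs (exp x - 1 - x) <= e * m).
{ replace (exp x - 1 - x) with (exp x - 1 - 1 * x) by ring. nra. }
assert (E2 : Rabs (cos y - 1) <= e * m).
{ replace (cos y - 1) with (cos y - 1 - 0 * y) by ring. nra. }
assert (E3 : Rabs (sin y - y) <= e * m).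
{ replace (sin y - y) with (sin y - 0 - 1 * y) by ring. nra. }
assert (E4 : Rabs (exp x - 1) <= 2 * m).
{ replace (exp x - 1) with ((exp x - 1 - x) + x) by ring.
  eapply Rle_trans. apply Rabs_triang. nra. }
assert (E5 : Rabs (sin y) <= 2 * m).
{ replace (sin y) with ((sin y - y) + y) by ring.
  eapply Rle_trans. apply Rabs_triang. nra. }
assert (E6 : Rabs (exp x * cos y - 1 - x) <= 3 * e * m).
{ replace (exp x * cos y - 1 - x) with ((exp x - 1 - x) * cos y + (cos y - 1) * (1 + x)) by ring.
  eapply Rle_trans. apply Rabs_triang. rewrite !Rabs_mult.
  assert (Rabs (1 + x) <= 2). { eapply Rle_trans. apply Rabs_triang. rewrite Rabs_R1. lra. }
  pose proof (Rabs_pos (exp x - 1 - x)). pose proof (Rabs_pos (cos y)).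
  pose proof (Rabs_pos (cos y - 1)). pose proof (Rabs_pos (1 + x)).
  assert (Rabs (exp x - 1 - x) * Rabs (cos y) <= e * m * 1) by (apply Rmult_le_compat; auto).
  assert (Rabs (cos y - 1) * Rabs (1 + x) <= e * m * 2) by (apply Rmult_le_compat; auto). lra. }
assert (E7 : Rabs (exp x * sin y - y) <= 5 * e * m).
{ replace (exp x * sin y - y) with ((exp x - 1) * sin y + (sin y - y)) by ring.
  eapply Rle_trans. apply Rabs_triang. rewrite !Rabs_mult.
  assert (Rabs (exp x - 1) * Rabs (sin y) <= 2 * m * (2 * m)).
  { apply Rmult_le_compat; auto; apply Rabs_pos. }
  nra. }
nra.
Qed.

Lemma cderive_Cexp z : cderive Cexp z (Cexp z).
Proof.
apply cderive_ext_loc with (f := fun w => (Cexp z * Cexp (w - z))%C) (d := 1); [lra| |].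
- intros w _. rewrite <- Cexp_plus. f_equal. ring.
- eapply cderive_eq. apply cderive_mult. apply cderive_const.
  apply (cderive_comp Cexp (fun w => w - z)%C).
  replace (z - z)%C with (RtoC 0) by ring. apply cderive_Cexp_0.
  apply cderive_minus. apply cderive_id. apply cderive_const.
  simpl. ring.
Qed.

(** * Integrals of complex-valued functions of a real variable *)

Definition pcont (p : R -> C) (t : R) : Prop :=
  forall eps, 0 < eps -> exists d, 0 < d /\ forall s, Rabs (s - t) < d ->
    Cmod (p s - p t)%C < eps.

Lemma continuous_R_eps (f : R -> R) (t : R) :
  continuous f t <-> forall eps, 0 < eps -> exists d, 0 < d /\ forall s,
    Rabs (s - t) < d -> Rabs (f s - f t) < eps.
Proof.
split.
- intros H eps Heps.
  destruct (proj1 (filterlim_locally _ _) H (mkposreal eps Heps)) as [d Hd].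
  exists d; split. apply cond_pos. intros s Hs. apply (Hd s Hs).
- intros H. apply filterlim_locally. intros eps.
  destruct (H eps (cond_pos eps)) as [d [Hd H']].
  exists (mkposreal d Hd). intros s Hs. apply (H' s Hs).
Qed.

Lemma Re_minus (z w : C) : Re (z - w)%C = Re z - Re w.
Proof. reflexivity. Qed.
Lemma Im_minus (z w : C) : Im (z - w)%C = Im z - Im w.
Proof. reflexivity. Qed.

Lemma pcont_components (p : R -> C) (t : R) :
  pcont p t <-> continuous (fun s => Re (p s)) t /\ continuous (fun s => Im (p s)) t.
Proof.
rewrite !continuous_R_eps. split.
- intros H; split; intros eps Heps; destruct (H eps Heps) as [d [Hd H']];
    exists d; split; auto; intros s Hs; (eapply Rle_lt_trans; [|exact (H' s Hs)]).
  + rewrite <- Re_minus. apply Re_le_Cmod.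
  + rewrite <- Im_minus. apply Im_le_Cmod.
- intros [H1 H2] eps Heps.
  destruct (H1 (eps / 2)) as [d1 [Hd1 H1']]; [lra|].
  destruct (H2 (eps / 2)) as [d2 [Hd2 H2']]; [lra|].
  exists (Rmin d1 d2); split. apply Rmin_glb_lt; auto.
  intros s Hs. eapply Rle_lt_trans. apply Cmod_le_sum. rewrite Re_minus, Im_minus.
  specialize (H1' s (Rlt_le_trans _ _ _ Hs (Rmin_l _ _))).
  specialize (H2' s (Rlt_le_trans _ _ _ Hs (Rmin_r _ _))). lra.
Qed.

Lemma pcont_comp (g : C -> C) (p : R -> C) (t : R) :
  ccont g (p t) -> pcont p t -> pcont (fun s => g (p s)) t.
Proof.
intros Hg Hp eps Heps. destruct (Hg eps Heps) as [d [Hd H]].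
destruct (Hp d Hd) as [d' [Hd' H']]. exists d'; split; auto.
Qed.

(** Taking the two components separately makes the theory of the real integral
available; the price is a factor 2 in [CInt_bound], which is harmless. *)
Definition CInt (f : R -> C) (a b : R) : C :=
  (RInt (fun t => Re (f t)) a b, RInt (fun t => Im (f t)) a b).

Definition ex_CInt (f : R -> C) (a b : R) : Prop :=
  ex_RInt (fun t => Re (f t)) a b /\ ex_RInt (fun t => Im (f t)) a b.

Lemma ex_CInt_cont f a b : a <= b -> (forall t, a <= t <= b -> pcont f t) -> ex_CInt f a b.
Proof.
intros Hab H.
assert (K : forall t, Rmin a b <= t <= Rmax a b -> pcont f t).
{ rewrite Rmin_left, Rmax_right by auto. exact H. }
split.
- apply (ex_RInt_continuous (V := R_CompleteNormedModule) (fun t => Re (f t))).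
  intros z Hz. exact (proj1 (proj1 (pcont_components f z) (K z Hz))).
- apply (ex_RInt_continuous (V := R_CompleteNormedModule) (fun t => Im (f t))).
  intros z Hz. exact (proj2 (proj1 (pcont_components f z) (K z Hz))).
Qed.

Lemma CInt_ext f g a b : a <= b -> (forall t, a <= t <= b -> f t = g t) -> CInt f a b = CInt g a b.
Proof.
intros Hab H. unfold CInt. f_equal; apply RInt_ext; rewrite Rmin_left, Rmax_right by auto;
  intros t Ht; rewrite H; auto; lra.
Qed.

Lemma CInt_plus f g a b : ex_CInt f a b -> ex_CInt g a b ->
  CInt (fun t => f t + g t)%C a b = (CInt f a b + CInt g a b)%C.
Proof.
intros [H1 H2] [H3 H4]. unfold CInt, Cplus; simpl. f_equal.
- apply (RInt_plus (V := R_CompleteNormedModule)); auto.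
- apply (RInt_plus (V := R_CompleteNormedModule)); auto.
Qed.

Lemma ex_CInt_plus f g a b : ex_CInt f a b -> ex_CInt g a b ->
  ex_CInt (fun t => f t + g t)%C a b.
Proof.
intros [H1 H2] [H3 H4]. split.
- apply (ex_RInt_plus (V := R_NormedModule) _ _ a b H1 H3).
- apply (ex_RInt_plus (V := R_NormedModule) _ _ a b H2 H4).
Qed.

Lemma is_CInt_scal (c : C) f a b : ex_CInt f a b ->
  is_RInt (fun t => Re (c * f t)%C) a b (Re (c * CInt f a b)%C) /\
  is_RInt (fun t => Im (c * f t)%C) a b (Im (c * CInt f a b)%C).
Proof.
intros [H1 H2]. apply (RInt_correct (V := R_CompleteNormedModule)) in H1. apply (RInt_correct (V := R_CompleteNormedModule)) in H2.
destruct c as [c1 c2]. split.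
- apply (is_RInt_minus (V := R_NormedModule) (fun t => c1 * Re (f t)) (fun t => c2 * Im (f t))).
  apply (is_RInt_scal (V := R_NormedModule)); auto.
  apply (is_RInt_scal (V := R_NormedModule)); auto.
- apply (is_RInt_plus (V := R_NormedModule) (fun t => c1 * Im (f t)) (fun t => c2 * Re (f t))).
  apply (is_RInt_scal (V := R_NormedModule)); auto.
  apply (is_RInt_scal (V := R_NormedModule)); auto.
Qed.

Lemma CInt_scal (c : C) f a b : ex_CInt f a b ->
  CInt (fun t => c * f t)%C a b = (c * CInt f a b)%C.
Proof.
intros H. destruct (is_CInt_scal c f a b H) as [H1 H2].
unfold CInt at 1. apply (is_RInt_unique (V := R_CompleteNormedModule)) in H1. apply (is_RInt_unique (V := R_CompleteNormedModule)) in H2.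
rewrite H1, H2. destruct (c * CInt f a b)%C; reflexivity.
Qed.

Lemma ex_CInt_scal (c : C) f a b : ex_CInt f a b -> ex_CInt (fun t => c * f t)%C a b.
Proof.
intros H. destruct (is_CInt_scal c f a b H) as [H1 H2]. split; eexists; eauto.
Qed.

Lemma CInt_Chasles f a b c : ex_CInt f a b -> ex_CInt f b c ->
  (CInt f a b + CInt f b c)%C = CInt f a c.
Proof.
intros [H1 H2] [H3 H4]. unfold CInt, Cplus; simpl. f_equal;
apply (RInt_Chasles (V := R_CompleteNormedModule)); auto.
Qed.

Lemma CInt_bound f a b M : a <= b -> ex_CInt f a b ->
  (forall t, a <= t <= b -> Cmod (f t) <= M) -> Cmod (CInt f a b) <= 2 * M * (b - a).
Proof.
intros Hab [H1 H2] HM. eapply Rle_trans. apply Cmod_le_sum.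
change (Rabs (RInt (fun t => Re (f t)) a b) + Rabs (RInt (fun t => Im (f t)) a b)
  <= 2 * M * (b - a)).
assert (E1 : Rabs (RInt (fun t => Re (f t)) a b) <= (b - a) * M).
{ apply abs_RInt_le_const; auto. intros t Ht. eapply Rle_trans. apply Re_le_Cmod. auto. }
assert (E2 : Rabs (RInt (fun t => Im (f t)) a b) <= (b - a) * M).
{ apply abs_RInt_le_const; auto. intros t Ht. eapply Rle_trans. apply Im_le_Cmod. auto. }
lra.
Qed.

(** * Goursat's theorem for rectangles *)

Definition rect_int (g : C -> C) (a b c d : R) : C :=
  (CInt (fun x => g (x, c)) a b - CInt (fun x => g (x, d)) a b
   + Ci * (CInt (fun y => g (b, y)) c d - CInt (fun y => g (a, y)) c d))%C.

Definition rect_ccont (g : C -> C) (a b c d : R) : Prop :=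
  a <= b /\ c <= d /\ forall x y, a <= x <= b -> c <= y <= d -> ccont g (x, y).

Lemma pcont_hor y t : pcont (fun x => (x, y)) t.
Proof.
intros eps Heps. exists eps; split; auto. intros s Hs.
eapply Rle_lt_trans. apply Cmod_le_sum. unfold Re, Im; simpl.
replace (y + - y) with 0 by ring. rewrite Rabs_R0. unfold Rminus in Hs. lra.
Qed.

Lemma pcont_ver x t : pcont (fun y => (x, y)) t.
Proof.
intros eps Heps. exists eps; split; auto. intros s Hs.
eapply Rle_lt_trans. apply Cmod_le_sum. unfold Re, Im; simpl.
replace (x + - x) with 0 by ring. rewrite Rabs_R0. unfold Rminus in Hs. lra.
Qed.

Lemma rect_ccont_hor g a b c d a' b' y : rect_ccont g a b c d -> a <= a' -> a' <= b' -> b' <= b ->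
  c <= y <= d -> ex_CInt (fun x => g (x, y)) a' b'.
Proof.
intros (H1 & H2 & H3) Ha Hab Hb Hy. apply ex_CInt_cont; auto.
intros t Ht. apply (pcont_comp g). apply H3; auto; lra. apply pcont_hor.
Qed.

Lemma rect_ccont_ver g a b c d c' d' x : rect_ccont g a b c d -> c <= c' -> c' <= d' -> d' <= d ->
  a <= x <= b -> ex_CInt (fun y => g (x, y)) c' d'.
Proof.
intros (H1 & H2 & H3) Ha Hab Hb Hy. apply ex_CInt_cont; auto.
intros t Ht. apply (pcont_comp g). apply H3; auto; lra. apply pcont_ver.
Qed.

Lemma rect_int_quarter g a m b c n d : rect_ccont g a b c d -> a <= m <= b -> c <= n <= d ->
  rect_int g a b c d =
  (rect_int g a m c n + rect_int g m b c n + rect_int g a m n d + rect_int g m b n d)%C.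
Proof.
intros H Hm Hn. assert (H' := H). destruct H' as (H1 & H2 & _). unfold rect_int.
rewrite <- (CInt_Chasles (fun x => g (x, c)) a m b) by (eapply rect_ccont_hor; eauto; lra).
rewrite <- (CInt_Chasles (fun x => g (x, d)) a m b) by (eapply rect_ccont_hor; eauto; lra).
rewrite <- (CInt_Chasles (fun y => g (a, y)) c n d) by (eapply rect_ccont_ver; eauto; lra).
rewrite <- (CInt_Chasles (fun y => g (b, y)) c n d) by (eapply rect_ccont_ver; eauto; lra).
ring.
Qed.

Lemma RInt_affine p q a b : is_RInt (fun t => p + q * t) a b (p * (b - a) + q * (b * b - a * a) / 2).
Proof.
evar_last. apply (is_RInt_derive (fun t => p * t + q * (t * t) / 2)).
- intros x _. auto_derive; auto. field.
- intros x _. apply (continuous_plus (V := R_NormedModule)). apply continuous_const.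
  apply (continuous_mult (K := R_AbsRing)). apply continuous_const. apply continuous_id.
- unfold minus, plus, opp; simpl. field.
Qed.

Lemma CInt_affine (p q : C) a b (f : R -> C) : (forall t, f t = p + q * RtoC t)%C ->
  CInt f a b = (p * RtoC (b - a) + q * RtoC ((b * b - a * a) / 2))%C.
Proof.
intros Hf. destruct p as [p1 p2], q as [q1 q2]. unfold CInt.
rewrite (RInt_ext _ (fun t => p1 + q1 * t)).
2: { intros t _. rewrite Hf. unfold Re; simpl. ring. }
rewrite (RInt_ext (fun t => Im _) (fun t => p2 + q2 * t)).
2: { intros t _. rewrite Hf. unfold Im; simpl. ring. }
rewrite (is_RInt_unique (V := R_CompleteNormedModule) _ _ _ _ (RInt_affine p1 q1 a b)).
rewrite (is_RInt_unique (V := R_CompleteNormedModule) _ _ _ _ (RInt_affine p2 q2 a b)).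
unfold Cplus, Cmult, RtoC; simpl. f_equal; field.
Qed.

(** An affine function has a primitive; here the four sides are integrated
explicitly. *)
Lemma rect_int_affine (k l : C) a b c d : rect_int (fun w => k + l * w)%C a b c d = RtoC 0.
Proof.
unfold rect_int.
rewrite (CInt_affine (k + l * (Ci * RtoC c))%C l a b (fun x => k + l * (x, c))%C).
2: { intros t. destruct l; unfold Ci, Cplus, Cmult, RtoC; simpl. f_equal; ring. }
rewrite (CInt_affine (k + l * (Ci * RtoC d))%C l a b (fun x => k + l * (x, d))%C).
2: { intros t. destruct l; unfold Ci, Cplus, Cmult, RtoC; simpl. f_equal; ring. }
rewrite (CInt_affine (k + l * RtoC b)%C (l * Ci)%C c d (fun y => k + l * (b, y))%C).
2: { intros t. destruct l; unfold Ci, Cplus, Cmult, RtoC; simpl. f_equal; ring. }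
rewrite (CInt_affine (k + l * RtoC a)%C (l * Ci)%C c d (fun y => k + l * (a, y))%C).
2: { intros t. destruct l; unfold Ci, Cplus, Cmult, RtoC; simpl. f_equal; ring. }
destruct k, l; unfold Ci, Cminus, Copp, Cplus, Cmult, RtoC; simpl. f_equal; field.
Qed.

Lemma rect_int_plus f g a b c d : rect_ccont f a b c d -> rect_ccont g a b c d ->
  rect_int (fun w => f w + g w)%C a b c d = (rect_int f a b c d + rect_int g a b c d)%C.
Proof.
intros Hf Hg. assert (H' := Hf). destruct H' as (H1 & H2 & _). unfold rect_int.
rewrite (CInt_plus (fun x => f (x, c)) (fun x => g (x, c))) by (eapply rect_ccont_hor; eauto; lra).
rewrite (CInt_plus (fun x => f (x, d)) (fun x => g (x, d))) by (eapply rect_ccont_hor; eauto; lra).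
rewrite (CInt_plus (fun x => f (b, x)) (fun x => g (b, x))) by (eapply rect_ccont_ver; eauto; lra).
rewrite (CInt_plus (fun x => f (a, x)) (fun x => g (a, x))) by (eapply rect_ccont_ver; eauto; lra).
ring.
Qed.

Lemma rect_int_bound g a b c d M : rect_ccont g a b c d ->
  (forall x y, a <= x <= b -> c <= y <= d -> Cmod (g (x, y)) <= M) ->
  Cmod (rect_int g a b c d) <= 4 * M * ((b - a) + (d - c)).
Proof.
intros H HM. assert (H' := H). destruct H' as (H1 & H2 & _). unfold rect_int.
assert (E1 : Cmod (CInt (fun x => g (x, c)) a b) <= 2 * M * (b - a)).
{ apply CInt_bound; auto. eapply rect_ccont_hor; eauto; lra. intros; apply HM; lra. }
assert (E2 : Cmod (CInt (fun x => g (x, d)) a b) <= 2 * M * (b - a)).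
{ apply CInt_bound; auto. eapply rect_ccont_hor; eauto; lra. intros; apply HM; lra. }
assert (E3 : Cmod (CInt (fun y => g (a, y)) c d) <= 2 * M * (d - c)).
{ apply CInt_bound; auto. eapply rect_ccont_ver; eauto; lra. intros; apply HM; lra. }
assert (E4 : Cmod (CInt (fun y => g (b, y)) c d) <= 2 * M * (d - c)).
{ apply CInt_bound; auto. eapply rect_ccont_ver; eauto; lra. intros; apply HM; lra. }
eapply Rle_trans. apply Cmod_triangle. rewrite Cmod_mult, Cmod_Ci, Rmult_1_l.
unfold Cminus.
eapply Rle_trans. apply Rplus_le_compat; apply Cmod_triangle. rewrite !Cmod_opp. lra.
Qed.

(** The bisection produces the abscissae and the ordinates of the lower left
corners in this form. *)
Lemma nested_point (u : nat -> R) (L : R) : 0 <= L ->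
  (forall n, u n <= u (S n) /\ u (S n) <= u n + L * (/ 2) ^ S n) ->
  exists X, forall n, u n <= X <= u n + L * (/ 2) ^ n.
Proof.
intros HL H.
assert (Hk : forall n k, u n <= u (n + k)%nat /\ u (n + k)%nat + L * (/ 2) ^ (n + k) <= u n + L * (/ 2) ^ n).
{ intros n k. induction k. rewrite Nat.add_0_r. lra.
  rewrite Nat.add_succ_r. destruct (H (n + k)%nat) as [A B]. simpl in B |- *. lra. }
assert (Hp : forall n, 0 <= L * (/ 2) ^ n) by (intros n; apply Rmult_le_pos; auto; apply pow_le; lra).
destruct (ex_finite_lim_seq_incr u (u 0%nat + L)) as [X HX].
- intros n; apply H.
- intros n. destruct (Hk 0%nat n) as [_ B]. simpl in B. specialize (Hp n). lra.
- exists X. intros n. split.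
  + apply (is_lim_seq_incr_compare u); auto. intros m; apply H.
  + apply (is_lim_seq_le (fun k => u (k + n)%nat) (fun _ => u n + L * (/ 2) ^ n) X (u n + L * (/ 2) ^ n)).
    * intros k. rewrite Nat.add_comm. destruct (Hk n k) as [_ B]. specialize (Hp (n + k)%nat). lra.
    * apply is_lim_seq_incr_n; auto.
    * apply is_lim_seq_const.
Qed.

(** If the integral were of modulus [m > 0], one of the four quarters would
carry at least [m/4], and so on: the rectangle scaled by [s = 2^-n] carries at
least [m s^2].  At the limit point the function is affine up to [eps |w - p|],
and affine functions integrate to 0, so that the same integral is at most a
constant times [eps s^2]. *)
Lemma goursat g a b c d : a <= b -> c <= d ->
  (forall x y, a <= x <= b -> c <= y <= d -> exists l, cderive g (x, y) l) ->
  rect_int g a b c d = RtoC 0.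
Proof.
intros Hab Hcd Hg. apply NNPP. intros Hne.
set (A := b - a). set (B := d - c). set (m := Cmod (rect_int g a b c d)).
assert (Hm : 0 < m) by (apply Cmod_gt_0; auto).
assert (HA : 0 <= A) by (unfold A; lra). assert (HB : 0 <= B) by (unfold B; lra).
(* The rectangle of lower left corner [p], scaled by [s], carries too large an
   integral. *)
set (bad := fun (p : R * R) (s : R) => a <= fst p /\ fst p + s * A <= b /\ c <= snd p /\
   snd p + s * B <= d /\
   m * (s * s) <= Cmod (rect_int g (fst p) (fst p + s * A) (snd p) (snd p + s * B))).
assert (ok : forall a' b' c' d', a <= a' -> a' <= b' -> b' <= b -> c <= c' -> c' <= d' -> d' <= d ->
   rect_ccont g a' b' c' d').
{ intros. repeat split; auto. intros x y Hx Hy. destruct (Hg x y) as [l Hl]; try lra.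
  eapply cderive_ccont; eauto. }
assert (step : forall p s, 0 < s -> bad p s -> exists q,
   fst p <= fst q <= fst p + A * (s / 2) /\ snd p <= snd q <= snd p + B * (s / 2) /\ bad q (s / 2)).
{ intros [x y] s Hs (B1 & B2 & B3 & B4 & B5). simpl in *.
  assert (0 <= s * A) by nra. assert (0 <= s * B) by nra.
  rewrite (rect_int_quarter g x (x + s / 2 * A) (x + s * A) y (y + s / 2 * B) (y + s * B)) in B5;
    [ | apply ok; lra | lra | lra ].
  replace (x + s * A) with (x + s / 2 * A + s / 2 * A) in B5 by field.
  replace (y + s * B) with (y + s / 2 * B + s / 2 * B) in B5 by field.
  apply NNPP. intros Hno.
  assert (Hq : forall x' y', x <= x' <= x + A * (s / 2) -> y <= y' <= y + B * (s / 2) ->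
     Cmod (rect_int g x' (x' + s / 2 * A) y' (y' + s / 2 * B)) < m * (s / 2 * (s / 2))).
  { intros x' y' Hx' Hy'. apply Rnot_le_lt. intros Hle. apply Hno. exists (x', y').
    simpl. split; [exact Hx'|]. split; [exact Hy'|]. unfold bad; simpl. repeat split; auto; lra. }
  pose proof (Hq x y ltac:(lra) ltac:(lra)) as Q1.
  pose proof (Hq (x + s / 2 * A) y ltac:(lra) ltac:(lra)) as Q2.
  pose proof (Hq x (y + s / 2 * B) ltac:(lra) ltac:(lra)) as Q3.
  pose proof (Hq (x + s / 2 * A) (y + s / 2 * B) ltac:(lra) ltac:(lra)) as Q4.
  apply (Rlt_irrefl (m * (s * s))). eapply Rle_lt_trans. exact B5.
  eapply Rle_lt_trans. apply Cmod_triangle.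
  eapply Rle_lt_trans. apply Rplus_le_compat_r. apply Cmod_triangle.
  eapply Rle_lt_trans. apply Rplus_le_compat_r. apply Rplus_le_compat_r. apply Cmod_triangle.
  lra. }
set (next := fun p s => epsilon (inhabits p) (fun q =>
   fst p <= fst q <= fst p + A * (s / 2) /\ snd p <= snd q <= snd p + B * (s / 2) /\ bad q (s / 2))).
set (P := fix P n := match n with O => (a, c) | S n => next (P n) ((/ 2) ^ n) end).
assert (Hs : forall n, 0 < (/ 2) ^ n) by (intros; apply pow_lt; lra).
assert (HP : forall n, bad (P n) ((/ 2) ^ n)).
{ induction n.
  - unfold bad; simpl. rewrite !Rmult_1_l, Rmult_1_r. replace (a + A) with b by (unfold A; ring).
    replace (c + B) with d by (unfold B; ring). repeat split; try lra. apply Rle_refl.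
  - replace ((/ 2) ^ S n) with ((/ 2) ^ n / 2) by (simpl; field).
    simpl. apply (epsilon_spec (inhabits (P n)) _ (step (P n) ((/ 2) ^ n) (Hs n) IHn)). }
assert (HPs : forall n, fst (P n) <= fst (P (S n)) <= fst (P n) + A * (/ 2) ^ S n /\
   snd (P n) <= snd (P (S n)) <= snd (P n) + B * (/ 2) ^ S n).
{ intros n. replace ((/ 2) ^ S n) with ((/ 2) ^ n / 2) by (simpl; field).
  pose proof (epsilon_spec (inhabits (P n)) _ (step (P n) ((/ 2) ^ n) (Hs n) (HP n))) as E.
  split; apply E. }
destruct (nested_point (fun n => fst (P n)) A HA) as [X HX]; [intros n; apply HPs|].
destruct (nested_point (fun n => snd (P n)) B HB) as [Y HY]; [intros n; apply HPs|].
destruct (Hg X Y) as [l Hl].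
{ specialize (HX 0%nat). simpl in HX. unfold A in HX. lra. }
{ specialize (HY 0%nat). simpl in HY. unfold B in HY. lra. }
(* Small enough for [4 e (A + B)^2 < m]. *)
set (e := m / (8 * ((A + B) * (A + B)) + 1)).
assert (HAB : 0 <= (A + B) * (A + B)) by nra.
assert (He : 0 < e) by (apply Rdiv_lt_0_compat; lra).
destruct (proj1 (cderive_eps _ _ _) Hl e He) as [dl [Hdl Hd]].
assert (Hsmall : exists n, (/ 2) ^ n * (A + B) < dl).
{ destruct (pow_lt_1_zero (/ 2)) with (y := dl / (A + B + 1)) as [N HN].
  - rewrite Rabs_pos_eq; lra.
  - apply Rdiv_lt_0_compat; lra.
  - exists N. specialize (HN N (Nat.le_refl N)). rewrite Rabs_pos_eq in HN by (left; auto).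
    apply Rlt_div_r in HN; [|lra]. specialize (Hs N). nra. }
destruct Hsmall as [n Hn].
specialize (HX n). specialize (HY n). destruct (HP n) as (B1 & B2 & B3 & B4 & B5).
set (s := (/ 2) ^ n) in *. set (x := fst (P n)) in *. set (y := snd (P n)) in *.
assert (Hs0 : 0 < s) by apply Hs.
assert (0 <= s * A) by nra. assert (0 <= s * B) by nra.
set (p := (X, Y) : C) in *.
set (r := fun w => (g w + ((- (g p - l * p)) + (- l) * w))%C).
assert (okaff : forall k q : C, rect_ccont (fun w => k + q * w)%C x (x + s * A) y (y + s * B)).
{ intros k q. repeat split; try lra. intros u v _ _. eapply cderive_ccont.
  apply cderive_plus. apply cderive_const. apply cderive_mult. apply cderive_const. apply cderive_id. }
assert (okg : rect_ccont g x (x + s * A) y (y + s * B)) by (apply ok; lra).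
assert (Er : rect_int r x (x + s * A) y (y + s * B) = rect_int g x (x + s * A) y (y + s * B)).
{ unfold r. rewrite (rect_int_plus g (fun w => - (g p - l * p) + - l * w)%C); auto.
  rewrite rect_int_affine. ring. }
assert (okr : rect_ccont r x (x + s * A) y (y + s * B)).
{ repeat split; try lra. intros u v Hu Hv. destruct (Hg u v) as [l' Hl']; try lra.
  eapply cderive_ccont. apply cderive_plus. exact Hl'.
  apply cderive_plus. apply cderive_const. apply cderive_mult. apply cderive_const. apply cderive_id. }
assert (Bd : Cmod (rect_int r x (x + s * A) y (y + s * B)) <=
   4 * (e * (s * (A + B))) * ((x + s * A - x) + (y + s * B - y))).
{ apply rect_int_bound; auto. intros u v Hu Hv.
  assert (Hw : Cmod ((u, v) - p)%C <= s * (A + B)).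
  { eapply Rle_trans. apply Cmod_le_sum. unfold p, Re, Im; simpl.
    assert (Rabs (u + - X) <= s * A) by (apply Rabs_le; lra).
    assert (Rabs (v + - Y) <= s * B) by (apply Rabs_le; lra). lra. }
  replace (r (u, v)) with (g (u, v) - g p - l * ((u, v) - p))%C by (unfold r; ring).
  eapply Rle_trans. apply Hd. lra. apply Rmult_le_compat_l; lra. }
rewrite Er in Bd.
assert (m * (s * s) <= 4 * e * ((A + B) * (A + B)) * (s * s)) by lra.
assert (Hm4 : m <= 4 * e * ((A + B) * (A + B))).
{ apply Rmult_le_reg_r with (s * s); auto. nra. }
assert (He' : e * (8 * ((A + B) * (A + B)) + 1) = m) by (unfold e; field; lra).
lra.
Qed.

(** * Integrals over circles centred at the origin *)

Definition polar (r t : R) : C := (r * cos t, r * sin t).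

Lemma Cexp_polar x y : Cexp (x, y) = polar (exp x) y.
Proof. reflexivity. Qed.

Lemma polar_mult r s t u : (polar r t * polar s u)%C = polar (r * s) (t + u).
Proof.
unfold polar, Cmult; simpl. rewrite cos_plus, sin_plus. f_equal; ring.
Qed.

Lemma polar_0 r : polar r 0 = RtoC r.
Proof. unfold polar, RtoC. rewrite cos_0, sin_0. f_equal; ring. Qed.

Lemma polar_pow r t n : (polar r t ^ n)%C = polar (r ^ n) (INR n * t).
Proof.
induction n.
- simpl. rewrite Rmult_0_l, polar_0. reflexivity.
- rewrite Cpow_S, IHn, polar_mult, S_INR. simpl. f_equal. ring.
Qed.

Lemma Cmod_polar r t : 0 <= r -> Cmod (polar r t) = r.
Proof.
intros Hr. unfold Cmod, polar; simpl fst; simpl snd.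
replace ((r * cos t) ^ 2 + (r * sin t) ^ 2) with (Rsqr r * (Rsqr (sin t) + Rsqr (cos t)))
  by (unfold Rsqr; ring).
rewrite sin2_cos2, Rmult_1_r. apply sqrt_Rsqr; auto.
Qed.

Lemma polar_neq_0 r t : 0 < r -> polar r t <> RtoC 0.
Proof. intros Hr. apply Cmod_gt_0. rewrite Cmod_polar; lra. Qed.

(** The inverse of a point of the circle is a negative rotation, which turns
powers of the inverse into trigonometric functions. *)
Lemma polar_inv r t : 0 < r -> (/ polar r t)%C = polar (/ r) (- t).
Proof.
intros Hr. assert (H := polar_neq_0 r t Hr).
assert (E : (polar r t * polar (/ r) (- t))%C = RtoC 1).
{ rewrite polar_mult. rewrite Rinv_r by lra. rewrite Rplus_opp_r. apply polar_0. }
replace (polar (/ r) (- t)) with (/ polar r t * (polar r t * polar (/ r) (- t)))%C by (field; auto).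
rewrite E. ring.
Qed.

Lemma polar_2PI r : polar r (2 * PI) = polar r 0.
Proof. unfold polar. rewrite cos_2PI, sin_2PI, cos_0, sin_0. reflexivity. Qed.

(** Up to the factor [2 pi], the mean value of [k] over the circle of radius
[r]. *)
Definition circ_int (k : C -> C) (r : R) : C := CInt (fun t => k (polar r t)) 0 (2 * PI).

Lemma continuity_2d_polar x y : continuity_2d_pt (fun t s => s * cos t) x y /\
  continuity_2d_pt (fun t s => s * sin t) x y.
Proof.
split; apply continuity_2d_pt_mult; try apply continuity_2d_pt_id2.
- apply (continuity_1d_2d_pt_comp cos (fun t s => t)). apply continuity_cos. apply continuity_2d_pt_id1.
- apply (continuity_1d_2d_pt_comp sin (fun t s => t)). apply continuity_sin. apply continuity_2d_pt_id1.
Qed.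

Lemma polar_cont s t eps : 0 < eps -> exists d, 0 < d /\ forall s' t',
  Rabs (t' - t) < d -> Rabs (s' - s) < d -> Cmod (polar s' t' - polar s t)%C < eps.
Proof.
intros Heps. destruct (continuity_2d_polar t s) as [H1 H2].
assert (Hp : 0 < eps / 2) by lra.
destruct (H1 (mkposreal _ Hp)) as [d1 H1']. destruct (H2 (mkposreal _ Hp)) as [d2 H2'].
exists (Rmin d1 d2). split. apply Rmin_glb_lt; apply cond_pos.
intros s' t' Ht Hs.
specialize (H1' t' s' (Rlt_le_trans _ _ _ Ht (Rmin_l _ _)) (Rlt_le_trans _ _ _ Hs (Rmin_l _ _))).
specialize (H2' t' s' (Rlt_le_trans _ _ _ Ht (Rmin_r _ _)) (Rlt_le_trans _ _ _ Hs (Rmin_r _ _))).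
simpl in H1', H2'. eapply Rle_lt_trans. apply Cmod_le_sum. rewrite Re_minus, Im_minus.
unfold polar, Re, Im; simpl. lra.
Qed.

Lemma pcont_polar r t : pcont (polar r) t.
Proof.
intros eps Heps. destruct (polar_cont r t eps Heps) as [d [Hd H]].
exists d; split; auto. intros s Hs. apply H; auto. rewrite Rminus_diag, Rabs_R0. auto.
Qed.

Lemma two_PI_pos : 0 < 2 * PI.
Proof. pose proof PI_RGT_0. lra. Qed.

Lemma ex_circ_int k r : (forall t, ccont k (polar r t)) ->
  ex_CInt (fun t => k (polar r t)) 0 (2 * PI).
Proof.
intros H. apply ex_CInt_cont. pose proof two_PI_pos; lra.
intros t _. apply (pcont_comp k). auto. apply pcont_polar.
Qed.

Lemma exp_mono x y : x <= y -> exp x <= exp y.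
Proof. intros [H| ->]; [left; apply exp_increasing; auto | right; auto]. Qed.

(** The exponential maps the rectangle [[ln r1, ln r2] x [0, 2 pi]] onto the
annulus.  The two horizontal sides have the same image, so their contributions
cancel and the vertical sides must agree. *)
Lemma circ_int_annulus k r1 r2 : 0 < r1 -> r1 <= r2 ->
  (forall z, r1 <= Cmod z <= r2 -> exists l, cderive k z l) ->
  circ_int k r1 = circ_int k r2.
Proof.
intros H1 H12 Hk.
assert (Hl : ln r1 <= ln r2).
{ destruct H12 as [H12|H12]; [left; apply ln_increasing; auto | subst; right; auto]. }
assert (G := goursat (fun w => k (Cexp w)) (ln r1) (ln r2) 0 (2 * PI) Hl (Rlt_le _ _ two_PI_pos)).
assert (G' : rect_int (fun w => k (Cexp w)) (ln r1) (ln r2) 0 (2 * PI) = RtoC 0).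
{ apply G. intros x y Hx Hy. destruct (Hk (Cexp (x, y))) as [l Hl'].
  - rewrite Cmod_Cexp. unfold Re; simpl.
    rewrite <- (exp_ln r1) at 1 by lra. rewrite <- (exp_ln r2) by lra.
    split; apply exp_mono; lra.
  - eexists. apply (cderive_comp k Cexp). exact Hl'. apply cderive_Cexp. }
unfold rect_int in G'.
rewrite (CInt_ext (fun x => k (Cexp (x, 0))) (fun x => k (Cexp (x, 2 * PI)))) in G'; auto.
2: { intros t _. rewrite !Cexp_polar, polar_2PI. reflexivity. }
unfold circ_int.
assert (E : forall r, 0 < r -> CInt (fun t => k (polar r t)) 0 (2 * PI)
   = CInt (fun y => k (Cexp (ln r, y))) 0 (2 * PI)).
{ intros r Hr. apply CInt_ext. pose proof two_PI_pos; lra. intros t _.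
  rewrite Cexp_polar, exp_ln; auto. }
rewrite !E by lra.
set (u := CInt (fun y => k (Cexp (ln r1, y))) 0 (2 * PI)) in *.
set (v := CInt (fun y => k (Cexp (ln r2, y))) 0 (2 * PI)) in *.
assert (Z : (Ci * (v - u))%C = RtoC 0) by (rewrite <- G'; ring).
apply Ceq_minus. replace (u - v)%C with (Ci * (Ci * (v - u)))%C.
- rewrite Z. ring.
- destruct u, v; unfold Ci, Cminus, Copp, Cplus, Cmult; simpl. f_equal; ring.
Qed.

(** Uniform continuity of the integrand in the angle.  Negative radii are allowed
so that the radius 0 is an interior point. *)
Lemma circ_int_cont k s0 : (forall t, ccont k (polar s0 t)) ->
  (forall s t, Rabs s < 1 -> ccont k (polar s t)) -> Rabs s0 < 1 ->
  forall eps, 0 < eps -> exists d, 0 < d /\ forall s, Rabs s < 1 -> Rabs (s - s0) < d ->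
    Cmod (circ_int k s - circ_int k s0)%C <= eps.
Proof.
intros Hk Hk' Hs0 eps Heps. pose proof two_PI_pos as Hpi.
set (e := eps / (2 * (2 * PI)) / 2).
assert (He : 0 < e) by (unfold e; apply Rdiv_lt_0_compat; [apply Rdiv_lt_0_compat|]; lra).
assert (C2 : forall x e', 0 < e' -> exists d, 0 < d /\ forall t s, Rabs (t - x) < d ->
   Rabs (s - s0) < d -> Cmod (k (polar s t) - k (polar s0 x))%C < e').
{ intros x e' He'. destruct (Hk x e' He') as [d1 [Hd1 H1]].
  destruct (polar_cont s0 x d1 Hd1) as [d2 [Hd2 H2]]. exists d2; split; auto. }
destruct (uniform_continuity_2d_1d (fun t s => Re (k (polar s t))) 0 (2 * PI) s0) with
  (eps := mkposreal e He) as [d1 H1].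
{ intros x _ [e' He']. destruct (C2 x e' He') as [d [Hd H]]. exists (mkposreal d Hd).
  intros u v Hu Hv. simpl. rewrite <- Re_minus. eapply Rle_lt_trans. apply Re_le_Cmod. auto. }
destruct (uniform_continuity_2d_1d (fun t s => Im (k (polar s t))) 0 (2 * PI) s0) with
  (eps := mkposreal e He) as [d2 H2].
{ intros x _ [e' He']. destruct (C2 x e' He') as [d [Hd H]]. exists (mkposreal d Hd).
  intros u v Hu Hv. simpl. rewrite <- Im_minus. eapply Rle_lt_trans. apply Im_le_Cmod. auto. }
exists (Rmin d1 d2). split. apply Rmin_glb_lt; apply cond_pos.
intros s Hs1 Hs. unfold circ_int.
assert (Hex : forall s, Rabs s < 1 -> ex_CInt (fun t => k (polar s t)) 0 (2 * PI)).
{ intros s' Hs'. apply ex_circ_int. auto. }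
replace (CInt (fun t => k (polar s t)) 0 (2 * PI) - CInt (fun t => k (polar s0 t)) 0 (2 * PI))%C
  with (CInt (fun t => k (polar s t) + (- (1)) * k (polar s0 t))%C 0 (2 * PI)).
2: { rewrite CInt_plus, CInt_scal; auto. ring. apply ex_CInt_scal; auto. }
replace eps with (2 * (2 * e) * (2 * PI - 0)) by (unfold e; field; lra).
apply CInt_bound. lra. apply ex_CInt_plus; auto. apply ex_CInt_scal; auto.
intros t Ht. replace (k (polar s t) + - (1) * k (polar s0 t))%C with (k (polar s t) - k (polar s0 t))%C by ring.
assert (Hsd1 := Rlt_le_trans _ _ _ Hs (Rmin_l _ _)). assert (Hsd2 := Rlt_le_trans _ _ _ Hs (Rmin_r _ _)).
pose proof (cond_pos d1) as P1. pose proof (cond_pos d2) as P2.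
apply Rabs_def2 in Hsd1. apply Rabs_def2 in Hsd2.
specialize (H1 t s0 t s Ht ltac:(lra) Ht ltac:(lra) ltac:(rewrite Rminus_diag, Rabs_R0; lra)).
specialize (H2 t s0 t s Ht ltac:(lra) Ht ltac:(lra) ltac:(rewrite Rminus_diag, Rabs_R0; lra)).
simpl in H1, H2. eapply Rle_trans. apply Cmod_le_sum. rewrite Re_minus, Im_minus. lra.
Qed.

Lemma Cmod_minus_small_eq (u v : C) : (forall eps, 0 < eps -> Cmod (u - v)%C <= eps) -> u = v.
Proof.
intros H. apply Ceq_minus. apply Cmod_eq_0.
apply Rle_antisym; [|apply Cmod_ge_0].
apply Rnot_lt_le. intros Hlt. specialize (H (Cmod (u - v)%C / 2) ltac:(lra)). lra.
Qed.

(** * Cauchy's formula for the disk *)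

Definition difference_quotient (f : C -> C) (zeta d z : C) : C :=
  if Ceq_dec z zeta then d else ((f z - f zeta) / (z - zeta))%C.

(** With the derivative as its value at [zeta], the difference quotient is
continuous there; differentiability at [zeta] is not available yet. *)
Lemma difference_quotient_ccont_at f zeta d : cderive f zeta d -> ccont (difference_quotient f zeta d) zeta.
Proof.
intros H eps Heps. destruct (proj1 (cderive_eps _ _ _) H (eps / 2)) as [dl [Hdl Hd]]; [lra|].
exists dl; split; auto. intros w Hw. unfold difference_quotient.
destruct (Ceq_dec zeta zeta); [|congruence].
destruct (Ceq_dec w zeta) as [E|E].
- replace (d - d)%C with (RtoC 0) by ring. rewrite Cmod_0; auto.
- specialize (Hd w Hw). assert (Hn := Cminus_eq_contra _ _ E).
  replace ((f w - f zeta) / (w - zeta) - d)%C with ((f w - f zeta - d * (w - zeta)) / (w - zeta))%C by (field; auto).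
  rewrite Cmod_div by auto. apply Cmod_gt_0 in Hn.
  apply Rle_lt_trans with (eps / 2); [|lra]. apply Rle_div_l; auto.
Qed.

Lemma difference_quotient_derivable f zeta d z a : z <> zeta -> cderive f z a ->
  exists l, cderive (difference_quotient f zeta d) z l.
Proof.
intros Hz Hf. assert (Hn := Cminus_eq_contra _ _ Hz). eexists.
apply cderive_ext_loc with (f := fun w => ((f w - f zeta) / (w - zeta))%C) (d := Cmod (z - zeta)%C).
- apply Cmod_gt_0; auto.
- intros w Hw. unfold difference_quotient. destruct (Ceq_dec w zeta) as [E|E]; auto.
  subst w. exfalso. replace (zeta - z)%C with (- (z - zeta))%C in Hw by ring.
  rewrite Cmod_opp in Hw. lra.
- apply cderive_div. auto. apply cderive_minus. exact Hf. apply cderive_const.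
  apply cderive_minus. apply cderive_id. apply cderive_const.
Qed.

Lemma CInt_0 a b : CInt (fun _ => RtoC 0) a b = RtoC 0.
Proof. rewrite (CInt_affine (RtoC 0) (RtoC 0)). ring. intros; ring. Qed.

Lemma analytic_cderive f z : analytic_on_disk f -> in_disk z -> exists l, cderive f z l.
Proof. intros H Hz. destruct (H z Hz) as [l Hl]. exists l; exact Hl. Qed.

Lemma ccont_mult f g z : ccont f z -> ccont g z -> ccont (fun w => f w * g w)%C z.
Proof.
intros Hf Hg eps Heps.
set (M := Cmod (f z) + Cmod (g z) + 1).
pose proof (Cmod_ge_0 (f z)) as P1. pose proof (Cmod_ge_0 (g z)) as P2.
assert (HM : 1 <= M) by (unfold M; lra).
assert (He : 0 < Rmin 1 (eps / (4 * M))).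
{ apply Rmin_glb_lt; [lra|]. apply Rdiv_lt_0_compat; lra. }
destruct (Hf _ He) as [d1 [Hd1 H1]]. destruct (Hg _ He) as [d2 [Hd2 H2]].
exists (Rmin d1 d2); split. apply Rmin_glb_lt; auto.
intros w Hw.
specialize (H1 w (Rlt_le_trans _ _ _ Hw (Rmin_l _ _))).
specialize (H2 w (Rlt_le_trans _ _ _ Hw (Rmin_r _ _))).
pose proof (Rmin_l 1 (eps / (4 * M))) as L1. pose proof (Rmin_r 1 (eps / (4 * M))) as L2.
set (e := Rmin 1 (eps / (4 * M))) in *.
assert (HeM : e * M <= eps / 4).
{ apply Rle_trans with (eps / (4 * M) * M). apply Rmult_le_compat_r; lra. right; field; lra. }
replace (f w * g w - f z * g z)%C with ((f w - f z) * (g w - g z) + (f w - f z) * g z + f z * (g w - g z))%C by ring.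
eapply Rle_lt_trans. apply Cmod_triangle.
eapply Rle_lt_trans. apply Rplus_le_compat_r. apply Cmod_triangle.
rewrite !Cmod_mult.
pose proof (Cmod_ge_0 (f w - f z)%C). pose proof (Cmod_ge_0 (g w - g z)%C).
assert (Cmod (f w - f z)%C * Cmod (g w - g z)%C <= e * 1) by (apply Rmult_le_compat; lra).
assert (Cmod (f w - f z)%C * Cmod (g z) <= e * M) by (apply Rmult_le_compat; unfold M; lra).
assert (Cmod (f z) * Cmod (g w - g z)%C <= M * e) by (apply Rmult_le_compat; unfold M; lra).
nra.
Qed.

Lemma difference_quotient_ccont f zeta d z : analytic_on_disk f -> cderive f zeta d -> in_disk z ->
  ccont (difference_quotient f zeta d) z.
Proof.
intros Hf Hd Hz. destruct (Ceq_dec z zeta) as [->|E]. apply difference_quotient_ccont_at; auto.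
destruct (analytic_cderive f z Hf Hz) as [a Ha].
destruct (difference_quotient_derivable f zeta d z a E Ha) as [l Hl]. eapply cderive_ccont; eauto.
Qed.

(** The integrand is differentiable away from [zeta], so its circle integrals are
constant for radii below and for radii above [Cmod zeta].  It is continuous
everywhere, hence the two constants agree, and they agree with the value at the
radius 0, where the factor [z] makes the integrand vanish. *)
Lemma circ_int_difference_quotient f zeta d r : analytic_on_disk f -> cderive f zeta d -> Cmod zeta < r < 1 ->
  circ_int (fun z => z * difference_quotient f zeta d z)%C r = RtoC 0.
Proof.
intros Hf Hd [Hr Hr1]. set (k := fun z => (z * difference_quotient f zeta d z)%C).
pose proof (Cmod_ge_0 zeta) as Hz0.
assert (Kd : forall z, in_disk z -> z <> zeta -> exists l, cderive k z l).
{ intros z Hz Hne. destruct (analytic_cderive f z Hf Hz) as [a Ha].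
  destruct (difference_quotient_derivable f zeta d z a Hne Ha) as [l Hl]. eexists. apply cderive_mult.
  apply cderive_id. exact Hl. }
assert (Kc : forall z, in_disk z -> ccont k z).
{ intros z Hz. apply ccont_mult. eapply cderive_ccont, cderive_id. apply difference_quotient_ccont; auto. }
assert (Dp : forall s t, Rabs s < 1 -> in_disk (polar s t)).
{ intros s t Hs. unfold in_disk. destruct (Rle_dec 0 s) as [p|n].
  - rewrite Cmod_polar; auto. rewrite Rabs_pos_eq in Hs; auto.
  - replace (polar s t) with (- polar (- s) t)%C.
    rewrite Cmod_opp, Cmod_polar. rewrite Rabs_left in Hs; lra. lra.
    unfold polar, Copp; simpl. f_equal; ring. }
assert (JC : forall s0, Rabs s0 < 1 -> forall eps, 0 < eps -> exists d, 0 < d /\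
  forall s, Rabs s < 1 -> Rabs (s - s0) < d -> Cmod (circ_int k s - circ_int k s0)%C <= eps).
{ intros s0 Hs0. apply circ_int_cont; auto. }
assert (Const : forall s s', 0 < s -> s <= s' -> s' < 1 -> (s' < Cmod zeta \/ Cmod zeta < s) ->
  circ_int k s = circ_int k s').
{ intros s s' H0 H1 H2 H3. apply circ_int_annulus; auto. intros z Hz.
  apply Kd. unfold in_disk; lra. intros ->. lra. }
assert (J0 : circ_int k 0 = RtoC 0).
{ unfold circ_int. rewrite (CInt_ext _ (fun _ => RtoC 0)). apply CInt_0.
  pose proof two_PI_pos; lra. intros t _. unfold k. replace (polar 0 t) with (RtoC 0).
  ring. unfold polar, RtoC. f_equal; ring. }
assert (E1 : circ_int k r = circ_int k (Cmod zeta)).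
{ apply Cmod_minus_small_eq. intros eps Heps.
  destruct (JC (Cmod zeta)) with (eps := eps) as [dl [Hdl H]]; auto. rewrite Rabs_pos_eq; lra.
  set (s := Cmod zeta + Rmin (dl / 2) (r - Cmod zeta)).
  assert (0 < Rmin (dl / 2) (r - Cmod zeta)) by (apply Rmin_glb_lt; lra).
  pose proof (Rmin_l (dl / 2) (r - Cmod zeta)). pose proof (Rmin_r (dl / 2) (r - Cmod zeta)).
  rewrite <- (Const s r); unfold s; try lra. fold s.
  apply H; rewrite Rabs_pos_eq; unfold s; lra. }
rewrite E1. destruct (Rle_lt_or_eq_dec _ _ Hz0) as [Hp|He].
2: { rewrite <- He; auto. }
transitivity (circ_int k (Cmod zeta / 2)).
- apply Cmod_minus_small_eq. intros eps Heps.
  destruct (JC (Cmod zeta)) with (eps := eps) as [dl [Hdl H]]; auto. rewrite Rabs_pos_eq; lra.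
  set (s := Cmod zeta - Rmin (dl / 2) (Cmod zeta / 2)).
  assert (0 < Rmin (dl / 2) (Cmod zeta / 2)) by (apply Rmin_glb_lt; lra).
  pose proof (Rmin_l (dl / 2) (Cmod zeta / 2)). pose proof (Rmin_r (dl / 2) (Cmod zeta / 2)).
  rewrite (Const (Cmod zeta / 2) s); unfold s; try lra. fold s.
  replace (circ_int k (Cmod zeta) - circ_int k s)%C with (- (circ_int k s - circ_int k (Cmod zeta)))%C by ring.
  rewrite Cmod_opp. apply H. rewrite Rabs_pos_eq; unfold s; lra. rewrite Rabs_left; unfold s; lra.
- rewrite <- J0. apply Cmod_minus_small_eq. intros eps Heps.
  destruct (JC 0) with (eps := eps) as [dl [Hdl H]]; auto. rewrite Rabs_R0; lra.
  set (s := Rmin (dl / 2) (Cmod zeta / 2)).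
  assert (0 < s) by (apply Rmin_glb_lt; lra).
  assert (s <= dl / 2) by apply Rmin_l. assert (s <= Cmod zeta / 2) by apply Rmin_r.
  rewrite <- (Const s (Cmod zeta / 2)); try lra.
  apply H; rewrite Rabs_pos_eq; lra.
Qed.

(** * Taylor series of functions analytic in the disk *)

Definition csum (u : nat -> C) (n : nat) : C := @sum_n C_AbelianMonoid u n.

Definition cseries (u : nat -> C) (l : C) : Prop := @is_series C_AbsRing C_NormedModule u l.

(** Convergence in [C] is defined by neighbourhoods for the product structure;
here it is expressed with the modulus. *)
Lemma cseries_eps u l : cseries u l <->
  forall eps, 0 < eps -> exists N, forall n, (N <= n)%nat -> Cmod (csum u n - l)%C < eps.
Proof.
split.
- intros H0. assert (H := proj1 (@filterlim_locally nat C_UniformSpace eventually _ (csum u) l) H0).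
  intros eps Heps. assert (H2 : 0 < eps / 2) by lra.
  destruct (H (mkposreal _ H2)) as [N HN]. exists N. intros n Hn.
  destruct (HN n Hn) as [A B].
  eapply Rle_lt_trans. apply Cmod_le_sum. rewrite Re_minus, Im_minus.
  change (Rabs (Re (csum u n) - Re l) < eps / 2) in A.
  change (Rabs (Im (csum u n) - Im l) < eps / 2) in B. lra.
- intros H. apply (proj2 (@filterlim_locally nat C_UniformSpace eventually _ (csum u) l)). intros eps.
  destruct (H eps (cond_pos eps)) as [N HN]. exists N. intros n Hn.
  specialize (HN n Hn). split; (eapply Rle_lt_trans; [|exact HN]).
  + exact (Re_le_Cmod (csum u n - l)%C).
  + exact (Im_le_Cmod (csum u n - l)%C).
Qed.

Lemma csum_S (u : nat -> C) n : csum u (S n) = (csum u n + u (S n))%C.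
Proof. exact (sum_Sn u n). Qed.

Lemma csum_0 (u : nat -> C) : csum u 0 = u 0%nat.
Proof. exact (sum_O u). Qed.

Lemma pcont_bounded p a b : a <= b -> (forall t, a <= t <= b -> pcont p t) ->
  exists M, 0 <= M /\ forall t, a <= t <= b -> Cmod (p t) <= M.
Proof.
intros Hab Hp. destruct (continuity_ab_maj (fun t => Cmod (p t)) a b Hab) as [x [Hx Hx']].
- intros c Hc. apply continuity_pt_filterlim.
  apply (proj2 (continuous_R_eps (fun t => Cmod (p t)) c)). intros eps Heps.
  destruct (Hp c Hc eps Heps) as [d [Hd H]]. exists d; split; auto. intros s Hs.
  specialize (H s Hs). eapply Rle_lt_trans; [|exact H].
  apply Rabs_le. pose proof (Cmod_triangle (p s - p c)%C (p c)) as T1.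
  pose proof (Cmod_triangle (- (p s - p c))%C (p s)) as T2. rewrite Cmod_opp in T2.
  replace (p s - p c + p c)%C with (p s) in T1 by ring.
  replace (- (p s - p c) + p s)%C with (p c) in T2 by ring. lra.
- exists (Cmod (p x)). split; auto. apply Cmod_ge_0.
Qed.

(** The [n]-th Taylor coefficient as the mean of [f(z) / z^n] over the circle of
radius [r]. *)
Definition coef (f : C -> C) (r : R) (n : nat) : C :=
  (CInt (fun t => (/ polar r t) ^ n * f (polar r t)) 0 (2 * PI) / RtoC (2 * PI))%C.

Lemma analytic_ccont f z : analytic_on_disk f -> in_disk z -> ccont f z.
Proof.
intros H Hz. destruct (analytic_cderive f z H Hz) as [l Hl]. eapply cderive_ccont; eauto.
Qed.

Lemma in_disk_polar r t : 0 <= r < 1 -> in_disk (polar r t).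
Proof. intros Hr. unfold in_disk. rewrite Cmod_polar; lra. Qed.

Lemma pcont_mult p q t : pcont p t -> pcont q t -> pcont (fun s => p s * q s)%C t.
Proof.
rewrite !pcont_components. intros [P1 P2] [Q1 Q2]. split.
- apply (continuous_minus (V := R_NormedModule) (fun s => Re (p s) * Re (q s)) (fun s => Im (p s) * Im (q s)));
  apply (continuous_mult (K := R_AbsRing)); auto.
- apply (continuous_plus (V := R_NormedModule) (fun s => Re (p s) * Im (q s)) (fun s => Im (p s) * Re (q s)));
  apply (continuous_mult (K := R_AbsRing)); auto.
Qed.

Lemma ccont_pow_inv n z : z <> RtoC 0 -> ccont (fun w => (/ w) ^ n)%C z.
Proof.
intros Hz. eapply cderive_ccont. apply (cderive_comp (fun w => w ^ n)%C Cinv).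
apply cderive_pow. apply cderive_inv; auto.
Qed.

Lemma pcont_inv_polar_pow r n t : 0 < r -> pcont (fun t => (/ polar r t) ^ n)%C t.
Proof.
intros Hr. apply (pcont_comp (fun w => (/ w) ^ n)%C). apply ccont_pow_inv, polar_neq_0; auto.
apply pcont_polar.
Qed.

(** Over a full period the nontrivial characters have mean 0. *)
Lemma CInt_polar r n : (1 <= n)%nat -> CInt (fun t => polar r (INR n * t)) 0 (2 * PI) = RtoC 0.
Proof.
intros Hn. assert (Hn0 : INR n <> 0) by (apply not_0_INR; lia).
assert (Hs : sin (INR n * (2 * PI)) = 0 /\ cos (INR n * (2 * PI)) = 1).
{ split. replace (INR n * (2 * PI)) with (0 + 2 * INR n * PI) by ring. rewrite sin_period. apply sin_0.
  replace (INR n * (2 * PI)) with (0 + 2 * INR n * PI) by ring. rewrite cos_period. apply cos_0. }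
destruct Hs as [Hs Hc].
unfold CInt, RtoC. f_equal; apply (is_RInt_unique (V := R_CompleteNormedModule)).
- evar_last. apply (is_RInt_derive (V := R_CompleteNormedModule) (fun t => r * sin (INR n * t) / INR n)).
  + intros x _. auto_derive; auto. unfold Re, polar; simpl. field; auto.
  + intros x _. apply (ex_derive_continuous (V := R_NormedModule)). unfold Re, polar; simpl. auto_derive; auto.
  + unfold minus, plus, opp; simpl. rewrite Rmult_0_r, Hs, sin_0. field; auto.
- evar_last. apply (is_RInt_derive (V := R_CompleteNormedModule) (fun t => - r * cos (INR n * t) / INR n)).
  + intros x _. auto_derive; auto. unfold Im, polar; simpl. field; auto.
  + intros x _. apply (ex_derive_continuous (V := R_NormedModule)). unfold Im, polar; simpl. auto_derive; auto.
  + unfold minus, plus, opp; simpl. rewrite Rmult_0_r, Hc, cos_0. field; auto.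
Qed.

Lemma Cconj_polar r t : Cconj (polar r t) = polar r (- t).
Proof. unfold Cconj, polar; simpl. rewrite cos_neg, sin_neg. f_equal; ring. Qed.

Lemma CInt_conj f a b : ex_CInt f a b -> CInt (fun t => Cconj (f t)) a b = Cconj (CInt f a b).
Proof.
intros [H1 H2]. unfold CInt, Cconj. f_equal. unfold Im; simpl.
apply (RInt_opp (V := R_CompleteNormedModule)). exact H2.
Qed.

Lemma pcont_polar_lin r c t : pcont (fun t => polar r (c * t)) t.
Proof.
apply pcont_components. split;
apply (ex_derive_continuous (V := R_NormedModule)); unfold Re, Im, polar; simpl; auto_derive; auto.
Qed.

Lemma CInt_inv_polar_pow r n : 0 < r ->
  CInt (fun t => (/ polar r t) ^ n)%C 0 (2 * PI) = if Nat.eq_dec n 0 then RtoC (2 * PI) else RtoC 0.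
Proof.
intros Hr. pose proof two_PI_pos as Hpi. destruct (Nat.eq_dec n 0) as [->|Hn].
- rewrite (CInt_affine (RtoC 1) (RtoC 0)). 2: { intros; simpl; ring. }
  replace (2 * PI - 0) with (2 * PI) by ring. ring.
- rewrite (CInt_ext _ (fun t => Cconj (polar ((/ r) ^ n) (INR n * t)))).
  + rewrite CInt_conj. rewrite CInt_polar by lia. unfold Cconj, RtoC; simpl. f_equal; ring.
    apply ex_CInt_cont. lra. intros t _. apply pcont_polar_lin.
  + lra.
  + intros t _. rewrite polar_inv, polar_pow, Cconj_polar by auto. f_equal; ring.
Qed.

(** Put [k(z) = z (f z - f zeta) / (z - zeta)] and let [I N] be the integral of
[k(z) / z^N] over the circle.  Since [(1 - zeta/z) k(z) = f z - f zeta], the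
difference [I N - zeta I (N+1)] is [2 pi] times the [N]-th coefficient, up to
the term [f zeta] which only appears for [N = 0].  Cauchy's formula is
[I 0 = 0], so the partial sums telescope, and the remainder decays like
[(|zeta|/r)^N]. *)
Lemma taylor_series f r zeta : analytic_on_disk f -> Cmod zeta < r < 1 ->
  cseries (fun n => coef f r n * zeta ^ n)%C (f zeta).
Proof.
intros Hf [Hr Hr1]. pose proof (Cmod_ge_0 zeta) as Hz0. pose proof two_PI_pos as Hpi.
assert (Hr0 : 0 < r) by lra.
assert (Hz : in_disk zeta) by (unfold in_disk; lra).
destruct (analytic_cderive f zeta Hf Hz) as [d Hd].
assert (J0 := circ_int_difference_quotient f zeta d r Hf Hd (conj Hr Hr1)).
set (k := fun z => (z * difference_quotient f zeta d z)%C) in *.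
assert (Kc : forall t, pcont (fun t => k (polar r t)) t).
{ intros t. apply (pcont_comp k). apply ccont_mult. eapply cderive_ccont, cderive_id.
  apply difference_quotient_ccont; auto. apply in_disk_polar; lra. apply pcont_polar. }
assert (Fc : forall t, pcont (fun t => f (polar r t)) t).
{ intros t. apply (pcont_comp f). apply analytic_ccont; auto. apply in_disk_polar; lra. apply pcont_polar. }
destruct (pcont_bounded (fun t => k (polar r t)) 0 (2 * PI)) as [M [HM HM']]; [lra|auto|].
set (I := fun N => CInt (fun t => (/ polar r t) ^ N * k (polar r t))%C 0 (2 * PI)).
assert (ex1 : forall N, ex_CInt (fun t => (/ polar r t) ^ N * k (polar r t))%C 0 (2 * PI)).
{ intros N. apply ex_CInt_cont. lra. intros t _. apply pcont_mult; auto. apply pcont_inv_polar_pow; auto. }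
assert (ex2 : forall N, ex_CInt (fun t => (/ polar r t) ^ N * f (polar r t))%C 0 (2 * PI)).
{ intros N. apply ex_CInt_cont. lra. intros t _. apply pcont_mult; auto. apply pcont_inv_polar_pow; auto. }
assert (ex3 : forall N, ex_CInt (fun t => (/ polar r t) ^ N)%C 0 (2 * PI)).
{ intros N. apply ex_CInt_cont. lra. intros t _. apply pcont_inv_polar_pow; auto. }
assert (Hpi0 : RtoC (2 * PI) <> RtoC 0). { intros E. apply RtoC_inj in E. lra. }
assert (rec : forall N, (I N - zeta * I (S N))%C =
   (RtoC (2 * PI) * coef f r N - f zeta * (if Nat.eq_dec N 0 then RtoC (2 * PI) else RtoC 0))%C).
{ intros N. unfold coef. rewrite <- (CInt_inv_polar_pow r N) by auto. unfold I.
  transitivity (CInt (fun t => (/ polar r t) ^ N * f (polar r t) + (- f zeta) * (/ polar r t) ^ N)%C 0 (2 * PI)).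
  2: { rewrite CInt_plus, CInt_scal; auto. field. exact Hpi0. apply ex_CInt_scal; auto. }
  transitivity (CInt (fun t => (/ polar r t) ^ N * k (polar r t) +
    (- zeta) * ((/ polar r t) ^ S N * k (polar r t)))%C 0 (2 * PI)).
  { rewrite CInt_plus, (CInt_scal (- zeta)%C (fun t => (/ polar r t) ^ S N * k (polar r t))%C); auto. ring.
    apply (ex_CInt_scal (- zeta)%C (fun t => (/ polar r t) ^ S N * k (polar r t))%C); auto. }
  apply CInt_ext. lra. intros t _.
  assert (Hp := polar_neq_0 r t Hr0). unfold k, difference_quotient.
  destruct (Ceq_dec (polar r t) zeta) as [E|E].
  { exfalso. rewrite <- E, Cmod_polar in Hr; lra. }
  apply Cminus_eq_contra in E. rewrite Cpow_S.
  set (q := ((/ polar r t) ^ N)%C). field. auto. }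
assert (sums : forall N, csum (fun n => coef f r n * zeta ^ n)%C N =
   (f zeta - zeta ^ S N * I (S N) / RtoC (2 * PI))%C).
{ induction N.
  - rewrite csum_0. specialize (rec 0%nat). simpl in rec.
    assert (I0 : I 0%nat = RtoC 0).
    { rewrite <- J0. unfold I, circ_int. apply CInt_ext. lra. intros t _. simpl. ring. }
    rewrite I0 in rec. simpl.
    replace (coef f r 0) with ((RtoC (2 * PI) * coef f r 0 - f zeta * RtoC (2 * PI)) / RtoC (2 * PI) + f zeta)%C
      by (field; auto).
    rewrite <- rec. field; auto.
  - rewrite csum_S, IHN. specialize (rec (S N)). simpl Nat.eq_dec in rec. cbv iota in rec.
    replace (coef f r (S N)) with ((RtoC (2 * PI) * coef f r (S N) - f zeta * 0) / RtoC (2 * PI))%C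
      by (field; auto).
    rewrite <- rec. rewrite (Cpow_S zeta (S N)). field; auto. }
apply cseries_eps. intros eps Heps.
set (q := Cmod zeta / r). assert (Hq : 0 <= q < 1).
{ unfold q. split. apply Rdiv_le_0_compat; auto. apply Rlt_div_l; lra. }
destruct (pow_lt_1_zero q) with (y := eps / (2 * M + 1)) as [N HN].
{ rewrite Rabs_pos_eq; lra. }
{ apply Rdiv_lt_0_compat; lra. }
exists N. intros n Hn. rewrite sums.
replace (f zeta - zeta ^ S n * I (S n) / RtoC (2 * PI) - f zeta)%C
  with (- (zeta ^ S n * I (S n) / RtoC (2 * PI)))%C by ring.
rewrite Cmod_opp, Cmod_div, Cmod_mult, Cmod_pow by auto. rewrite Cmod_R, Rabs_pos_eq by lra.
assert (BI : Cmod (I (S n)) <= 2 * ((/ r) ^ S n * M) * (2 * PI - 0)).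
{ apply CInt_bound. lra. auto. intros t Ht. rewrite Cmod_mult, Cmod_pow, Cmod_inv by (apply polar_neq_0; auto).
  rewrite Cmod_polar by lra. apply Rmult_le_compat_l; auto. apply pow_le. left; apply Rinv_0_lt_compat; auto. }
assert (HN' := HN (S n) ltac:(lia)). rewrite Rabs_pos_eq in HN' by (apply pow_le; lra).
apply Rlt_div_r in HN'; [|lra].
apply Rle_lt_trans with (q ^ S n * (2 * M)).
- apply Rle_div_l; auto.
  replace (q ^ S n * (2 * M) * (2 * PI)) with (Cmod zeta ^ S n * (2 * ((/ r) ^ S n * M) * (2 * PI - 0))).
  apply Rmult_le_compat_l; auto. apply pow_le; auto.
  unfold q, Rdiv. rewrite Rpow_mult_distr. ring.
- assert (0 <= q ^ S n) by (apply pow_le; lra). lra.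
Qed.

(** * Finite sums and series *)

Definition rsum (u : nat -> R) (n : nat) : R := @sum_n R_AbelianMonoid u n.

Lemma rsum_S u n : rsum u (S n) = rsum u n + u (S n).
Proof. exact (sum_Sn u n). Qed.

Lemma rsum_0 u : rsum u 0 = u 0%nat.
Proof. exact (sum_O u). Qed.

Lemma rsum_ext u v n : (forall k, (k <= n)%nat -> u k = v k) -> rsum u n = rsum v n.
Proof. intros H. apply sum_n_ext_loc. auto. Qed.

Lemma csum_ext u v n : (forall k, (k <= n)%nat -> u k = v k) -> csum u n = csum v n.
Proof. intros H. apply sum_n_ext_loc. auto. Qed.

Lemma rsum_le u v n : (forall k, (k <= n)%nat -> u k <= v k) -> rsum u n <= rsum v n.
Proof.
induction n; intros H.
- rewrite !rsum_0. auto.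
- rewrite !rsum_S. apply Rplus_le_compat; auto.
Qed.

Lemma rsum_scal c u n : rsum (fun k => c * u k) n = c * rsum u n.
Proof. induction n. rewrite !rsum_0; auto. rewrite !rsum_S, IHn. ring. Qed.

Lemma Cmod_csum u n : Cmod (csum u n) <= rsum (fun k => Cmod (u k)) n.
Proof.
induction n. rewrite csum_0, rsum_0. lra. rewrite csum_S, rsum_S.
eapply Rle_trans. apply Cmod_triangle. lra.
Qed.

Lemma csum_scal c u n : csum (fun k => c * u k)%C n = (c * csum u n)%C.
Proof. induction n. rewrite !csum_0; auto. rewrite !csum_S, IHn. ring. Qed.

Lemma csum_zero u n : (forall k, (k <= n)%nat -> u k = RtoC 0) -> csum u n = RtoC 0.
Proof.
induction n; intros H. rewrite csum_0; auto. rewrite csum_S, IHn, H; auto. ring.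
Qed.

Lemma rsum_le_Series (u : nat -> R) n : (forall k, 0 <= u k) -> ex_series u -> rsum u n <= Series u.
Proof.
intros Hu He. apply (is_lim_seq_incr_compare (rsum u)).
- exact (Series_correct u He).
- intros k. rewrite rsum_S. specialize (Hu (S k)). lra.
Qed.

Lemma cseries_ext u v l : (forall n, u n = v n) -> cseries u l -> cseries v l.
Proof. intros H. apply (@is_series_ext C_AbsRing C_NormedModule u v l H). Qed.

Lemma cseries_plus u v l m : cseries u l -> cseries v m -> cseries (fun n => u n + v n)%C (l + m)%C.
Proof. apply (@is_series_plus C_AbsRing C_NormedModule). Qed.

Lemma cseries_scal c u l : cseries u l -> cseries (fun n => c * u n)%C (c * l)%C.
Proof. apply (@is_series_scal C_AbsRing C_NormedModule). Qed.

Lemma cseries_minus u v l m : cseries u l -> cseries v m -> cseries (fun n => u n - v n)%C (l - m)%C.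
Proof. apply (@is_series_minus C_AbsRing C_NormedModule). Qed.

Lemma cseries_decr u l : cseries (fun n => u (S n)) l -> cseries u (l + u 0%nat)%C.
Proof.
intros H. apply (@is_series_decr_1 C_AbsRing C_NormedModule).
change (cseries (fun k => u (S k)) (l + u 0%nat - u 0%nat)%C).
replace (l + u 0%nat - u 0%nat)%C with l by ring. exact H.
Qed.

Lemma cseries_bound u l B : (forall n, Cmod (csum u n) <= B) -> cseries u l -> Cmod l <= B.
Proof.
intros HB H. apply Rnot_lt_le. intros Hlt.
destruct (proj1 (cseries_eps _ _) H (Cmod l - B)) as [N HN]; [lra|].
specialize (HN N (Nat.le_refl N)). specialize (HB N).
pose proof (Cmod_triangle (- (csum u N - l))%C (csum u N)) as T.
replace (- (csum u N - l) + csum u N)%C with l in T by ring. rewrite Cmod_opp in T. lra.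
Qed.

Lemma cseries_unique u l m : cseries u l -> cseries u m -> l = m.
Proof.
intros Hl Hm. apply Cmod_minus_small_eq. intros eps Heps.
assert (H := cseries_minus _ _ _ _ Hl Hm). eapply cseries_bound; [|exact H].
intros n. rewrite csum_zero. rewrite Cmod_0; lra. intros; ring.
Qed.

Lemma cseries_terms_bounded u l : cseries u l -> exists M, 0 <= M /\ forall n, Cmod (u n) <= M.
Proof.
intros H. destruct (proj1 (cseries_eps _ _) H 1) as [N HN]; [lra|].
exists (2 + rsum (fun k => Cmod (u k)) N).
assert (Hs : forall n, 0 <= rsum (fun k => Cmod (u k)) n).
{ induction n. rewrite rsum_0; apply Cmod_ge_0. rewrite rsum_S. pose proof (Cmod_ge_0 (u (S n))). lra. }
split. specialize (Hs N); lra.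
intros n. destruct (le_lt_dec n N) as [Hn|Hn].
- apply Rle_trans with (rsum (fun k => Cmod (u k)) N); [|lra].
  clear HN. induction N. replace n with 0%nat by lia. rewrite rsum_0; lra.
  rewrite rsum_S. destruct (Nat.eq_dec n (S N)) as [->|E].
  + specialize (Hs N). lra.
  + specialize (IHN ltac:(lia)). pose proof (Cmod_ge_0 (u (S N))). lra.
- destruct n; [lia|]. pose proof (HN (S n) ltac:(lia)) as A1. pose proof (HN n ltac:(lia)) as A2.
  rewrite csum_S in A1.
  pose proof (Cmod_triangle (csum u n + u (S n) - l)%C (- (csum u n - l))%C) as T.
  rewrite Cmod_opp in T.
  replace (csum u n + u (S n) - l + - (csum u n - l))%C with (u (S n)) in T by ring.
  specialize (Hs N). lra.
Qed.

Lemma cseries_finite u n : (forall k, (n < k)%nat -> u k = RtoC 0) -> cseries u (csum u n).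
Proof.
intros H. apply cseries_eps. intros eps Heps. exists n. intros m Hm.
replace (csum u m) with (csum u n).
- replace (csum u n - csum u n)%C with (RtoC 0) by ring. rewrite Cmod_0; auto.
- induction Hm; auto. rewrite csum_S, <- IHHm, H by lia. ring.
Qed.

(** * Power series, orders of vanishing and uniqueness *)

Definition series_on (R : R) (f : C -> C) (a : nat -> C) : Prop :=
  forall z, Cmod z < R -> cseries (fun n => a n * z ^ n)%C (f z).

Notation has_coefs := (series_on 1).

(** [f z = o(z^n)] as [z] tends to 0; this relation replaces computations with
formal power series. *)
Definition small_o (f : C -> C) (n : nat) : Prop :=
  forall eps, 0 < eps -> exists d, 0 < d /\ forall z, Cmod z < d -> Cmod (f z) <= eps * Cmod z ^ n.

Lemma small_o_ext f g n : (forall z, in_disk z -> f z = g z) -> small_o f n -> small_o g n.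
Proof.
intros H Hf eps Heps. destruct (Hf eps Heps) as [d [Hd H']]. exists (Rmin d 1).
split. apply Rmin_glb_lt; lra. intros z Hz. rewrite <- H.
- apply H'. eapply Rlt_le_trans; [exact Hz|apply Rmin_l].
- eapply Rlt_le_trans; [exact Hz|apply Rmin_r].
Qed.

Lemma small_o_plus f g n : small_o f n -> small_o g n -> small_o (fun z => f z + g z)%C n.
Proof.
intros Hf Hg eps Heps. destruct (Hf (eps / 2)) as [d1 [Hd1 H1]]; [lra|].
destruct (Hg (eps / 2)) as [d2 [Hd2 H2]]; [lra|].
exists (Rmin d1 d2). split. apply Rmin_glb_lt; auto. intros z Hz.
specialize (H1 z (Rlt_le_trans _ _ _ Hz (Rmin_l _ _))).
specialize (H2 z (Rlt_le_trans _ _ _ Hz (Rmin_r _ _))).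
eapply Rle_trans. apply Cmod_triangle. lra.
Qed.

Lemma small_o_mult_bounded f g n M d0 : 0 < d0 -> (forall z, Cmod z < d0 -> Cmod (g z) <= M) ->
  small_o f n -> small_o (fun z => g z * f z)%C n.
Proof.
intros Hd0 Hg Hf eps Heps.
assert (HM : 0 <= M).
{ specialize (Hg (RtoC 0)). rewrite Cmod_0 in Hg. eapply Rle_trans; [apply Cmod_ge_0|auto]. }
destruct (Hf (eps / (M + 1))) as [d [Hd H]]. apply Rdiv_lt_0_compat; lra.
exists (Rmin d d0). split. apply Rmin_glb_lt; auto. intros z Hz.
specialize (H z (Rlt_le_trans _ _ _ Hz (Rmin_l _ _))).
specialize (Hg z (Rlt_le_trans _ _ _ Hz (Rmin_r _ _))).
rewrite Cmod_mult. apply Rle_trans with (M * (eps / (M + 1) * Cmod z ^ n)).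
- apply Rmult_le_compat; auto; apply Cmod_ge_0.
- assert (0 <= Cmod z ^ n) by (apply pow_le, Cmod_ge_0).
  rewrite <- Rmult_assoc. apply Rmult_le_compat_r; auto.
  unfold Rdiv. rewrite <- Rmult_assoc. apply Rle_div_l; [lra|]. nra.
Qed.

Lemma small_o_scal c f n : small_o f n -> small_o (fun z => c * f z)%C n.
Proof. intros H. apply (small_o_mult_bounded f (fun _ => c) n (Cmod c) 1); auto; intros; lra. Qed.

Lemma bigO_small_o f n M d0 : 0 < d0 ->
  (forall z, Cmod z < d0 -> Cmod (f z) <= M * Cmod z ^ S n) -> small_o f n.
Proof.
intros Hd0 H eps Heps. set (K := Rmax M 1). assert (HK : 1 <= K) by apply Rmax_r.
exists (Rmin d0 (eps / K)). split. apply Rmin_glb_lt; auto. apply Rdiv_lt_0_compat; lra.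
intros z Hz. specialize (H z (Rlt_le_trans _ _ _ Hz (Rmin_l _ _))).
assert (Hz2 := Rlt_le_trans _ _ _ Hz (Rmin_r _ _)). apply Rlt_div_r in Hz2; [|lra].
eapply Rle_trans. exact H. simpl.
assert (0 <= Cmod z ^ n) by (apply pow_le, Cmod_ge_0). pose proof (Cmod_ge_0 z).
assert (M <= K) by apply Rmax_l.
rewrite <- Rmult_assoc. apply Rmult_le_compat_r; auto.
apply Rle_trans with (K * Cmod z); [|lra]. apply Rmult_le_compat_r; auto.
Qed.

Lemma series_on_coef_bound R f a rho : 0 < rho < R -> series_on R f a ->
  exists M, 0 <= M /\ forall n, Cmod (a n) * rho ^ n <= M.
Proof.
intros Hr H. assert (Hm : Cmod (RtoC rho) = rho) by (rewrite Cmod_R; apply Rabs_pos_eq; lra).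
assert (Hz : Cmod (RtoC rho) < R) by lra.
destruct (cseries_terms_bounded _ _ (H _ Hz)) as [M [HM HM']].
exists M; split; auto. intros n. specialize (HM' n). rewrite Cmod_mult, Cmod_pow, Hm in HM'. auto.
Qed.

(** On the disk of radius [R/4] the terms are dominated by those of a geometric
series of ratio at most 1/2, so the first one controls the sum. *)
Lemma vanish_bigO R f a n : 0 < R -> series_on R f a -> (forall k, (k < n)%nat -> a k = RtoC 0) ->
  exists M, forall z, Cmod z <= R / 4 -> Cmod (f z) <= M * Cmod z ^ n.
Proof.
intros HR H Ha. destruct (series_on_coef_bound R f a (R / 2)) as [M [HM HM']]; [lra|auto|].
exists (2 * M * (2 / R) ^ n). intros z Hz. pose proof (Cmod_ge_0 z) as Hz0.
set (q := Cmod z * (2 / R)).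
assert (Hq : 0 <= q <= / 2).
{ unfold q. split. apply Rmult_le_pos; auto. apply Rdiv_le_0_compat; lra.
  apply Rmult_le_reg_r with R; auto. unfold Rdiv. rewrite !Rmult_assoc, Rinv_l; lra. }
replace (2 * M * (2 / R) ^ n * Cmod z ^ n) with (2 * M * q ^ n).
2: { unfold q. rewrite Rpow_mult_distr. ring. }
assert (Ht : forall k, Cmod (a k * z ^ k)%C <= M * q ^ k).
{ intros k. rewrite Cmod_mult, Cmod_pow. unfold q. rewrite Rpow_mult_distr.
  specialize (HM' k). replace (Cmod (a k) * Cmod z ^ k) with (Cmod (a k) * (R / 2) ^ k * (Cmod z ^ k * (2 / R) ^ k)).
  apply Rmult_le_compat_r; auto. apply Rmult_le_pos; apply pow_le; auto. apply Rdiv_le_0_compat; lra.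
  assert (E : (R / 2) ^ k * (2 / R) ^ k = 1).
  { rewrite <- Rpow_mult_distr. replace (R / 2 * (2 / R)) with 1 by (field; lra). apply pow1. }
  transitivity (Cmod (a k) * Cmod z ^ k * ((R / 2) ^ k * (2 / R) ^ k)); [ring|]. rewrite E; ring. }
assert (Hqn : forall k, 0 <= q ^ k) by (intros; apply pow_le; lra).
assert (Hs : forall N, Cmod (csum (fun k => a k * z ^ k)%C N) <= 
   if le_lt_dec n N then 2 * M * (q ^ n - q ^ S N) else 0).
{ induction N.
  - rewrite csum_0. destruct (le_lt_dec n 0).
    + replace n with 0%nat by lia. specialize (Ht 0%nat). simpl in *. nra.
    + rewrite Ha by lia. rewrite Cmult_0_l, Cmod_0. lra.
  - rewrite csum_S. destruct (le_lt_dec n (S N)) as [Hn|Hn].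
    + eapply Rle_trans. apply Cmod_triangle. specialize (Ht (S N)).
      pose proof (Hqn (S N)) as Q1.
      replace (q ^ S (S N)) with (q * q ^ S N) by reflexivity.
      assert (q * q ^ S N <= / 2 * q ^ S N) by (apply Rmult_le_compat_r; lra).
      assert (E1 : 0 <= M * (q ^ S N - 2 * (q * q ^ S N))) by (apply Rmult_le_pos; lra).
      destruct (le_lt_dec n N).
      * nra.
      * replace n with (S N) by lia. nra.
    + rewrite (Ha (S N)) by lia. destruct (le_lt_dec n N); [lia|].
      rewrite Cmult_0_l, Cplus_0_r. auto. }
assert (HzR : Cmod z < R) by lra.
eapply cseries_bound; [|exact (H z HzR)].
intros N. eapply Rle_trans. apply Hs. pose proof (Hqn n). pose proof (Hqn (S N)).
destruct (le_lt_dec n N); nra.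
Qed.

Lemma series_on_minus R f g a b : series_on R f a -> series_on R g b ->
  series_on R (fun z => f z - g z)%C (fun n => a n - b n)%C.
Proof.
intros Hf Hg z Hz. eapply cseries_ext; [|apply cseries_minus; [apply Hf; auto|apply Hg; auto]].
intros n; simpl. ring.
Qed.

Lemma series_on_plus R f g a b : series_on R f a -> series_on R g b ->
  series_on R (fun z => f z + g z)%C (fun n => a n + b n)%C.
Proof.
intros Hf Hg z Hz. eapply cseries_ext; [|apply cseries_plus; [apply Hf; auto|apply Hg; auto]].
intros n; simpl. ring.
Qed.

Lemma series_on_scal R c f a : series_on R f a ->
  series_on R (fun z => c * f z)%C (fun n => c * a n)%C.
Proof.
intros Hf z Hz. eapply cseries_ext; [|apply cseries_scal; apply Hf; auto].
intros n; simpl. ring.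
Qed.

Lemma series_on_ext R f g a b : (forall z, Cmod z < R -> f z = g z) -> (forall n, a n = b n) ->
  series_on R f a -> series_on R g b.
Proof.
intros H Hab Hf z Hz. rewrite <- H by auto. eapply cseries_ext; [|apply Hf; auto].
intros n; simpl; rewrite Hab; auto.
Qed.

Definition trunc (a : nat -> C) (n k : nat) : C := if le_lt_dec k n then a k else RtoC 0.

Lemma trunc_le a n k : (k <= n)%nat -> trunc a n k = a k.
Proof. intros H. unfold trunc. destruct (le_lt_dec k n); auto; lia. Qed.

Lemma trunc_gt a n k : (n < k)%nat -> trunc a n k = RtoC 0.
Proof. intros H. unfold trunc. destruct (le_lt_dec k n); auto; lia. Qed.

Definition cpoly (a : nat -> C) (n : nat) (z : C) : C := csum (fun k => a k * z ^ k)%C n.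

Lemma series_on_cpoly R a n : series_on R (cpoly a n) (trunc a n).
Proof.
intros z Hz. unfold cpoly.
replace (csum (fun k => a k * z ^ k)%C n) with (csum (fun k => trunc a n k * z ^ k)%C n).
- apply cseries_finite. intros k Hk. rewrite trunc_gt by auto. ring.
- apply csum_ext. intros k Hk. rewrite trunc_le; auto.
Qed.

Lemma taylor_small_o R f a n : 0 < R -> series_on R f a -> small_o (fun z => f z - cpoly a n z)%C n.
Proof.
intros HR H.
destruct (vanish_bigO R _ _ (S n) HR (series_on_minus _ _ _ _ _ H (series_on_cpoly R a n))) as [M HM].
- intros k Hk. rewrite trunc_le by lia. ring.
- apply (bigO_small_o _ n M (R / 4)). lra. intros z Hz. apply HM. lra.
Qed.

Lemma small_o_weaken f n k : (k <= n)%nat -> small_o f n -> small_o f k.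
Proof.
intros Hk H eps Heps. destruct (H eps Heps) as [d [Hd H']].
exists (Rmin d 1). split. apply Rmin_glb_lt; lra. intros z Hz.
assert (Hz1 := Rlt_le_trans _ _ _ Hz (Rmin_r _ _)).
eapply Rle_trans. apply H'. eapply Rlt_le_trans; [exact Hz|apply Rmin_l].
apply Rmult_le_compat_l; [lra|]. replace n with (k + (n - k))%nat by lia.
rewrite pow_add. rewrite <- (Rmult_1_r (Cmod z ^ k)) at 2.
apply Rmult_le_compat_l. apply pow_le, Cmod_ge_0.
rewrite <- (pow1 (n - k)). apply pow_incr. split. apply Cmod_ge_0. lra.
Qed.

Lemma small_o_monomial c n : small_o (fun z => c * z ^ n)%C n -> c = RtoC 0.
Proof.
intros H. apply Cmod_minus_small_eq. intros eps Heps. replace (c - 0)%C with c by ring.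
destruct (H eps Heps) as [d [Hd H']]. specialize (H' (RtoC (d / 2))).
rewrite Cmod_mult, Cmod_pow, Cmod_R, Rabs_pos_eq in H' by lra. specialize (H' ltac:(lra)).
apply Rmult_le_reg_r in H'; auto. apply pow_lt; lra.
Qed.

(** By induction on the index: once the lower coefficients vanish, [a_k z^k] is
the difference between [f], which is [o(z^k)], and the remainder of its Taylor
polynomial, which is [o(z^k)] too. *)
Lemma small_o_coefs_zero R f a n : 0 < R -> series_on R f a -> small_o f n ->
  forall k, (k <= n)%nat -> a k = RtoC 0.
Proof.
intros HR Ha Hf k. induction k as [k IH] using lt_wf_ind. intros Hk.
apply small_o_monomial with k.
apply small_o_ext with (f := fun z => (f z + - (1) * (f z - cpoly a k z))%C).
- intros z _. replace (f z + - (1) * (f z - cpoly a k z))%C with (cpoly a k z) by ring.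
  unfold cpoly. destruct k. rewrite csum_0; auto. rewrite csum_S, csum_zero. ring.
  intros j Hj. rewrite IH by lia. ring.
- apply small_o_plus. eapply small_o_weaken; eauto. apply small_o_scal.
  apply taylor_small_o with R; auto.
Qed.

(** The tool for reading off coefficients: it suffices to compare two functions
to the right order at the origin. *)
Lemma coefs_small_o_eq R f g a b n : 0 < R -> series_on R f a -> series_on R g b ->
  small_o (fun z => f z - g z)%C n -> forall k, (k <= n)%nat -> a k = b k.
Proof.
intros HR Ha Hb H k Hk. apply Ceq_minus.
exact (small_o_coefs_zero R _ _ n HR (series_on_minus _ _ _ _ _ Ha Hb) H k Hk).
Qed.

Lemma coefs_unique R f a b : 0 < R -> series_on R f a -> series_on R f b -> forall n, a n = b n.
Proof.
intros HR Ha Hb n. apply (coefs_small_o_eq R f f a b n HR Ha Hb); auto.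
intros eps Heps. exists 1; split; [lra|]. intros z _.
replace (f z - f z)%C with (RtoC 0) by ring. rewrite Cmod_0.
apply Rmult_le_pos; [lra|]. apply pow_le, Cmod_ge_0.
Qed.

(** On the smaller of the two disks both sequences represent [f]. *)
Lemma coef_radius f r s : analytic_on_disk f -> 0 < r < 1 -> 0 < s < 1 -> forall n, coef f r n = coef f s n.
Proof.
intros Hf Hr Hs. apply (coefs_unique (Rmin r s) f).
- apply Rmin_glb_lt; lra.
- intros z Hz. apply taylor_series; auto. split; [|lra]. eapply Rlt_le_trans; [exact Hz|apply Rmin_l].
- intros z Hz. apply taylor_series; auto. split; [|lra]. eapply Rlt_le_trans; [exact Hz|apply Rmin_r].
Qed.

(** All radii give the same coefficients; the proofs below use the radius 1/2. *)
Lemma analytic_coefs f r : analytic_on_disk f -> 0 < r < 1 -> has_coefs f (coef f r).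
Proof.
intros Hf Hr z Hz. set (s := (Rmax r (Cmod z) + 1) / 2).
assert (Rmax r (Cmod z) < 1) by (apply Rmax_lub_lt; lra).
pose proof (Rmax_l r (Cmod z)). pose proof (Rmax_r r (Cmod z)).
eapply cseries_ext; [|apply (taylor_series f s z); auto; unfold s; lra].
intros n; simpl. rewrite (coef_radius f s r); auto; unfold s; lra.
Qed.

Lemma has_coefs_coef f a r : analytic_on_disk f -> has_coefs f a -> 0 < r < 1 -> forall n, a n = coef f r n.
Proof.
intros Hf Ha Hr. apply (coefs_unique 1 f); auto; [lra|]. apply analytic_coefs; auto.
Qed.

Lemma series_on_shift R f a : series_on R f a ->
  series_on R (fun z => z * f z)%C (fun n => match n with O => RtoC 0 | S n => a n end).
Proof.
intros H z Hz. replace (z * f z)%C with (z * f z + 0 * z ^ 0)%C by ring.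
apply (cseries_decr (fun n => match n with O => RtoC 0 | S n => a n end * z ^ n)%C).
eapply cseries_ext; [|apply cseries_scal, H; auto].
intros n; simpl. ring.
Qed.

Lemma series_on_0 R f a : 0 < R -> series_on R f a -> f (RtoC 0) = a 0%nat.
Proof.
intros HR H. assert (Hz : Cmod (RtoC 0) < R) by (rewrite Cmod_0; auto).
apply (cseries_unique _ _ _ (H _ Hz)).
replace (a 0%nat) with (csum (fun n => a n * RtoC 0 ^ n)%C 0).
- apply cseries_finite. intros k Hk. destruct k; [lia|]. simpl. ring.
- rewrite csum_0. simpl. ring.
Qed.

(** * Termwise differentiation of power series *)

(** The bound is multiplied by [rho^2] to avoid the exponent [n - 2].  The error
terms satisfy [E_(n+1) = z E_n + n z0^(n-1) (z - z0)^2], which gives the factor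
[n (n-1) / 2], bounded here by [n^2]. *)
Lemma pow_taylor_error n z z0 rho : 0 < rho -> Cmod z <= rho -> Cmod z0 <= rho ->
  rho ^ 2 * Cmod (z ^ n - z0 ^ n - INR n * z0 ^ pred n * (z - z0))%C
    <= INR n ^ 2 * rho ^ n * Cmod (z - z0)%C ^ 2.
Proof.
intros Hr Hz Hz0. induction n.
- replace (z ^ 0 - z0 ^ 0 - INR 0 * z0 ^ pred 0 * (z - z0))%C with (RtoC 0) by (simpl; ring).
  rewrite Cmod_0. simpl. lra.
- set (E := (z ^ n - z0 ^ n - INR n * z0 ^ pred n * (z - z0))%C) in *.
  replace (z ^ S n - z0 ^ S n - INR (S n) * z0 ^ pred (S n) * (z - z0))%C
    with (z * E + INR n * z0 ^ pred n * (z - z0) ^ 2)%C.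
  2: { unfold E. rewrite S_INR, RtoC_plus. destruct n; simpl; ring. }
  set (w := Cmod (z - z0)%C) in *. assert (Hw : 0 <= w) by apply Cmod_ge_0.
  pose proof (pos_INR n) as Hn. assert (Hrn : 0 <= rho ^ n) by (apply pow_le; lra).
  assert (T2 : rho ^ 2 * Cmod (INR n * z0 ^ pred n * (z - z0) ^ 2)%C <= INR n * rho ^ S n * w ^ 2).
  { rewrite !Cmod_mult, !Cmod_pow, Cmod_R, Rabs_pos_eq by auto. fold w.
    destruct n. simpl; lra. simpl pred.
    assert (Cmod z0 ^ n <= rho ^ n) by (apply pow_incr; split; auto; apply Cmod_ge_0).
    replace (rho ^ 2 * (INR (S n) * Cmod z0 ^ n * w ^ 2)) with (Cmod z0 ^ n * (rho ^ 2 * INR (S n) * w ^ 2)) by ring.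
    replace (INR (S n) * rho ^ S (S n) * w ^ 2) with (rho ^ n * (rho ^ 2 * INR (S n) * w ^ 2)) by (simpl; ring).
    apply Rmult_le_compat_r; auto. repeat apply Rmult_le_pos; auto using pow_le; lra. }
  assert (T1 : rho ^ 2 * Cmod (z * E)%C <= INR n ^ 2 * rho ^ S n * w ^ 2).
  { rewrite Cmod_mult. replace (rho ^ 2 * (Cmod z * Cmod E)) with (Cmod z * (rho ^ 2 * Cmod E)) by ring.
    replace (INR n ^ 2 * rho ^ S n * w ^ 2) with (rho * (INR n ^ 2 * rho ^ n * w ^ 2)) by (simpl; ring).
    apply Rmult_le_compat; auto using Cmod_ge_0. apply Rmult_le_pos. nra. apply Cmod_ge_0. }
  apply Rle_trans with (rho ^ 2 * (Cmod (z * E)%C + Cmod (INR n * z0 ^ pred n * (z - z0) ^ 2)%C)).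
  apply Rmult_le_compat_l. nra. apply Cmod_triangle.
  rewrite S_INR. assert (0 <= rho ^ S n * w ^ 2) by (apply Rmult_le_pos; apply pow_le; lra). nra.
Qed.

Definition bounded_coefs (a : nat -> C) : Prop :=
  forall rho, 0 < rho < 1 -> exists M, forall n, Cmod (a n) * rho ^ n <= M.

Lemma has_coefs_bounded f a : has_coefs f a -> bounded_coefs a.
Proof.
intros H rho Hr. destruct (series_on_coef_bound 1 f a rho Hr H) as [M [_ HM]]. exists M; auto.
Qed.

Definition dcoef (a : nat -> C) (n : nat) : C := (INR (S n) * a (S n))%C.

(** Absolute values of the coefficients form a real power series of radius of
convergence at least 1, so the real theory of the radius of convergence applies,
in particular its invariance under differentiation. *)
Lemma bounded_coefs_radius a rho : bounded_coefs a -> 0 <= rho < 1 ->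
  Rbar_lt (Rabs rho) (CV_radius (fun n => Cmod (a n))).
Proof.
intros Ha Hr. apply Rbar_lt_le_trans with (Finite ((rho + 1) / 2)).
- rewrite Rabs_pos_eq by lra. simpl. lra.
- apply (proj1 (CV_radius_bounded (fun n => Cmod (a n)))).
  destruct (Ha ((rho + 1) / 2)) as [M HM]; [lra|]. exists M. intros n.
  rewrite Rabs_pos_eq; auto. apply Rmult_le_pos. apply Cmod_ge_0. apply pow_le; lra.
Qed.

Lemma Cmod_dcoef a n : Cmod (dcoef a n) = PS_derive (fun n => Cmod (a n)) n.
Proof.
unfold dcoef, PS_derive. rewrite Cmod_mult, Cmod_R, Rabs_pos_eq by apply pos_INR. reflexivity.
Qed.

Lemma CV_abs_series (b : nat -> R) rho : (forall n, 0 <= b n) -> 0 <= rho ->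
  Rbar_lt (Rabs rho) (CV_radius b) -> ex_series (fun n => b n * rho ^ n).
Proof.
intros Hb Hr H. apply CV_disk_inside in H. eapply ex_series_ext; [|exact H].
intros n. simpl. apply Rabs_pos_eq. apply Rmult_le_pos; auto. apply pow_le; auto.
Qed.

Lemma bounded_coefs_abs a rho : bounded_coefs a -> 0 <= rho < 1 ->
  ex_series (fun n => Cmod (a n) * rho ^ n).
Proof.
intros Ha Hr. apply (CV_abs_series (fun n => Cmod (a n))). intros; apply Cmod_ge_0. lra.
apply bounded_coefs_radius; auto.
Qed.

Lemma bounded_coefs_derive a : bounded_coefs a -> bounded_coefs (dcoef a).
Proof.
intros Ha rho Hr. assert (H : ex_series (fun n => Cmod (dcoef a n) * rho ^ n)).
{ apply (CV_abs_series (fun n => Cmod (dcoef a n))). intros; apply Cmod_ge_0. lra.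
  rewrite (CV_radius_ext _ (PS_derive (fun n => Cmod (a n)))) by (intros; apply Cmod_dcoef).
  rewrite CV_radius_derive. apply bounded_coefs_radius; auto. lra. }
assert (Hp : forall k, 0 <= Cmod (dcoef a k) * rho ^ k).
{ intros k. apply Rmult_le_pos. apply Cmod_ge_0. apply pow_le; lra. }
exists (Series (fun n => Cmod (dcoef a n) * rho ^ n)). intros n.
eapply Rle_trans; [|apply (rsum_le_Series (fun n => Cmod (dcoef a n) * rho ^ n) n); auto].
assert (Hs : forall n, 0 <= rsum (fun n => Cmod (dcoef a n) * rho ^ n) n).
{ induction n0. rewrite rsum_0; auto. rewrite rsum_S. specialize (Hp (S n0)). lra. }
destruct n. rewrite rsum_0; lra. rewrite rsum_S. specialize (Hs n). lra.
Qed.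

Lemma abs_cseries u : ex_series (fun n => Cmod (u n)) -> exists l, cseries u l.
Proof.
intros H. assert (E := @ex_series_le C_AbsRing C_CompleteNormedModule u (fun n => Cmod (u n))).
destruct E as [l Hl]; auto.
- intros n. apply Rle_refl.
- exists l. exact Hl.
Qed.

(** A total function: its value is arbitrary where the series diverges. *)
Definition series_fun (a : nat -> C) (z : C) : C :=
  epsilon (inhabits (RtoC 0)) (cseries (fun n => a n * z ^ n)%C).

Lemma series_fun_correct a : bounded_coefs a -> has_coefs (series_fun a) a.
Proof.
intros Ha z Hz. unfold series_fun. apply epsilon_spec. apply abs_cseries.
eapply ex_series_ext; [|apply (bounded_coefs_abs a (Cmod z) Ha)].
- intros n. simpl. rewrite Cmod_mult, Cmod_pow. reflexivity.
- split; auto. apply Cmod_ge_0.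
Qed.

(** The sum dominates the second order remainders of all the terms of the series
at once.  It converges because the twice differentiated series does. *)
Lemma series_second_bound a rho : bounded_coefs a -> 0 < rho < 1 ->
  exists K, forall N, rsum (fun n => Cmod (a n) * (INR n ^ 2 * rho ^ n)) N <= K.
Proof.
intros Ha Hr. exists (Series (fun n => Cmod (a n) * (INR n ^ 2 * rho ^ n))). intros N.
apply rsum_le_Series.
{ intros k. apply Rmult_le_pos. apply Cmod_ge_0. apply Rmult_le_pos; apply pow_le. apply pos_INR. lra. }
apply ex_series_incr_1. apply ex_series_incr_1.
assert (H : ex_series (fun n => Cmod (dcoef (dcoef a) n) * rho ^ n)).
{ apply bounded_coefs_abs. apply bounded_coefs_derive, bounded_coefs_derive; auto. lra. }
apply (ex_series_le (K := R_AbsRing) (V := R_CompleteNormedModule) _ (fun n => 2 * (Cmod (dcoef (dcoef a) n) * rho ^ n))).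
2: { apply (ex_series_scal_l (K := R_AbsRing) 2 (fun n => Cmod (dcoef (dcoef a) n) * rho ^ n)). exact H. }
intros n. unfold norm; simpl. unfold abs; simpl.
change (Rabs (Cmod (a (S (S n))) * (INR (S (S n)) ^ 2 * rho ^ S (S n)))
  <= 2 * (Cmod (dcoef (dcoef a) n) * rho ^ n)).
unfold dcoef. rewrite !Cmod_mult, !Cmod_R. rewrite !(Rabs_pos_eq (INR _)) by apply pos_INR.
rewrite Rabs_pos_eq.
2: { apply Rmult_le_pos. apply Cmod_ge_0. apply Rmult_le_pos; apply pow_le. apply pos_INR. lra. }
pose proof (Cmod_ge_0 (a (S (S n)))) as Hc. set (c := Cmod (a (S (S n)))) in *.
rewrite !S_INR. pose proof (pos_INR n) as Hn. set (x := INR n) in *.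
assert (Hrn : 0 <= rho ^ n) by (apply pow_le; lra).
simpl. set (q := rho ^ n) in *.
assert (0 <= c * q) by nra.
assert (rho * rho <= 1) by nra.
replace (c * ((x + 1 + 1) * ((x + 1 + 1) * 1) * (rho * (rho * q)))) with (c * q * ((x + 2) * (x + 2) * (rho * rho))) by ring.
replace (2 * ((x + 1) * ((x + 1 + 1) * c) * q)) with (c * q * (2 * (x + 1) * (x + 2))) by ring.
apply Rmult_le_compat_l; auto.
apply Rle_trans with ((x + 2) * (x + 2) * 1); [apply Rmult_le_compat_l; nra|nra].
Qed.

(** The second order errors of the powers add up to at most a constant times
[|z - z0|^2]. *)
Lemma termwise_derivative f g a z0 : has_coefs f a -> has_coefs g (dcoef a) -> in_disk z0 ->
  cderive f z0 (g z0).
Proof.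
intros Hf Hg Hz0. unfold in_disk in Hz0. pose proof (Cmod_ge_0 z0) as Hz0'.
set (rho := (Cmod z0 + 1) / 2). assert (Hr : 0 < rho < 1) by (unfold rho; lra).
assert (Hr2 : 0 < rho ^ 2) by (apply pow_lt; lra).
destruct (series_second_bound a rho (has_coefs_bounded _ _ Hf) Hr) as [K HK].
apply cderive_eps. intros eps Heps.
assert (Hd : 0 < Rmin (rho - Cmod z0) (eps * rho ^ 2 / (Rabs K + 1))).
{ apply Rmin_glb_lt. unfold rho; lra. pose proof (Rabs_pos K). apply Rdiv_lt_0_compat; [|lra]. apply Rmult_lt_0_compat; auto. }
eexists; split; [exact Hd|]. intros z Hw.
assert (Hw1 := Rlt_le_trans _ _ _ Hw (Rmin_l _ _)).
assert (Hw2 := Rlt_le_trans _ _ _ Hw (Rmin_r _ _)).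
pose proof (Rabs_pos K) as HK0. apply Rlt_div_r in Hw2; [|lra].
assert (Hzr : Cmod z <= rho).
{ replace z with (z - z0 + z0)%C by ring. eapply Rle_trans. apply Cmod_triangle. lra. }
set (E := fun n => (z ^ n - z0 ^ n - INR n * z0 ^ pred n * (z - z0))%C).
assert (HS : cseries (fun n => a n * E n)%C (f z - f z0 - g z0 * (z - z0))%C).
{ assert (S1 := Hf z ltac:(lra)). assert (S2 := Hf z0 ltac:(lra)).
  assert (S3 := Hg z0 ltac:(lra)).
  assert (S4 : cseries (fun n => INR n * a n * z0 ^ pred n)%C (g z0 + 0)%C).
  { replace (g z0 + 0)%C with (g z0 + INR 0 * a 0%nat * z0 ^ pred 0)%C by (simpl; ring).
    apply (cseries_decr (fun n => INR n * a n * z0 ^ pred n)%C). exact S3. }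
  apply (cseries_scal (z - z0)%C) in S4.
  eapply cseries_ext; [|replace (g z0 * (z - z0))%C with ((z - z0) * (g z0 + 0))%C by ring;
    apply cseries_minus; [apply cseries_minus; [exact S1|exact S2]|exact S4]].
  intros n. unfold E. simpl. ring. }
set (w := Cmod (z - z0)%C) in *. assert (Hw0 : 0 <= w) by apply Cmod_ge_0.
assert (B : Cmod (f z - f z0 - g z0 * (z - z0))%C <= K * w ^ 2 / rho ^ 2).
{ eapply cseries_bound; [|exact HS]. intros N.
  eapply Rle_trans. apply Cmod_csum.
  apply Rle_div_r. auto.
  apply Rle_trans with (rsum (fun n => w ^ 2 * (Cmod (a n) * (INR n ^ 2 * rho ^ n))) N).
  - rewrite Rmult_comm, <- rsum_scal. apply rsum_le. intros k _. rewrite Cmod_mult.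
    assert (P := pow_taylor_error k z z0 rho (proj1 Hr) Hzr ltac:(unfold rho; lra)).
    fold w in P. change (rho ^ 2 * Cmod (E k) <= INR k ^ 2 * rho ^ k * w ^ 2) in P.
    pose proof (Cmod_ge_0 (a k)).
    replace (rho ^ 2 * (Cmod (a k) * Cmod (E k))) with (Cmod (a k) * (rho ^ 2 * Cmod (E k))) by ring.
    replace (w ^ 2 * (Cmod (a k) * (INR k ^ 2 * rho ^ k))) with (Cmod (a k) * (INR k ^ 2 * rho ^ k * w ^ 2)) by ring.
    apply Rmult_le_compat_l; auto.
  - rewrite rsum_scal. specialize (HK N). rewrite Rmult_comm. apply Rmult_le_compat_r; auto. nra. }
eapply Rle_trans. exact B. apply Rle_div_l. auto.
assert (K <= Rabs K) by apply Rle_abs.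
assert (w * K <= w * (Rabs K + 1)) by (apply Rmult_le_compat_l; lra).
simpl. simpl in Hw2. nra.
Qed.

Lemma has_coefs_derivative f a : has_coefs f a ->
  has_coefs (series_fun (dcoef a)) (dcoef a) /\
  forall z, in_disk z -> cderive f z (series_fun (dcoef a) z).
Proof.
intros Hf. assert (H : has_coefs (series_fun (dcoef a)) (dcoef a)).
{ apply series_fun_correct, bounded_coefs_derive. eapply has_coefs_bounded; eauto. }
split; auto. intros z Hz. eapply termwise_derivative; eauto.
Qed.

Lemma has_coefs_analytic f a : has_coefs f a -> analytic_on_disk f.
Proof.
intros Hf z Hz. destruct (has_coefs_derivative f a Hf) as [_ H]. exists (series_fun (dcoef a) z).
apply H; auto.
Qed.

Lemma cderive_unique f z l m : cderive f z l -> cderive f z m -> l = m.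
Proof.
intros Hl Hm. apply is_C_derive_unique in Hl. apply is_C_derive_unique in Hm. congruence.
Qed.

Lemma derivative_coefs f f' a : has_coefs f a -> (forall z, in_disk z -> cderive f z (f' z)) ->
  has_coefs f' (dcoef a).
Proof.
intros Hf H. destruct (has_coefs_derivative f a Hf) as [H1 H2].
apply (series_on_ext 1 (series_fun (dcoef a)) f' (dcoef a) (dcoef a)); auto.
intros z Hz. apply (cderive_unique f z); auto.
Qed.

(** * Square means over circles *)

Lemma Cconj_plus u v : Cconj (u + v)%C = (Cconj u + Cconj v)%C.
Proof. destruct u, v. unfold Cconj, Cplus; simpl. f_equal; ring. Qed.

Lemma Cconj_mult u v : Cconj (u * v)%C = (Cconj u * Cconj v)%C.
Proof. destruct u, v. unfold Cconj, Cmult; simpl. f_equal; ring. Qed.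

Lemma Cconj_pow u n : Cconj (u ^ n)%C = (Cconj u ^ n)%C.
Proof.
induction n. unfold Cconj, RtoC; simpl. unfold RtoC. f_equal; ring.
rewrite !Cpow_S, Cconj_mult, IHn. auto.
Qed.

Lemma Cmod_sqr z : Cmod z ^ 2 = Re (z * Cconj z)%C.
Proof.
destruct z as [x y]. unfold Cmod. rewrite pow2_sqrt.
- unfold Re, Cconj, Cmult; simpl. ring.
- simpl. nra.
Qed.

Lemma RtoC_pow r n : RtoC (r ^ n) = (RtoC r ^ n)%C.
Proof. induction n; auto. rewrite Cpow_S, <- IHn, <- RtoC_mult. reflexivity. Qed.

Lemma Cconj_polar_pow r t n : 0 < r ->
  Cconj (polar r t ^ n)%C = (RtoC (r ^ (2 * n)) * (/ polar r t) ^ n)%C.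
Proof.
intros Hr. rewrite Cconj_pow, Cconj_polar, pow_mult, RtoC_pow, <- Cpow_mult_l. f_equal.
rewrite polar_inv by auto. rewrite <- (polar_0 (r ^ 2)), polar_mult. f_equal; [|ring]. field. lra.
Qed.

Lemma pcont_analytic h r t : analytic_on_disk h -> 0 <= r < 1 -> pcont (fun t => h (polar r t)) t.
Proof.
intros Hh Hr. apply (pcont_comp h). apply analytic_ccont; auto. apply in_disk_polar; auto. apply pcont_polar.
Qed.

Lemma pcont_conj p t : pcont p t -> pcont (fun s => Cconj (p s)) t.
Proof.
rewrite !pcont_components. intros [H1 H2]. split. exact H1.
exact (continuous_opp (V := R_NormedModule) _ _ H2).
Qed.

Lemma cpoly_analytic a N : analytic_on_disk (cpoly a N).
Proof. apply (has_coefs_analytic _ (trunc a N)), series_on_cpoly. Qed.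

Lemma cpoly_S a N z : cpoly a (S N) z = (cpoly a N z + a (S N) * z ^ S N)%C.
Proof. unfold cpoly. apply csum_S. Qed.

(** On the circle of radius [r] the conjugate of [z^n] is [r^(2n) / z^n], so the
integral against [z^n] is the formula for the [n]-th coefficient. *)
Lemma circle_inner_cpoly h b a N r : 0 < r < 1 -> analytic_on_disk h -> has_coefs h b ->
  CInt (fun t => h (polar r t) * Cconj (cpoly a N (polar r t)))%C 0 (2 * PI) =
  (RtoC (2 * PI) * csum (fun n => b n * Cconj (a n) * RtoC (r ^ (2 * n))) N)%C.
Proof.
intros Hr Hh Hb. pose proof two_PI_pos as Hpi.
assert (Hpi0 : RtoC (2 * PI) <> RtoC 0). { intros E. apply RtoC_inj in E. lra. }
assert (ex : forall n, ex_CInt (fun t => (/ polar r t) ^ n * h (polar r t))%C 0 (2 * PI)).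
{ intros n. apply ex_CInt_cont; [lra|]. intros t _. apply pcont_mult.
  apply pcont_inv_polar_pow; lra. apply pcont_analytic; auto; lra. }
assert (term : forall n, CInt (fun t => h (polar r t) * Cconj (a n * polar r t ^ n))%C 0 (2 * PI)
   = (RtoC (2 * PI) * (b n * Cconj (a n) * RtoC (r ^ (2 * n))))%C).
{ intros n. transitivity (CInt (fun t => (Cconj (a n) * RtoC (r ^ (2 * n))) *
     ((/ polar r t) ^ n * h (polar r t)))%C 0 (2 * PI)).
  - apply CInt_ext; [lra|]. intros t _. rewrite Cconj_mult, Cconj_polar_pow by lra. ring.
  - rewrite (CInt_scal _ (fun t => (/ polar r t) ^ n * h (polar r t))%C) by auto.
    rewrite (has_coefs_coef h b r Hh Hb Hr n). unfold coef. field. auto. }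
induction N.
- rewrite csum_0, <- (term 0%nat). unfold cpoly. apply CInt_ext; [lra|]. intros t _. rewrite csum_0. auto.
- rewrite csum_S, Cmult_plus_distr_l, <- IHN, <- (term (S N)), <- CInt_plus.
  + apply CInt_ext; [lra|]. intros t _. rewrite cpoly_S, Cconj_plus. ring.
  + apply ex_CInt_cont; [lra|]. intros t _. apply pcont_mult. apply pcont_analytic; auto; lra.
    apply pcont_conj. apply pcont_analytic; [apply cpoly_analytic|lra].
  + apply ex_CInt_cont; [lra|]. intros t _. apply pcont_mult. apply pcont_analytic; auto; lra.
    apply pcont_conj. apply (pcont_comp (fun z => a (S N) * z ^ S N)%C).
    eapply cderive_ccont. apply cderive_mult. apply cderive_const. apply cderive_pow. apply pcont_polar.
Qed.

Definition circle_norm2 (h : C -> C) (r : R) : R :=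
  RInt (fun t => Cmod (h (polar r t)) ^ 2) 0 (2 * PI).

Lemma cont_Re_inner g h r t : analytic_on_disk g -> analytic_on_disk h -> 0 < r < 1 ->
  continuous (fun t => Re (g (polar r t) * Cconj (h (polar r t)))%C) t.
Proof.
intros Hg Hh Hr.
assert (H : pcont (fun t => g (polar r t) * Cconj (h (polar r t)))%C t).
{ apply pcont_mult. apply pcont_analytic; auto; lra. apply pcont_conj, pcont_analytic; auto; lra. }
exact (proj1 (proj1 (pcont_components _ t) H)).
Qed.

Lemma ex_circle_norm2 h r : analytic_on_disk h -> 0 < r < 1 ->
  ex_RInt (fun t => Cmod (h (polar r t)) ^ 2) 0 (2 * PI).
Proof.
intros Hh Hr. apply (ex_RInt_continuous (V := R_CompleteNormedModule)). intros t _.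
apply (continuous_ext (fun t => Re (h (polar r t) * Cconj (h (polar r t)))%C)).
- intros s. symmetry. apply Cmod_sqr.
- apply cont_Re_inner; auto.
Qed.

Lemma circle_norm2_le g h r : analytic_on_disk g -> analytic_on_disk h -> 0 < r < 1 ->
  (forall z, in_disk z -> Cmod (g z) <= Cmod (h z)) -> circle_norm2 g r <= circle_norm2 h r.
Proof.
intros Hg Hh Hr H. apply RInt_le; try (apply ex_circle_norm2; auto).
pose proof two_PI_pos; lra. intros t _. apply pow_incr. split. apply Cmod_ge_0.
apply H, in_disk_polar; lra.
Qed.

Lemma Re_csum_sqr b a r N : (forall n, (n <= N)%nat -> b n = a n) ->
  Re (RtoC (2 * PI) * csum (fun n => b n * Cconj (a n) * RtoC (r ^ (2 * n))) N)%C =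
  2 * PI * rsum (fun n => Cmod (a n) ^ 2 * r ^ (2 * n)) N.
Proof.
intros H. rewrite (csum_ext _ (fun n => a n * Cconj (a n) * RtoC (r ^ (2 * n)))%C).
2: { intros k Hk. rewrite H; auto. }
transitivity (2 * PI * Re (csum (fun n => a n * Cconj (a n) * RtoC (r ^ (2 * n)))%C N)).
{ destruct (csum _ _). unfold Re, Cmult, RtoC; simpl. ring. }
f_equal. clear. induction N.
- rewrite csum_0, rsum_0, Cmod_sqr. destruct (a 0%nat). unfold Re, Cmult, RtoC; simpl. ring.
- rewrite csum_S, rsum_S, <- IHN, Cmod_sqr. set (u := csum _ _). clearbody u.
  destruct u, (a (S N)). unfold Re, Cmult, Cplus, RtoC; simpl. ring.
Qed.

(** Parseval's identity for polynomials. *)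
Lemma circle_norm2_cpoly a N r : 0 < r < 1 ->
  circle_norm2 (cpoly a N) r = 2 * PI * rsum (fun n => Cmod (a n) ^ 2 * r ^ (2 * n)) N.
Proof.
intros Hr. rewrite <- (Re_csum_sqr (trunc a N)).
2: { intros n Hn. apply trunc_le; auto. }
rewrite <- (circle_inner_cpoly (cpoly a N)); auto using cpoly_analytic, series_on_cpoly.
unfold circle_norm2, CInt, Re at 1; simpl fst. apply RInt_ext. intros t _. apply Cmod_sqr.
Qed.

(** With [p] the Taylor polynomial of degree [N] of [h], integrate
[|h|^2 >= 2 Re (h conj p) - |p|^2]; both terms on the right are inner products
with a polynomial. *)
Lemma bessel h b N r : 0 < r < 1 -> analytic_on_disk h -> has_coefs h b ->
  2 * PI * rsum (fun n => Cmod (b n) ^ 2 * r ^ (2 * n)) N <= circle_norm2 h r.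
Proof.
intros Hr Hh Hb. pose proof two_PI_pos as Hpi.
assert (E1 : RInt (fun t => Re (h (polar r t) * Cconj (cpoly b N (polar r t)))%C) 0 (2 * PI) =
  2 * PI * rsum (fun n => Cmod (b n) ^ 2 * r ^ (2 * n)) N).
{ rewrite <- (Re_csum_sqr b b) by auto. rewrite <- (circle_inner_cpoly h); auto. }
assert (E2 := circle_norm2_cpoly b N r Hr).
assert (Hp := cpoly_analytic b N).
assert (I1 : ex_RInt (fun t => Re (h (polar r t) * Cconj (cpoly b N (polar r t)))%C) 0 (2 * PI)).
{ apply (ex_RInt_continuous (V := R_CompleteNormedModule)). intros t _. apply cont_Re_inner; auto. }
assert (I2 := ex_circle_norm2 (cpoly b N) r Hp Hr).
set (f1 := fun t => Re (h (polar r t) * Cconj (cpoly b N (polar r t)))%C) in *.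
set (f2 := fun t => Cmod (cpoly b N (polar r t)) ^ 2) in *.
unfold circle_norm2 in E2. fold f2 in E2.
assert (I3 : is_RInt (fun t => 2 * f1 t - f2 t) 0 (2 * PI)
  (2 * (RInt f1 0 (2 * PI)) - RInt f2 0 (2 * PI))).
{ apply (is_RInt_minus (V := R_NormedModule) (fun t => 2 * f1 t) f2).
  apply (is_RInt_scal (V := R_NormedModule)). apply (RInt_correct (V := R_CompleteNormedModule)); auto.
  apply (RInt_correct (V := R_CompleteNormedModule)); auto. }
replace (2 * PI * rsum (fun n => Cmod (b n) ^ 2 * r ^ (2 * n)) N)
  with (2 * (RInt f1 0 (2 * PI)) - RInt f2 0 (2 * PI)) by (rewrite E1, E2; ring).
rewrite <- (is_RInt_unique (V := R_CompleteNormedModule) _ _ _ _ I3).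
apply RInt_le. lra. eexists; exact I3. apply ex_circle_norm2; auto.
intros t _. unfold f1, f2. rewrite !Cmod_sqr.
set (u := h (polar r t)). set (v := cpoly b N (polar r t)).
destruct u as [u1 u2], v as [v1 v2]. unfold Re, Cmult, Cconj; simpl.
pose proof (Rle_0_sqr (u1 - v1)). pose proof (Rle_0_sqr (u2 - v2)). unfold Rsqr in *. lra.
Qed.

(** * Functions bounded by one *)

(** Replacing the powers by the smallest one, [r^(2N)], leaves a bound that passes
to the limit [r -> 1]. *)
Lemma rsum_radius_limit u N S : (forall k, 0 <= u k) ->
  (forall r, 0 < r < 1 -> rsum (fun n => u n * r ^ (2 * n)) N <= S) -> rsum u N <= S.
Proof.
intros Hu H. assert (H1 : forall r, 0 < r < 1 -> rsum u N * r ^ (2 * N) <= S).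
{ intros r Hr. eapply Rle_trans; [|apply (H r Hr)]. rewrite Rmult_comm, <- rsum_scal.
  apply rsum_le. intros k Hk. rewrite Rmult_comm. apply Rmult_le_compat_l; auto.
  replace (2 * N)%nat with (2 * k + 2 * (N - k))%nat by lia. rewrite pow_add.
  rewrite <- (Rmult_1_r (r ^ (2 * k))) at 2. apply Rmult_le_compat_l. apply pow_le; lra.
  rewrite <- (pow1 (2 * (N - k))). apply pow_incr; lra. }
apply Rnot_lt_le. intros Hlt.
assert (HS : 0 <= S).
{ eapply Rle_trans; [|apply (H1 (/2)); lra]. apply Rmult_le_pos; [|apply pow_le; lra].
  clear -Hu. induction N. rewrite rsum_0; auto. rewrite rsum_S. specialize (Hu (Datatypes.S N)). lra. }
set (s := rsum u N) in *.
(* The radii [1 - 1/(n+2)] are positive and tend to 1. *)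
assert (C1 : is_lim_seq (fun n => s * (1 - / INR (n + 2)) ^ (2 * N)) (s * (1 - 0) ^ (2 * N))).
{ apply (is_lim_seq_scal_l _ s (Finite ((1 - 0) ^ (2 * N)))).
  apply (is_lim_seq_continuous (fun x => x ^ (2 * N)) (fun n => 1 - / INR (n + 2))).
  - apply derivable_continuous_pt, derivable_pt_pow.
  - apply is_lim_seq_minus'. apply is_lim_seq_const.
    replace (Finite 0) with (Rbar_inv p_infty) by reflexivity.
    apply is_lim_seq_inv; [|discriminate].
    apply (is_lim_seq_incr_n INR 2). apply is_lim_seq_INR. }
rewrite Rminus_0_r, pow1, Rmult_1_r in C1.
assert (s <= S); [|lra].
apply (is_lim_seq_le _ (fun _ => S) s S) in C1; auto using is_lim_seq_const.
intros n. apply H1. assert (2 <= INR (n + 2)). { replace 2 with (INR 2) by reflexivity. apply le_INR; lia. }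
assert (0 < / INR (n + 2)) by (apply Rinv_0_lt_compat; lra).
assert (/ INR (n + 2) <= / 2) by (apply Rinv_le_contravar; lra). lra.
Qed.

Lemma analytic_mult f g : analytic_on_disk f -> analytic_on_disk g -> analytic_on_disk (fun z => f z * g z)%C.
Proof.
intros Hf Hg z Hz. destruct (analytic_cderive f z Hf Hz) as [a Ha].
destruct (analytic_cderive g z Hg Hz) as [b Hb]. eexists. apply (cderive_mult f g z a b Ha Hb).
Qed.

(** The first [N + 1] coefficients of [phi h] only depend on those of [h], so [h]
may be replaced by its Taylor polynomial [p].  Then the square mean of [phi p]
is at most that of [p], which is computed by Parseval's identity, and dominates
the coefficients of [phi p] by Bessel's inequality. *)
Lemma schur_contraction phi h b c N : analytic_on_disk phi ->
  (forall z, in_disk z -> Cmod (phi z) <= 1) -> has_coefs h b ->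
  has_coefs (fun z => phi z * h z)%C c ->
  rsum (fun n => Cmod (c n) ^ 2) N <= rsum (fun n => Cmod (b n) ^ 2) N.
Proof.
intros Hphi Hb1 Hh Hc.
set (p := cpoly b N). assert (Hp : analytic_on_disk p) by apply cpoly_analytic.
set (k := fun z => (phi z * p z)%C).
assert (Hk : analytic_on_disk k) by (apply analytic_mult; auto).
set (d := coef k (/ 2)). assert (Hd : has_coefs k d) by (apply analytic_coefs; auto; lra).
assert (Ecd : forall n, (n <= N)%nat -> c n = d n).
{ apply (coefs_small_o_eq 1 (fun z => phi z * h z)%C k); auto; [lra|].
  apply small_o_ext with (f := fun z => (phi z * (h z - p z))%C). intros; unfold k; ring.
  apply small_o_mult_bounded with (M := 1) (d0 := 1); [lra|auto|].
  apply taylor_small_o with 1; auto; lra. }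
rewrite (rsum_ext _ (fun n => Cmod (d n) ^ 2)) by (intros n Hn; rewrite Ecd; auto).
apply rsum_radius_limit. intros; apply pow2_ge_0.
intros r Hr. pose proof two_PI_pos as Hpi.
apply Rmult_le_reg_l with (2 * PI); auto.
eapply Rle_trans. apply (bessel k); auto.
eapply Rle_trans. apply (circle_norm2_le k p); auto.
{ intros z Hz. unfold k. rewrite Cmod_mult. rewrite <- (Rmult_1_l (Cmod (p z))) at 2.
  apply Rmult_le_compat_r; auto. apply Cmod_ge_0. }
unfold p. rewrite circle_norm2_cpoly by auto. apply Rmult_le_compat_l; [lra|].
apply rsum_le. intros n _. rewrite <- (Rmult_1_r (Cmod (b n) ^ 2)) at 2.
apply Rmult_le_compat_l. apply pow2_ge_0. rewrite <- (pow1 (2 * n)). apply pow_incr; lra.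
Qed.

Lemma rsum_shift u n : rsum u (S n) = u 0%nat + rsum (fun k => u (S k)) n.
Proof.
induction n. rewrite rsum_S, !rsum_0. auto. rewrite rsum_S, IHn, rsum_S. ring.
Qed.

Lemma csum_shift u n : csum u (S n) = (u 0%nat + csum (fun k => u (S k)) n)%C.
Proof.
induction n. rewrite csum_S, !csum_0. auto. rewrite csum_S, IHn, csum_S. ring.
Qed.

Definition const_coefs (c : C) (n : nat) : C := match n with O => c | S _ => RtoC 0 end.

Lemma series_on_const R c : series_on R (fun _ => c) (const_coefs c).
Proof.
intros z Hz. pose proof (cseries_finite (fun n => const_coefs c n * z ^ n)%C 0) as H.
rewrite csum_0 in H. replace (const_coefs c 0 * z ^ 0)%C with c in H by (simpl; ring).
apply H. intros k Hk. destruct k; [lia|]. simpl. ring.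
Qed.

Lemma rsum_tail_zero u n : (forall k, u (S k) = 0) -> rsum u n = u 0%nat.
Proof. intros H. induction n. apply rsum_0. rewrite rsum_S, IHn, H. ring. Qed.

(** Contraction applied to the constant function 1. *)
Lemma schur_coef_bound phi a n : analytic_on_disk phi -> (forall z, in_disk z -> Cmod (phi z) <= 1) ->
  has_coefs phi a -> Cmod (a n) <= 1.
Proof.
intros Hphi Hb Ha.
assert (H := schur_contraction phi (fun _ => RtoC 1) (const_coefs 1) a n Hphi Hb (series_on_const 1 _)).
assert (H' : rsum (fun n => Cmod (a n) ^ 2) n <= 1).
{ eapply Rle_trans. apply H.
  - apply (series_on_ext 1 phi _ a a); auto. intros; ring.
  - rewrite rsum_tail_zero. simpl. rewrite Cmod_1. lra. intros k. simpl. rewrite Cmod_0. ring. }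
assert (Hp : forall m, 0 <= rsum (fun n => Cmod (a n) ^ 2) m).
{ induction m. rewrite rsum_0; apply pow2_ge_0. rewrite rsum_S. pose proof (pow2_ge_0 (Cmod (a (S m)))). lra. }
assert (Cmod (a n) ^ 2 <= 1).
{ destruct n. rewrite rsum_0 in H'; auto. rewrite rsum_S in H'. specialize (Hp n). lra. }
pose proof (Cmod_ge_0 (a n)). nra.
Qed.

(** * Rogosinski's theorem on subordinate functions *)

Lemma analytic_comp_cpoly phi B m : analytic_on_disk phi -> analytic_on_disk (fun z => cpoly B m (phi z)).
Proof.
intros Hphi. induction m.
- intros z Hz. exists (RtoC 0). apply (cderive_ext_loc (fun _ => B 0%nat) _ z _ 1); [lra| |apply cderive_const].
  intros w _. unfold cpoly. rewrite csum_0. simpl. ring.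
- intros z Hz. destruct (analytic_cderive _ z IHm Hz) as [l Hl].
  destruct (analytic_cderive _ z Hphi Hz) as [d Hd]. eexists.
  apply (cderive_ext_loc (fun w => cpoly B m (phi w) + B (S m) * (phi w) ^ S m)%C _ z _ 1); [lra| |].
  + intros w _. rewrite cpoly_S. auto.
  + apply cderive_plus. exact Hl. apply cderive_mult. apply cderive_const.
    apply (cderive_comp (fun w => w ^ S m)%C phi). apply cderive_pow. exact Hd.
Qed.

Lemma cpoly_horner B m w : cpoly B (S m) w = (B 0%nat + w * cpoly (fun k => B (S k)) m w)%C.
Proof.
unfold cpoly. rewrite csum_shift, <- csum_scal. simpl. f_equal. ring.
apply csum_ext. intros k _. ring.
Qed.

(** Induction along the Horner scheme.  The constant term and the multiple of
[phi] have no coefficient in common because [phi] vanishes at 0, so the square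
norms add up, and multiplication by [phi] is a contraction. *)
Lemma littlewood_cpoly phi N m : analytic_on_disk phi -> (forall z, in_disk z -> Cmod (phi z) <= 1) ->
  phi (RtoC 0) = RtoC 0 -> forall B c, has_coefs (fun z => cpoly B m (phi z)) c ->
  rsum (fun n => Cmod (c n) ^ 2) N <= rsum (fun n => Cmod (B n) ^ 2) m.
Proof.
intros Hphi Hb H0. induction m; intros B c Hc.
- assert (Hc' : has_coefs (fun z => cpoly B 0 (phi z)) (const_coefs (B 0%nat))).
  { eapply series_on_ext; [| |apply (series_on_const 1 (B 0%nat))]; auto.
    intros z _. unfold cpoly. rewrite csum_0. simpl. ring. }
  assert (E := coefs_unique 1 _ _ _ Rlt_0_1 Hc Hc').
  rewrite rsum_tail_zero, rsum_0, E. simpl; lra. intros k. rewrite E. simpl. rewrite Cmod_0. ring.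
- set (h := fun z => cpoly (fun k => B (S k)) m (phi z)).
  assert (Hh : analytic_on_disk h) by (apply analytic_comp_cpoly; auto).
  assert (Hhc := analytic_coefs h (/ 2) Hh ltac:(lra)).
  assert (Hkc := analytic_coefs _ (/ 2) (analytic_mult _ _ Hphi Hh) ltac:(lra)).
  set (b := coef h (/ 2)) in *. set (d := coef (fun z => phi z * h z)%C (/ 2)) in *.
  assert (E : forall n, c n = (const_coefs (B 0%nat) n + d n)%C).
  { apply (coefs_unique 1 (fun z => cpoly B (S m) (phi z))); auto; [lra|].
    eapply series_on_ext; [| |apply (series_on_plus 1 _ _ _ _ (series_on_const 1 (B 0%nat)) Hkc)]; auto.
    intros z _. simpl. rewrite cpoly_horner. auto. }
  assert (Ed : d 0%nat = RtoC 0).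
  { rewrite <- (series_on_0 1 _ _ Rlt_0_1 Hkc). simpl. rewrite H0. ring. }
  specialize (IHm _ _ Hhc).
  assert (S1 := schur_contraction phi h b d N Hphi Hb Hhc Hkc).
  rewrite rsum_shift.
  apply Rle_trans with (Cmod (B 0%nat) ^ 2 + rsum (fun n => Cmod (d n) ^ 2) N); [|lra].
  right. clear -E Ed. induction N.
  + rewrite !rsum_0, E, Ed. simpl. rewrite Cplus_0_r, Cmod_0. ring.
  + rewrite !rsum_S, IHN, E. simpl const_coefs. rewrite Cplus_0_l. ring.
Qed.

(** As [phi z = O(z)], the remainder of order [N + 1] of [G] stays of that order
after substitution. *)
Lemma coefs_comp_small phi G B N : analytic_on_disk phi ->
  phi (RtoC 0) = RtoC 0 -> forall R, 0 < R -> series_on R G B ->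
  small_o (fun z => G (phi z) - cpoly B N (phi z))%C N.
Proof.
intros Hphi H0 R HR HG.
destruct (vanish_bigO R _ _ (S N) HR (series_on_minus _ _ _ _ _ HG (series_on_cpoly R B N))) as [M HM].
{ intros k Hk. rewrite trunc_le by lia. ring. }
assert (Hpc := analytic_coefs phi (/ 2) Hphi ltac:(lra)).
destruct (vanish_bigO 1 phi _ 1 Rlt_0_1 Hpc) as [M' HM'].
{ intros k Hk. replace k with 0%nat by lia. rewrite <- (series_on_0 1 _ _ Rlt_0_1 Hpc). auto. }
set (M2 := Rabs M' + 1). assert (HM2 : 0 < M2) by (unfold M2; pose proof (Rabs_pos M'); lra).
apply (bigO_small_o _ N (Rabs M * M2 ^ S N) (Rmin (1 / 4) (R / 4 / M2))).
{ apply Rmin_glb_lt; [lra|]. apply Rdiv_lt_0_compat; lra. }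
intros z Hz. assert (Hz1 := Rlt_le_trans _ _ _ Hz (Rmin_l _ _)).
assert (Hz2 := Rlt_le_trans _ _ _ Hz (Rmin_r _ _)). apply Rlt_div_r in Hz2; auto.
pose proof (Cmod_ge_0 z) as Hz0.
assert (P : Cmod (phi z) <= M2 * Cmod z).
{ eapply Rle_trans. apply HM'. lra. rewrite pow_1. apply Rmult_le_compat_r; auto.
  unfold M2. pose proof (Rle_abs M'). lra. }
eapply Rle_trans. apply HM. lra.
apply Rle_trans with (Rabs M * Cmod (phi z) ^ S N).
- apply Rmult_le_compat_r. apply pow_le, Cmod_ge_0. apply Rle_abs.
- rewrite Rmult_assoc, <- Rpow_mult_distr. apply Rmult_le_compat_l. apply Rabs_pos.
  apply pow_incr. split; auto. apply Cmod_ge_0.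
Qed.

(** Up to the index [N], the coefficients of [G o phi] are those of the
composition of the Taylor polynomial of [G] with [phi]. *)
Lemma rogosinski phi F G B c N : analytic_on_disk phi -> (forall z, in_disk z -> Cmod (phi z) < 1) ->
  phi (RtoC 0) = RtoC 0 -> (forall z, in_disk z -> F z = G (phi z)) ->
  has_coefs G B -> has_coefs F c ->
  rsum (fun n => Cmod (c n) ^ 2) N <= rsum (fun n => Cmod (B n) ^ 2) N.
Proof.
intros Hphi Hb H0 HFG HG HF.
set (p := fun z => cpoly B N (phi z)).
assert (Hp := analytic_coefs p (/ 2) (analytic_comp_cpoly phi B N Hphi) ltac:(lra)).
set (d := coef p (/ 2)) in *.
assert (E : forall n, (n <= N)%nat -> c n = d n).
{ apply (coefs_small_o_eq 1 F p); auto; [lra|].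
  apply small_o_ext with (f := fun z => (G (phi z) - cpoly B N (phi z))%C).
  intros z Hz. rewrite HFG; auto. apply coefs_comp_small with 1; auto; lra. }
rewrite (rsum_ext _ (fun n => Cmod (d n) ^ 2)) by (intros n Hn; rewrite E; auto).
apply littlewood_cpoly with phi; auto. intros z Hz; left; auto.
Qed.

(** Summation by parts: the difference of the two sides is at least [w N] times
the difference of the unweighted sums, by induction. *)
Lemma weighted_rsum_le (x y w : nat -> R) N : (forall n, 0 <= w (S n) <= w n) ->
  (forall n, rsum x n <= rsum y n) ->
  rsum (fun n => w n * x n) N <= rsum (fun n => w n * y n) N.
Proof.
intros Hw Hxy.
assert (H : w N * (rsum y N - rsum x N) <= rsum (fun n => w n * y n) N - rsum (fun n => w n * x n) N).
{ induction N. rewrite !rsum_0. lra. rewrite !rsum_S.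
  specialize (Hw N). specialize (Hxy N). nra. }
specialize (Hxy N). assert (0 <= w N) by (specialize (Hw N); lra). nra.
Qed.

(** * The principal logarithm and principal powers *)

(** The definition of the argument by [acos] is correct in both half-planes: the
sine of [acos x] is the nonnegative root, and the sign of the imaginary part
selects the branch. *)
Lemma polar_Carg z : z <> RtoC 0 -> polar (Cmod z) (Carg z) = z.
Proof.
intros Hz. assert (Hm : 0 < Cmod z) by (apply Cmod_gt_0; auto).
set (m := Cmod z) in *. destruct z as [x y].
assert (Hm2 : m * m = x * x + y * y).
{ unfold m, Cmod. simpl fst; simpl snd. rewrite sqrt_sqrt. ring. nra. }
assert (Hx : -1 <= x / m <= 1).
{ pose proof (Re_le_Cmod (x, y)) as H. fold m in H. unfold Re in H; simpl in H.
  apply Rabs_le_between in H. split. apply Rle_div_r; lra. apply Rle_div_l; lra. }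
assert (Hs : m * sqrt (1 - Rsqr (x / m)) = Rabs y).
{ rewrite <- (sqrt_Rsqr m) at 1 by lra. rewrite <- sqrt_mult_alt by (apply Rle_0_sqr).
  rewrite <- sqrt_Rsqr_abs. f_equal. unfold Rsqr. field_simplify; [|lra]. nra. }
unfold polar, Carg, Re, Im; simpl fst; simpl snd. fold m.
destruct (Rle_dec 0 y) as [Hy|Hy].
- rewrite cos_acos, sin_acos, Hs, Rabs_pos_eq by auto. f_equal. field. lra.
- rewrite cos_neg, sin_neg, cos_acos, sin_acos by auto.
  f_equal. field; lra. rewrite Ropp_mult_distr_r_reverse, Hs, Rabs_left by lra. ring.
Qed.

Lemma Cexp_Clog z : z <> RtoC 0 -> Cexp (Clog z) = z.
Proof.
intros Hz. unfold Clog. rewrite Cexp_polar, exp_ln by (apply Cmod_gt_0; auto). apply polar_Carg; auto.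
Qed.

Lemma Re_pos_neq_0 z : 0 < Re z -> z <> RtoC 0.
Proof. intros H ->. unfold Re in H; simpl in H. lra. Qed.

Lemma Carg_bound z : 0 < Re z -> - (PI / 2) < Carg z < PI / 2.
Proof.
intros H. assert (Hz := Re_pos_neq_0 z H). assert (Hm := proj1 (Cmod_gt_0 z) Hz).
assert (Hx : 0 < Re z / Cmod z) by (apply Rdiv_lt_0_compat; auto).
assert (Hx1 : -1 <= Re z / Cmod z <= 1).
{ split. lra. apply Rle_div_l; auto. pose proof (Re_le_Cmod z). pose proof (Rle_abs (Re z)). lra. }
assert (Ha : 0 <= acos (Re z / Cmod z) < PI / 2).
{ pose proof (acos_bound (Re z / Cmod z)) as [B1 B2]. split; auto.
  apply Rnot_le_lt. intros Hle. pose proof PI_RGT_0.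
  assert (C := cos_le_0 _ Hle ltac:(lra)). rewrite cos_acos in C; lra. }
unfold Carg. destruct (Rle_dec 0 (Im z)); lra.
Qed.

Lemma Carg_atan z : 0 < Re z -> Carg z = atan (Im z / Re z).
Proof.
intros H. assert (Hb := Carg_bound z H). assert (Hz := Re_pos_neq_0 z H).
assert (Hm := proj1 (Cmod_gt_0 z) Hz).
assert (E := polar_Carg z Hz).
rewrite <- (atan_tan (Carg z)) by auto. f_equal. unfold tan.
rewrite <- E at 3 4. unfold polar, Re, Im; simpl fst; simpl snd.
assert (0 < cos (Carg z)) by (apply cos_gt_0; lra).
field. lra.
Qed.

Lemma continuity_2d_ccont (f g : R -> R -> R) (h : C -> C) z d : 0 < d ->
  (forall w, Cmod (w - z)%C < d -> h w = (f (Re w) (Im w), g (Re w) (Im w))) ->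
  continuity_2d_pt f (Re z) (Im z) -> continuity_2d_pt g (Re z) (Im z) -> ccont h z.
Proof.
intros Hd Hh Hf Hg eps Heps. assert (H2 : 0 < eps / 2) by lra.
destruct (Hf (mkposreal _ H2)) as [d1 H1]. destruct (Hg (mkposreal _ H2)) as [d2 H2'].
exists (Rmin d (Rmin d1 d2)). split. { repeat apply Rmin_glb_lt; auto; apply cond_pos. }
intros w Hw. assert (Hw0 := Rlt_le_trans _ _ _ Hw (Rmin_l _ _)).
assert (Hw' := Rlt_le_trans _ _ _ Hw (Rmin_r _ _)).
assert (Hw1 := Rlt_le_trans _ _ _ Hw' (Rmin_l _ _)).
assert (Hw2 := Rlt_le_trans _ _ _ Hw' (Rmin_r _ _)).
rewrite (Hh w Hw0), (Hh z).
2: { replace (z - z)%C with (RtoC 0) by ring. rewrite Cmod_0; auto. }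
pose proof (Re_le_Cmod (w - z)%C) as R1. pose proof (Im_le_Cmod (w - z)%C) as R2.
rewrite Re_minus in R1. rewrite Im_minus in R2.
specialize (H1 (Re w) (Im w) ltac:(lra) ltac:(lra)).
specialize (H2' (Re w) (Im w) ltac:(lra) ltac:(lra)). simpl in H1, H2'.
eapply Rle_lt_trans. apply Cmod_le_sum. rewrite Re_minus, Im_minus.
change (Rabs (f (Re w) (Im w) - f (Re z) (Im z)) + Rabs (g (Re w) (Im w) - g (Re z) (Im z)) < eps). lra.
Qed.

(** In the right half-plane the argument is an arctangent, hence continuous. *)
Lemma Clog_ccont z : 0 < Re z -> ccont Clog z.
Proof.
intros H. assert (Hz := Re_pos_neq_0 z H). assert (Hm := proj1 (Cmod_gt_0 z) Hz).
apply (continuity_2d_ccont (fun u v => ln (sqrt (u * u + v * v))) (fun u v => atan (v * / u)) _ _ (Re z)); auto.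
- intros w Hw. assert (Hr : 0 < Re w).
  { pose proof (Re_le_Cmod (w - z)%C) as R1. rewrite Re_minus in R1.
    assert (R2 := Rle_lt_trans _ _ _ R1 Hw). apply Rabs_def2 in R2. lra. }
  unfold Clog. rewrite Carg_atan by auto. f_equal.
  destruct w as [u v]. unfold Cmod, Re, Im; simpl fst; simpl snd. f_equal. f_equal. ring.
- assert (Hp : 0 < Re z * Re z + Im z * Im z) by nra.
  apply (continuity_1d_2d_pt_comp ln (fun u v => sqrt (u * u + v * v))).
  + apply continuity_pt_filterlim. apply (ex_derive_continuous (V := R_NormedModule)).
    exists (/ sqrt (Re z * Re z + Im z * Im z)). apply is_derive_ln. apply sqrt_lt_R0; auto.
  + apply (continuity_1d_2d_pt_comp sqrt (fun u v => u * u + v * v)).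
    apply continuity_pt_sqrt. lra.
    apply continuity_2d_pt_plus; apply continuity_2d_pt_mult;
      (apply continuity_2d_pt_id1 || apply continuity_2d_pt_id2).
- apply (continuity_1d_2d_pt_comp atan (fun u v => v * / u)).
  + apply derivable_continuous_pt, derivable_pt_atan.
  + apply continuity_2d_pt_mult. apply continuity_2d_pt_id2.
    apply (continuity_2d_pt_inv (fun u v => u)). apply continuity_2d_pt_id1. lra.
Qed.

(** Derivative of an inverse function: [Clog] is continuous and [Cexp] inverts
it, with nonzero derivative. *)
Lemma cderive_Clog z : 0 < Re z -> cderive Clog z (/ z)%C.
Proof.
intros H. assert (Hz := Re_pos_neq_0 z H). assert (Hm := proj1 (Cmod_gt_0 z) Hz).
apply cderive_eps. intros eps Heps.
set (m := Cmod z) in *.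
(* The bound [m / 2] gives [m |u| <= 2 |v|] for the increments [u] of the
   logarithm and [v] of its argument; the other one gives the estimate. *)
set (e := Rmin (m / 2) (eps * (m * m) / 2)).
assert (He : 0 < e). { apply Rmin_glb_lt; [lra|]. apply Rdiv_lt_0_compat; [|lra]. apply Rmult_lt_0_compat; nra. }
assert (He1 : e <= m / 2) by apply Rmin_l. assert (He2 : e <= eps * (m * m) / 2) by apply Rmin_r.
destruct (proj1 (cderive_eps _ _ _) (cderive_Cexp (Clog z)) e He) as [d1 [Hd1 H1]].
destruct (Clog_ccont z H d1 Hd1) as [d2 [Hd2 H2]].
exists (Rmin d2 (Re z)). split. apply Rmin_glb_lt; auto. intros w Hw.
assert (Hw1 := Rlt_le_trans _ _ _ Hw (Rmin_l _ _)).
assert (Hw2 := Rlt_le_trans _ _ _ Hw (Rmin_r _ _)).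
assert (Hr : 0 < Re w).
{ pose proof (Re_le_Cmod (w - z)%C) as R1. rewrite Re_minus in R1.
  assert (R2 := Rle_lt_trans _ _ _ R1 Hw2). apply Rabs_def2 in R2. lra. }
specialize (H1 _ (H2 w Hw1)). rewrite !Cexp_Clog in H1 by (auto using Re_pos_neq_0).
set (u := (Clog w - Clog z)%C) in *. set (v := (w - z)%C) in *.
replace (u - / z * v)%C with (- ((v - z * u) / z))%C by (field; auto).
rewrite Cmod_opp, Cmod_div by auto. fold m. apply Rle_div_l; auto.
assert (Hu : m * Cmod u <= Cmod v + e * Cmod u).
{ pose proof (Cmod_triangle v (- (v - z * u))%C) as T. rewrite Cmod_opp in T.
  replace (v + - (v - z * u))%C with (z * u)%C in T by ring. rewrite Cmod_mult in T. fold m in T. lra. }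
pose proof (Cmod_ge_0 u) as P1. pose proof (Cmod_ge_0 v) as P2.
assert (Hu2 : m * Cmod u <= 2 * Cmod v) by nra.
apply Rle_trans with (1 := H1).
apply Rmult_le_reg_l with m; auto.
apply Rle_trans with (e * (2 * Cmod v)). { replace (m * (e * Cmod u)) with (e * (m * Cmod u)) by ring. apply Rmult_le_compat_l; lra. }
apply Rle_trans with (eps * (m * m) / 2 * (2 * Cmod v)). apply Rmult_le_compat_r; lra. right. field.
Qed.

Lemma cderive_Cpower z b : 0 < Re z -> cderive (fun w => Cpower w b) z (RtoC b * Cpower z b / z)%C.
Proof.
intros H. eapply cderive_eq.
- apply (cderive_comp Cexp (fun w => RtoC b * Clog w)%C). apply cderive_Cexp.
  apply cderive_mult. apply cderive_const. apply cderive_Clog; auto.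
- simpl. unfold Cpower. field. apply Re_pos_neq_0; auto.
Qed.

Lemma Clog_1 : Clog (RtoC 1) = RtoC 0.
Proof.
unfold Clog. rewrite Carg_atan by (unfold Re; simpl; lra).
rewrite Cmod_1, ln_1. unfold Re, Im, RtoC; simpl. f_equal. unfold Rdiv. rewrite Rmult_0_l. apply atan_0.
Qed.

Lemma Cpower_1 b : Cpower (RtoC 1) b = RtoC 1.
Proof. unfold Cpower. rewrite Clog_1, Cmult_0_r. apply Cexp_0. Qed.

Lemma Cpower_polar z b : z <> RtoC 0 ->
  Cpower z b = polar (exp (b * ln (Cmod z))) (b * Carg z).
Proof.
intros Hz. unfold Cpower, Clog. rewrite <- Cexp_polar. f_equal.
unfold Cmult, RtoC; simpl. f_equal; ring.
Qed.

(** * The sector map and the sector *)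

Lemma cayley_Re_pos z : in_disk z -> 0 < Re ((RtoC 1 + z) / (RtoC 1 - z))%C.
Proof.
intros Hz. unfold in_disk in Hz.
assert (Hz2 : Cmod z ^ 2 < 1). { pose proof (Cmod_ge_0 z). nra. }
rewrite Cmod_sqr in Hz2. destruct z as [x y]. unfold Re, Cmult, Cconj in Hz2; simpl in Hz2.
unfold Re, Cdiv, Cinv, Cminus, Copp, Cmult, Cplus, RtoC; simpl.
assert (Hd : 0 < (1 + - x) * ((1 + - x) * 1) + (0 + - y) * ((0 + - y) * 1)) by nra.
set (D := (1 + - x) * ((1 + - x) * 1) + (0 + - y) * ((0 + - y) * 1)) in *.
replace ((1 + x) * ((1 + - x) / D) - (0 + y) * (- (0 + - y) / D)) with ((1 - x * x - y * y) / D) by (field; lra).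
apply Rdiv_lt_0_compat; auto. lra.
Qed.

Lemma one_minus_neq_0 z : in_disk z -> (RtoC 1 - z)%C <> RtoC 0.
Proof.
intros Hz E. unfold in_disk in Hz. replace z with (RtoC 1) in Hz. rewrite Cmod_1 in Hz. lra.
apply Ceq_minus; auto.
Qed.

(** A point of the right half-plane is closer to 1 than to -1. *)
Lemma cayley_inv_lt_1 p : 0 < Re p -> (p + 1)%C <> RtoC 0 /\ Cmod ((p - 1) / (p + 1))%C < 1.
Proof.
intros Hp. assert (Hn : (p + 1)%C <> RtoC 0).
{ apply Re_pos_neq_0. unfold Re in *. destruct p; simpl in *. lra. }
split; auto. rewrite Cmod_div by auto. apply Rlt_div_l. apply Cmod_gt_0; auto. rewrite Rmult_1_l.
apply Rsqr_incrst_0; try apply Cmod_ge_0.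
replace (Rsqr (Cmod (p - 1)%C)) with (Cmod (p - 1)%C ^ 2) by (unfold Rsqr; ring).
replace (Rsqr (Cmod (p + 1)%C)) with (Cmod (p + 1)%C ^ 2) by (unfold Rsqr; ring).
rewrite !Cmod_sqr. destruct p as [x y]. unfold Re, Cconj, Cminus, Copp, Cplus, Cmult, RtoC in *; simpl in *. nra.
Qed.

Lemma cderive_sector_map alpha z : in_disk z ->
  cderive (sector_map alpha) z (RtoC (2 * alpha) * sector_map alpha z / ((1 - z) * (1 + z)))%C.
Proof.
intros Hz. assert (Hn := one_minus_neq_0 z Hz). assert (Hp := cayley_Re_pos z Hz).
assert (Hn1 : (1 + z)%C <> RtoC 0).
{ intros E. apply (Re_pos_neq_0 _ Hp). rewrite E. unfold Cdiv. ring. }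
eapply cderive_eq.
- apply (cderive_comp (fun w => Cpower w alpha) (fun z => (RtoC 1 + z) / (RtoC 1 - z))%C).
  apply cderive_Cpower; auto. apply cderive_div; auto.
  apply cderive_plus. apply cderive_const. apply cderive_id.
  apply cderive_minus. apply cderive_const. apply cderive_id.
- simpl. change (Cpower ((RtoC 1 + z) / (RtoC 1 - z))%C alpha) with (sector_map alpha z).
  rewrite RtoC_mult. field. auto.
Qed.

Lemma sector_map_analytic alpha : analytic_on_disk (sector_map alpha).
Proof. intros z Hz. eexists. apply cderive_sector_map; auto. Qed.

Lemma sector_map_0 alpha : sector_map alpha (RtoC 0) = RtoC 1.
Proof.
unfold sector_map. replace ((1 + 0) / (1 - 0))%C with (RtoC 1) by (field; replace (1 - 0)%C with (RtoC 1) by ring; apply C1_nz).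
apply Cpower_1.
Qed.

(** The sector [|arg w| < alpha pi/2] as the intersection of the two half-planes
bounded by its sides, rotated by [b = (1 - alpha) pi/2]; convexity is then
obvious. *)
Definition in_sector (alpha : R) (w : C) : Prop :=
  let b := (1 - alpha) * (PI / 2) in
  0 < Re w * cos b - Im w * sin b /\ 0 < Re w * cos b + Im w * sin b.

Lemma in_sector_plus alpha u v : in_sector alpha u -> in_sector alpha v -> in_sector alpha (u + v)%C.
Proof. unfold in_sector, Re, Im; destruct u, v; simpl. intros; lra. Qed.

Lemma in_sector_scal alpha r u : 0 < r -> in_sector alpha u -> in_sector alpha (RtoC r * u)%C.
Proof.
unfold in_sector, Re, Im; destruct u as [x y]; simpl. intros Hr [H1 H2].
replace (r * x - 0 * y) with (r * x) by ring. replace (r * y + 0 * x) with (r * y) by ring.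
rewrite !Rmult_assoc. split; nra.
Qed.

Lemma in_sector_polar alpha r t : 0 < r ->
  (in_sector alpha (polar r t) <-> 0 < cos (t + (1 - alpha) * (PI / 2)) /\ 0 < cos (t - (1 - alpha) * (PI / 2))).
Proof.
intros Hr. unfold in_sector, polar, Re, Im; simpl. rewrite cos_plus, cos_minus. split; intros; nra.
Qed.

Lemma Cpower_in_sector alpha p : 0 < alpha <= 1 -> 0 < Re p -> in_sector alpha (Cpower p alpha).
Proof.
intros Ha Hp. rewrite Cpower_polar by (apply Re_pos_neq_0; auto).
apply in_sector_polar. apply exp_pos. pose proof (Carg_bound p Hp). set (t := Carg p) in *.
pose proof PI_RGT_0. split; apply cos_gt_0; nra.
Qed.

Lemma in_sector_Re_pos alpha w : 0 < alpha <= 1 -> in_sector alpha w -> 0 < Re w.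
Proof.
intros Ha [H1 H2]. pose proof PI_RGT_0.
assert (0 < cos ((1 - alpha) * (PI / 2))) by (apply cos_gt_0; nra). nra.
Qed.

(** The two half-plane conditions are [cos (t + b) > 0] and [cos (t - b) > 0] for
the argument [t]; as [|t| < pi/2] they force [|t| < alpha pi/2]. *)
Lemma sector_root_Re_pos alpha w : 0 < alpha <= 1 -> in_sector alpha w -> 0 < Re (Cpower w (/ alpha)).
Proof.
intros Ha Hw. assert (Hr := in_sector_Re_pos alpha w Ha Hw). assert (Hz := Re_pos_neq_0 w Hr).
assert (Hb := Carg_bound w Hr). pose proof PI_RGT_0 as Hpi.
rewrite Cpower_polar by auto. rewrite <- (polar_Carg w Hz) in Hw.
apply in_sector_polar in Hw; [|apply Cmod_gt_0; auto]. destruct Hw as [H1 H2].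
set (t := Carg w) in *. set (b := (1 - alpha) * (PI / 2)) in *.
assert (Hb0 : 0 <= b < PI / 2) by (unfold b; split; nra).
assert (T1 : t < alpha * (PI / 2)).
{ apply Rnot_le_lt. intros Hle.
  assert (C := cos_le_0 (t + b) ltac:(unfold b; lra) ltac:(lra)). lra. }
assert (T2 : - (alpha * (PI / 2)) < t).
{ apply Rnot_le_lt. intros Hle. rewrite <- cos_neg in H2.
  assert (C := cos_le_0 (- (t - b)) ltac:(unfold b; lra) ltac:(lra)). lra. }
unfold polar, Re; simpl. apply Rmult_lt_0_compat. apply exp_pos.
assert (Hi : 0 < / alpha) by (apply Rinv_0_lt_compat; lra).
assert (E : / alpha * (alpha * (PI / 2)) = PI / 2) by (field; lra).
apply cos_gt_0.
- apply Rmult_lt_compat_l with (r := / alpha) in T2; auto.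
  rewrite Ropp_mult_distr_r_reverse, E in T2. lra.
- apply Rmult_lt_compat_l with (r := / alpha) in T1; auto. lra.
Qed.

(** * The coefficient bound for functions with values in the sector *)

(** The inverse of [sector_map], from the sector onto the disk. *)
Definition sector_inv (alpha : R) (w : C) : C :=
  ((Cpower w (/ alpha) - 1) / (Cpower w (/ alpha) + 1))%C.

Lemma sector_inv_lt_1 alpha w : 0 < alpha <= 1 -> in_sector alpha w -> Cmod (sector_inv alpha w) < 1.
Proof. intros Ha Hw. apply cayley_inv_lt_1. apply sector_root_Re_pos; auto. Qed.

Lemma cderive_sector_inv alpha w : 0 < alpha <= 1 -> in_sector alpha w ->
  exists l, cderive (sector_inv alpha) w l.
Proof.
intros Ha Hw. eexists. apply cderive_div. apply cayley_inv_lt_1. apply sector_root_Re_pos; auto.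
apply cderive_minus. apply cderive_Cpower. eapply in_sector_Re_pos; eauto. apply cderive_const.
apply cderive_plus. apply cderive_Cpower. eapply in_sector_Re_pos; eauto. apply cderive_const.
Qed.

Lemma two_neq_0 : RtoC 2 <> RtoC 0.
Proof. intros E. apply RtoC_inj in E. lra. Qed.

Lemma cderive_sector_inv_1 alpha : 0 < alpha <= 1 -> cderive (sector_inv alpha) (RtoC 1) (RtoC (/ (2 * alpha))).
Proof.
intros Ha. assert (H1 : 0 < Re (RtoC 1)) by (unfold Re; simpl; lra).
assert (E2 : (RtoC 1 + RtoC 1)%C = RtoC 2) by (rewrite <- RtoC_plus; f_equal; ring).
assert (Han : RtoC alpha <> RtoC 0) by (intros E; apply RtoC_inj in E; lra).
eapply cderive_eq.
- apply cderive_div. rewrite Cpower_1, E2. apply two_neq_0.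
  apply cderive_minus. apply cderive_Cpower; auto. apply cderive_const.
  apply cderive_plus. apply cderive_Cpower; auto. apply cderive_const.
- simpl. rewrite !Cpower_1, E2. rewrite (RtoC_inv (2 * alpha)), RtoC_mult by lra.
  rewrite RtoC_inv by lra. field. repeat split; auto using two_neq_0.
Qed.

Lemma sector_inv_1 alpha : sector_inv alpha (RtoC 1) = RtoC 0.
Proof. unfold sector_inv. rewrite Cpower_1. unfold Cdiv. ring. Qed.

Lemma roots_of_unity_sum n m : (0 < m < n)%nat ->
  csum (fun k => polar 1 (2 * PI / INR n) ^ (k * m))%C (pred n) = RtoC 0.
Proof.
intros [Hm Hmn]. set (q := (polar 1 (2 * PI / INR n) ^ m)%C).
assert (Hn0 : 0 < INR n) by (apply lt_0_INR; lia).
assert (Hm0 : 0 < INR m) by (apply lt_0_INR; lia).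
assert (Hmn' : INR m < INR n) by (apply lt_INR; auto).
assert (Eq : q = polar 1 (INR m * (2 * PI / INR n))) by (unfold q; rewrite polar_pow, pow1; auto).
assert (Hq : (q - 1)%C <> RtoC 0).
{ intros E. apply Ceq_minus in E. rewrite Eq in E.
  apply (f_equal Re) in E. unfold polar, Re in E; simpl in E.
  set (h := INR m * PI / INR n).
  replace (INR m * (2 * PI / INR n)) with (2 * h) in E by (unfold h; field; lra).
  rewrite cos_2a_sin in E.
  assert (0 < sin h); [|nra]. pose proof PI_RGT_0. apply sin_gt_0; unfold h.
  apply Rdiv_lt_0_compat; nra. apply Rlt_div_l; nra. }
assert (Hqn : (q ^ n)%C = RtoC 1).
{ rewrite Eq, polar_pow, pow1. replace (INR n * (INR m * (2 * PI / INR n))) with (0 + 2 * INR m * PI) by (field; lra).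
  unfold polar. rewrite cos_period, sin_period, cos_0, sin_0. unfold RtoC. f_equal; ring. }
assert (G : forall j, ((q - 1) * csum (fun k => q ^ k) j = q ^ (S j) - 1)%C).
{ induction j. rewrite csum_0. simpl. ring. rewrite csum_S, Cmult_plus_distr_l, IHj. simpl. ring. }
rewrite (csum_ext _ (fun k => q ^ k)%C).
2: { intros k _. unfold q. rewrite <- Cpow_mult_r. f_equal. lia. }
specialize (G (pred n)). replace (S (pred n)) with n in G by lia. rewrite Hqn in G.
replace (RtoC 1 - 1)%C with (RtoC 0) in G by ring.
destruct (Ceq_dec (csum (fun k => q ^ k)%C (pred n)) (RtoC 0)) as [E|E]; auto.
exfalso. apply (Cmult_neq_0 _ _ Hq E G).
Qed.

(** Averaging over the [n]-th roots of unity kills the coefficients whose index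
is not a multiple of [n]. *)
Definition rotate_mean (F : C -> C) (n : nat) (z : C) : C :=
  (RtoC (/ INR n) * csum (fun k => F (polar 1 (2 * PI / INR n) ^ k * z)) (pred n))%C.

Lemma in_disk_rot t k z : in_disk z -> in_disk (polar 1 t ^ k * z)%C.
Proof.
unfold in_disk. intros Hz. rewrite Cmod_mult, polar_pow, pow1, Cmod_polar; lra.
Qed.

Lemma rotate_mean_coefs F c n : has_coefs F c ->
  has_coefs (rotate_mean F n)
   (fun m => RtoC (/ INR n) * (c m * csum (fun k => polar 1 (2 * PI / INR n) ^ (k * m)) (pred n)))%C.
Proof.
intros HF. unfold rotate_mean. apply (series_on_scal 1 (RtoC (/ INR n))).
set (w := polar 1 (2 * PI / INR n)).
assert (Hk : forall k, has_coefs (fun z => F (w ^ k * z)%C) (fun m => c m * w ^ (k * m))%C).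
{ intros k z Hz. assert (Hz' := in_disk_rot (2 * PI / INR n) k z Hz). fold w in Hz'.
  eapply cseries_ext; [|apply (HF _ Hz')]. intros m. simpl. rewrite Cpow_mult_l, Cpow_mult_r. ring. }
induction (pred n) as [|j IH].
- eapply series_on_ext; [| |apply (Hk 0%nat)].
  + intros z _. rewrite csum_0. auto.
  + intros m. simpl. rewrite csum_0. auto.
- eapply series_on_ext; [| |apply (series_on_plus 1 _ _ _ _ IH (Hk (S j)))].
  + intros z _. simpl. rewrite csum_S. auto.
  + intros m. cbv beta. rewrite csum_S. ring.
Qed.

Lemma rotate_mean_in_sector alpha F n z : (0 < n)%nat -> in_disk z ->
  (forall z, in_disk z -> in_sector alpha (F z)) -> in_sector alpha (rotate_mean F n z).
Proof.
intros Hn Hz HF. unfold rotate_mean. apply in_sector_scal.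
apply Rinv_0_lt_compat, lt_0_INR; auto.
induction (pred n) as [|j IH]. rewrite csum_0. apply HF, in_disk_rot; auto.
rewrite csum_S. apply in_sector_plus; auto. apply HF, in_disk_rot; auto.
Qed.

Lemma csum_const_1 n : csum (fun _ => RtoC 1) n = RtoC (INR (S n)).
Proof. induction n. rewrite csum_0. auto. rewrite csum_S, IHn, (S_INR (S n)), RtoC_plus. auto. Qed.

Lemma cpoly_gap a n z : (1 <= n)%nat -> (forall k, (0 < k < n)%nat -> a k = RtoC 0) ->
  cpoly a n z = (a 0%nat + a n * z ^ n)%C.
Proof.
intros Hn Hk. unfold cpoly. destruct n; [lia|]. rewrite csum_S. f_equal.
destruct n. rewrite csum_0. simpl; ring.
rewrite csum_shift, csum_zero. simpl; ring. intros k Hk'. rewrite Hk by lia. ring.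
Qed.

(** Let [H = 1 + c_n z^n + ...] be the mean of [F] over the [n]-th roots of unity.
It has values in the sector by convexity, so [sector_inv o H] is bounded by 1;
as [sector_inv] has derivative [1/(2 alpha)] at 1, the [n]-th coefficient of the
composition is [c_n/(2 alpha)]. *)
Lemma sector_coef_bound alpha F c n : 0 < alpha <= 1 -> (1 <= n)%nat -> has_coefs F c ->
  F (RtoC 0) = RtoC 1 -> (forall z, in_disk z -> in_sector alpha (F z)) -> Cmod (c n) <= 2 * alpha.
Proof.
intros Ha Hn HF F0 Hsec.
assert (Hn0 : 0 < INR n) by (apply lt_0_INR; lia).
assert (HH := rotate_mean_coefs F c n HF).
set (H := rotate_mean F n) in *. set (h := fun m => _) in HH.
assert (Hc0 : c 0%nat = RtoC 1) by (rewrite <- (series_on_0 1 F c); auto; lra).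
assert (Hnn : (RtoC (/ INR n) * RtoC (INR n))%C = RtoC 1).
{ rewrite <- RtoC_mult, Rinv_l; auto. lra. }
assert (h0 : h 0%nat = RtoC 1).
{ unfold h. rewrite Hc0. rewrite (csum_ext _ (fun _ => RtoC 1)).
  2: { intros k _. rewrite Nat.mul_0_r. auto. }
  rewrite csum_const_1. replace (S (pred n)) with n by lia. rewrite Cmult_1_l. auto. }
assert (hm : forall m, (0 < m < n)%nat -> h m = RtoC 0).
{ intros m Hm. unfold h. rewrite roots_of_unity_sum by auto. ring. }
assert (hn : h n = c n).
{ unfold h. rewrite (csum_ext _ (fun _ => RtoC 1)).
  2: { intros k _. rewrite polar_pow, pow1. rewrite mult_INR.
    replace (INR k * INR n * (2 * PI / INR n)) with (0 + 2 * INR k * PI) by (field; lra).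
    unfold polar. rewrite cos_period, sin_period, cos_0, sin_0. unfold RtoC. f_equal; ring. }
  rewrite csum_const_1. replace (S (pred n)) with n by lia.
  transitivity (RtoC (/ INR n) * RtoC (INR n) * c n)%C; [ring|]. rewrite Hnn. ring. }
assert (Hpoly : forall z, cpoly h n z = (1 + c n * z ^ n)%C).
{ intros z. rewrite cpoly_gap, h0, hn by auto. auto. }
assert (SO := taylor_small_o 1 H h n Rlt_0_1 HH).
set (T := sector_inv alpha). set (Phi := fun z => T (H z)).
assert (HHs : forall z, in_disk z -> in_sector alpha (H z)).
{ intros z Hz. apply rotate_mean_in_sector; auto. }
assert (HPa : analytic_on_disk Phi).
{ intros z Hz. destruct (cderive_sector_inv alpha (H z) Ha (HHs z Hz)) as [l Hl].
  destruct (analytic_cderive H z (has_coefs_analytic _ _ HH) Hz) as [l' Hl'].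
  eexists. apply (cderive_comp T H z l l' Hl Hl'). }
assert (HPt := analytic_coefs Phi (/ 2) HPa ltac:(lra)). set (t := coef Phi (/ 2)) in *.
assert (HPb : forall k, Cmod (t k) <= 1).
{ intros k. apply (schur_coef_bound Phi); auto. intros z Hz. left. apply sector_inv_lt_1; auto. }
set (s := RtoC (/ (2 * alpha))).
assert (Et : t n = (s * c n)%C).
{ (* The Taylor polynomial of degree [n] of the composition is [s c_n z^n]. *)
  set (mono := fun k => if Nat.eq_dec k n then (s * c n)%C else RtoC 0).
  assert (Em : forall z, cpoly mono n z = (s * c n * z ^ n)%C).
  { intros z. rewrite cpoly_gap; auto.
    - unfold mono. destruct (Nat.eq_dec 0 n); [lia|]. destruct (Nat.eq_dec n n); [|lia]. ring.
    - intros k Hk. unfold mono. destruct (Nat.eq_dec k n); [lia|auto]. }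
  transitivity (trunc mono n n).
  2: { rewrite trunc_le by auto. unfold mono. destruct (Nat.eq_dec n n); [auto|lia]. }
  apply (coefs_small_o_eq 1 Phi (cpoly mono n) _ _ n); auto; [lra|apply series_on_cpoly|].
  apply small_o_ext with (f := fun z => ((Phi z - s * (H z - 1)) + s * (H z - cpoly h n z))%C).
  { intros z _. rewrite Em, Hpoly. ring. }
  apply small_o_plus; [|apply small_o_scal; auto].
  destruct (vanish_bigO 1 (fun z => H z - 1)%C _ n Rlt_0_1
     (series_on_minus 1 _ _ _ _ HH (series_on_const 1 (RtoC 1)))) as [M HM].
  { intros k Hk. destruct k. rewrite h0. simpl; ring. rewrite hm by lia. simpl; ring. }
  intros eps Heps. pose proof (Rabs_pos M) as HMp.
  assert (HT := cderive_sector_inv_1 alpha Ha). fold T in HT. fold s in HT.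
  destruct (proj1 (cderive_eps _ _ _) HT (eps / (Rabs M + 1))) as [d [Hd HTd]].
  { apply Rdiv_lt_0_compat; lra. }
  unfold T in HTd. rewrite sector_inv_1 in HTd. fold T in HTd.
  exists (Rmin (/ 4) (d / (Rabs M + 1))). split.
  { apply Rmin_glb_lt; [lra|]. apply Rdiv_lt_0_compat; lra. }
  intros z Hz. assert (Hz1 := Rlt_le_trans _ _ _ Hz (Rmin_l _ _)).
  assert (Hz2 := Rlt_le_trans _ _ _ Hz (Rmin_r _ _)). apply Rlt_div_r in Hz2; [|lra].
  specialize (HM z ltac:(lra)). cbv beta in HM.
  pose proof (Cmod_ge_0 z) as Hz0.
  assert (Hzn : 0 <= Cmod z ^ n) by (apply pow_le; auto).
  assert (HM2 : Cmod (H z - 1)%C <= (Rabs M + 1) * Cmod z ^ n).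
  { eapply Rle_trans. exact HM. apply Rmult_le_compat_r; auto. pose proof (Rle_abs M). lra. }
  assert (Hzn1 : Cmod z ^ n <= Cmod z).
  { destruct n; [lia|]. simpl.
    assert (Cmod z ^ n <= 1) by (rewrite <- (pow1 n); apply pow_incr; lra).
    nra. }
  assert (Hd' : Cmod (H z - 1)%C < d) by nra.
  specialize (HTd (H z) Hd'). unfold Phi.
  replace (T (H z) - s * (H z - 1))%C with (T (H z) - 0 - s * (H z - 1))%C by ring.
  eapply Rle_trans. exact HTd.
  replace (eps * Cmod z ^ n) with (eps / (Rabs M + 1) * ((Rabs M + 1) * Cmod z ^ n)) by (field; lra).
  apply Rmult_le_compat_l; auto. left. apply Rdiv_lt_0_compat; lra. }
specialize (HPb n). rewrite Et, Cmod_mult in HPb. unfold s in HPb.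
assert (Hi : 0 < / (2 * alpha)) by (apply Rinv_0_lt_compat; lra).
rewrite Cmod_R, Rabs_pos_eq in HPb by lra.
apply Rmult_le_reg_l with (/ (2 * alpha)); auto. rewrite Rinv_l by lra. exact HPb.
Qed.

(** * The coefficients of the sector map *)

Lemma gbinom_S alpha k : gbinom alpha (S k) = gbinom alpha k * (alpha - INR k) / INR (S k).
Proof.
unfold gbinom. simpl falling. rewrite fact_simpl, mult_INR. field.
split. apply INR_fact_neq_0. apply not_0_INR; lia.
Qed.

Lemma gbinom_0 alpha : gbinom alpha 0 = 1.
Proof. unfold gbinom. simpl. field. Qed.

Lemma one_plus_Re_pos z : in_disk z -> 0 < Re (1 + z)%C.
Proof.
intros Hz. unfold in_disk in Hz. pose proof (Re_le_Cmod z) as H.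
assert (H' := Rle_lt_trans _ _ _ H Hz). apply Rabs_def2 in H'.
unfold Re in *. destruct z; simpl in *. lra.
Qed.

Lemma cderive_one_plus_power alpha z : in_disk z ->
  cderive (fun w => Cpower (1 + w)%C alpha) z (RtoC alpha * Cpower (1 + z)%C alpha / (1 + z))%C.
Proof.
intros Hz. eapply cderive_eq.
- apply (cderive_comp (fun w => Cpower w alpha) (fun w => 1 + w)%C).
  apply cderive_Cpower, one_plus_Re_pos; auto.
  apply cderive_plus. apply cderive_const. apply cderive_id.
- simpl. ring.
Qed.

(** The function satisfies [(1 + z) E' = alpha E], a recurrence of order one for
the coefficients, which is that of the binomial coefficients. *)
Lemma binomial_series alpha : has_coefs (fun z => Cpower (1 + z)%C alpha) (fun k => RtoC (gbinom alpha k)).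
Proof.
set (E := fun z => Cpower (1 + z)%C alpha).
set (E' := fun z => (RtoC alpha * E z / (1 + z))%C).
assert (HE : forall z, in_disk z -> cderive E z (E' z)) by (intros; apply cderive_one_plus_power; auto).
assert (Ha : analytic_on_disk E) by (intros z Hz; eexists; apply HE; auto).
assert (He := analytic_coefs E (/ 2) Ha ltac:(lra)). set (e := coef E (/ 2)) in *.
assert (Hd := derivative_coefs E E' e He HE).
assert (Heq : forall n, (dcoef e n + match n with O => 0 | S n => dcoef e n end = RtoC alpha * e n)%C).
{ apply (coefs_unique 1 (fun z => E' z + z * E' z)%C); [lra| |].
  - apply series_on_plus; auto. apply series_on_shift; auto.
  - eapply series_on_ext; [|intros; reflexivity|apply (series_on_scal 1 (RtoC alpha) _ _ He)].
    intros z Hz. simpl. unfold E'. field. apply Re_pos_neq_0, one_plus_Re_pos; auto. }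
assert (G : forall n, e n = RtoC (gbinom alpha n)).
{ induction n.
  - rewrite <- (series_on_0 1 E e); auto; [|lra]. rewrite gbinom_0. unfold E. rewrite Cplus_0_r. apply Cpower_1.
  - assert (Hn : RtoC (INR (S n)) <> RtoC 0). { intros H. apply RtoC_inj in H. apply (not_0_INR (S n)); auto; lia. }
    assert (E1 : (RtoC (INR (S n)) * e (S n) = (RtoC alpha - RtoC (INR n)) * e n)%C).
    { specialize (Heq n). unfold dcoef in Heq. destruct n.
      - simpl INR at 2. rewrite Cplus_0_r in Heq. rewrite Heq. ring.
      - replace ((RtoC alpha - RtoC (INR (S n))) * e (S n))%C with (RtoC alpha * e (S n) - RtoC (INR (S n)) * e (S n))%C by ring.
        rewrite <- Heq. ring. }
    replace (e (S n)) with (RtoC (INR (S n)) * e (S n) / RtoC (INR (S n)))%C by (field; auto).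
    rewrite E1, IHn, gbinom_S. unfold Rdiv. rewrite !RtoC_mult, RtoC_minus, RtoC_inv.
    field; auto. apply not_0_INR; lia. }
eapply series_on_ext; [| |exact He]; auto.
Qed.

(** The coefficient of [z^n] in [(z/(1-z))^k].  The test keeps [Binomial.C] away
from indices above its range, where its value is not 0. *)
Definition half_plane_coef (k n : nat) : R :=
  match k, n with
  | O, O => 1
  | O, S _ => 0
  | S _, O => 0
  | S j, S m => if le_lt_dec j m then Binomial.C m j else 0
  end.

Lemma binomial_n_n n : Binomial.C n n = 1.
Proof.
unfold Binomial.C. rewrite Nat.sub_diag. simpl. field. apply INR_fact_neq_0.
Qed.

Lemma binomial_n_0 n : Binomial.C n 0 = 1.
Proof.
unfold Binomial.C. rewrite Nat.sub_0_r. simpl. field. apply INR_fact_neq_0.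
Qed.

(** Pascal's rule; the cases in the definition are such that it also holds at the
boundary. *)
Lemma half_plane_coef_rec k n : half_plane_coef (S k) (S n) - half_plane_coef (S k) n = half_plane_coef k n.
Proof.
destruct n as [|m]; destruct k as [|j]; unfold half_plane_coef.
- destruct (le_lt_dec 0 0); [|lia]. rewrite binomial_n_0. ring.
- destruct (le_lt_dec (S j) 0); [lia|]. ring.
- destruct (le_lt_dec 0 (S m)); [|lia]. destruct (le_lt_dec 0 m); [|lia]. rewrite !binomial_n_0. ring.
- destruct (le_lt_dec (S j) (S m)); destruct (le_lt_dec (S j) m); destruct (le_lt_dec j m); try lia.
  + rewrite <- (pascal m j) by lia. ring.
  + replace m with j by lia. rewrite !binomial_n_n. ring.
  + ring.
Qed.

(** This function maps the disk onto a half-plane; twice it is the [u] with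
[(1+z)/(1-z) = 1 + u]. *)
Definition half_plane_map (z : C) : C := (z / (1 - z))%C.

Lemma half_plane_map_analytic : analytic_on_disk half_plane_map.
Proof.
intros z Hz. eexists. apply cderive_div. apply one_minus_neq_0; auto. apply cderive_id.
apply cderive_minus. apply cderive_const. apply cderive_id.
Qed.

(** From [(1 - z) v^(k+1) = z v^k] for [v = z/(1-z)]. *)
Lemma half_plane_map_pow_coefs k : has_coefs (fun z => half_plane_map z ^ k)%C (fun n => RtoC (half_plane_coef k n)).
Proof.
induction k.
- eapply series_on_ext; [| |apply (series_on_const 1 (RtoC 1))]; auto.
  intros [|n]; auto.
- assert (Ha : analytic_on_disk (fun z => half_plane_map z ^ S k)%C).
  { apply (analytic_mult half_plane_map (fun z => half_plane_map z ^ k)%C). apply half_plane_map_analytic.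
    apply (has_coefs_analytic _ _ IHk). }
  assert (Hb := analytic_coefs _ (/ 2) Ha ltac:(lra)).
  set (b := coef (fun z => half_plane_map z ^ S k)%C (/ 2)) in *.
  assert (Hr : forall n, (b n - match n with O => 0 | S n => b n end)%C =
     match n with O => RtoC 0 | S n => RtoC (half_plane_coef k n) end).
  { apply (coefs_unique 1 (fun z => half_plane_map z ^ S k - z * half_plane_map z ^ S k)%C); [lra| |].
    - apply series_on_minus; auto. apply series_on_shift; auto.
    - eapply series_on_ext; [|intros; reflexivity|apply (series_on_shift 1 _ _ IHk)].
      intros z Hz. cbv beta. rewrite Cpow_S. set (q := (half_plane_map z ^ k)%C). unfold half_plane_map. field.
      apply one_minus_neq_0; auto. }
  eapply series_on_ext; [| |exact Hb]; auto.
  intros n. induction n.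
  + specialize (Hr 0%nat). simpl in Hr |- *. rewrite <- Hr. ring.
  + specialize (Hr (S n)). cbv iota in Hr.
    replace (half_plane_coef (S k) (S n)) with (half_plane_coef k n + half_plane_coef (S k) n)
      by (rewrite <- (half_plane_coef_rec k n); ring).
    rewrite RtoC_plus, <- Hr, IHn. ring.
Qed.

Lemma cpoly_half_plane_map_coefs e N :
  has_coefs (fun z => cpoly e N (RtoC 2 * half_plane_map z)%C)
    (fun n => csum (fun k => e k * RtoC (2 ^ k * half_plane_coef k n)) N)%C.
Proof.
assert (Hk : forall k, has_coefs (fun z => e k * (RtoC 2 * half_plane_map z) ^ k)%C
   (fun n => e k * RtoC (2 ^ k * half_plane_coef k n))%C).
{ intros k. eapply series_on_ext; [| |apply (series_on_scal 1 (e k * RtoC (2 ^ k))%C _ _ (half_plane_map_pow_coefs k))].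
  - intros z _. cbv beta. rewrite Cpow_mult_l, RtoC_pow. ring.
  - intros n. cbv beta. rewrite RtoC_mult. ring. }
induction N.
- eapply series_on_ext; [| |apply (Hk 0%nat)]. intros z _; unfold cpoly; rewrite csum_0; auto.
  intros n; rewrite csum_0; auto.
- eapply series_on_ext; [| |apply (series_on_plus 1 _ _ _ _ IHN (Hk (S N)))].
  intros z _. cbv beta. rewrite cpoly_S. auto. intros n; cbv beta; rewrite csum_S; auto.
Qed.

Lemma csum_RtoC u n : csum (fun k => RtoC (u k)) n = RtoC (rsum u n).
Proof. induction n. rewrite csum_0, rsum_0; auto. rewrite csum_S, rsum_S, IHn, RtoC_plus; auto. Qed.

Lemma A_coeff_S alpha m : A_coeff alpha (S m) =
  rsum (fun k => gbinom alpha (S k) * (2 ^ S k * half_plane_coef (S k) (S m))) m.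
Proof.
unfold A_coeff. rewrite <- sum_n_m_S. apply sum_n_m_ext_loc. intros k Hk.
replace (S m - 1)%nat with m by lia. replace (S k - 1)%nat with k by lia.
unfold half_plane_coef. destruct (le_lt_dec k m); [|lia]. 
change (Binomial.C m k * gbinom alpha (S k) * 2 ^ S k = gbinom alpha (S k) * (2 ^ S k * Binomial.C m k)).
ring.
Qed.

(** Substitute [u = 2z/(1-z)] in the binomial series.  The series represents
[(1+u)^alpha] only for [|u| < 1], but the coefficients only depend on a
neighbourhood of 0. *)
Lemma sector_map_coefs alpha B : has_coefs (sector_map alpha) B ->
  forall m, B (S m) = RtoC (A_coeff alpha (S m)).
Proof.
intros HB m.
set (e := fun k => RtoC (gbinom alpha k)).
assert (H2 : analytic_on_disk (fun z => RtoC 2 * half_plane_map z)%C).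
{ apply (analytic_mult (fun _ => RtoC 2) half_plane_map); [|apply half_plane_map_analytic].
  intros z _. eexists. apply cderive_const. }
assert (S0 := coefs_comp_small (fun z => RtoC 2 * half_plane_map z)%C (fun z => Cpower (1 + z)%C alpha) e (S m) H2
  ltac:(unfold half_plane_map; simpl; unfold Cdiv; ring) 1 Rlt_0_1 (binomial_series alpha)).
rewrite (coefs_small_o_eq 1 (sector_map alpha) _ B _ (S m) Rlt_0_1 HB (cpoly_half_plane_map_coefs e (S m))); auto.
- rewrite A_coeff_S, csum_shift, <- csum_RtoC. simpl half_plane_coef at 1. rewrite Rmult_0_r, Cmult_0_r, Cplus_0_l.
  apply csum_ext. intros k Hk. unfold e. rewrite <- RtoC_mult. auto.
- eapply small_o_ext; [|exact S0]. intros z Hz. cbv beta. f_equal. unfold sector_map. f_equal.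
  unfold half_plane_map. field. apply one_minus_neq_0; auto.
Qed.

Lemma sector_map_coef_1 alpha B : has_coefs (sector_map alpha) B -> B 1%nat = RtoC (2 * alpha).
Proof.
intros HB.
assert (H := derivative_coefs _ _ _ HB (cderive_sector_map alpha)).
apply series_on_0 in H; [|lra]. unfold dcoef in H. simpl in H. rewrite Cmult_1_l in H.
rewrite <- H, sector_map_0.
replace (1 + 0)%C with (RtoC 1) by ring. replace (1 - 0)%C with (RtoC 1) by ring.
field.
Qed.

(** * Logarithmic coefficients *)

Lemma in_disk_0 : in_disk (RtoC 0).
Proof. unfold in_disk. rewrite Cmod_0. lra. Qed.

Lemma C_derive_eq f z : analytic_on_disk f -> in_disk z -> cderive f z (C_derive f z).
Proof.
intros Hf Hz. destruct (analytic_cderive f z Hf Hz) as [l Hl].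
assert (E := is_C_derive_unique _ _ _ Hl). rewrite E. exact Hl.
Qed.

(** Logarithmic derivative of [Cexp L = f/z].  At [z = 0], where the division is
not available, both sides vanish. *)
Lemma log_branch_derivative f F L z l : class_A f -> is_starlike_quotient f F -> is_log_branch f L ->
  in_disk z -> cderive L z l -> (z * l)%C = (F z - 1)%C.
Proof.
intros (Hf & f0 & fd0) (HF & F0 & HQ) (HL & L0 & HE) Hz Hl.
destruct (Ceq_dec z (RtoC 0)) as [->|Hn].
- rewrite F0. ring.
- destruct (HQ z Hz Hn) as [Hfz HFz].
  assert (Hm := proj1 (Cmod_gt_0 z) Hn). unfold in_disk in Hz.
  assert (D1 : cderive (fun w => Cexp (L w)) z (l * Cexp (L z))%C).
  { apply (cderive_comp Cexp L). apply cderive_Cexp. exact Hl. }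
  assert (D2 : cderive (fun w => Cexp (L w)) z ((C_derive f z * z - f z * 1) / (z * z))%C).
  { apply (cderive_ext_loc (fun w => f w / w)%C _ z _ (Rmin (Cmod z) (1 - Cmod z))).
    - apply Rmin_glb_lt; lra.
    - intros w Hw. symmetry.
      assert (Hw1 := Rlt_le_trans _ _ _ Hw (Rmin_l _ _)).
      assert (Hw2 := Rlt_le_trans _ _ _ Hw (Rmin_r _ _)).
      apply HE.
      + unfold in_disk. replace w with (z + (w - z))%C by ring.
        eapply Rle_lt_trans. apply Cmod_triangle. lra.
      + intros ->. replace (0 - z)%C with (- z)%C in Hw1 by ring. rewrite Cmod_opp in Hw1. lra.
    - apply (cderive_div f (fun w => w)); auto. apply C_derive_eq; auto. apply cderive_id. }
  assert (E := cderive_unique _ _ _ _ D1 D2). rewrite HE in E by auto.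
  rewrite HFz. replace l with (l * (f z / z) * (z / f z))%C by (field; auto).
  rewrite E. field. auto.
Qed.

Lemma log_branch_coefs (gamma : nat -> C) (L : C -> C) :
  (forall z, in_disk z -> exists s, cseries (fun k => gamma (k + 1)%nat * z ^ (k + 1))%C s /\ L z = (RtoC 2 * s)%C) ->
  has_coefs L (fun n => match n with O => RtoC 0 | S _ => RtoC 2 * gamma n end)%C.
Proof.
intros H z Hz. destruct (H z Hz) as [s [Hs ->]].
replace (RtoC 2 * s)%C with (RtoC 2 * s + 0 * z ^ 0)%C by (simpl; ring).
apply (cseries_decr (fun n => match n with O => RtoC 0 | S _ => RtoC 2 * gamma n end * z ^ n)%C).
eapply cseries_ext; [|apply cseries_scal; exact Hs].
intros n. cbv beta. rewrite Nat.add_1_r. ring.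
Qed.

Lemma log_coeffs_starlike_quotient f F gamma c : class_A f -> is_starlike_quotient f F -> is_log_coeffs f gamma ->
  has_coefs F c -> forall n, (RtoC (INR (S n)) * (RtoC 2 * gamma (S n)))%C = c (S n).
Proof.
intros Hf HQ [L [HL Hs]] Hc n.
assert (HLc := log_branch_coefs gamma L Hs). set (l := fun n => _) in HLc.
destruct (has_coefs_derivative L l HLc) as [Hd Hd'].
assert (H1 : has_coefs (fun z => F z - 1)%C (fun n => match n with O => RtoC 0 | S n => dcoef l n end)).
{ eapply series_on_ext; [|intros; reflexivity|apply (series_on_shift 1 _ _ Hd)].
  intros z Hz. apply (log_branch_derivative f F L z); auto. }
assert (H2 := series_on_minus 1 _ _ _ _ Hc (series_on_const 1 (RtoC 1))).
assert (E := coefs_unique 1 _ _ _ Rlt_0_1 H1 H2 (S n)). simpl in E.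
unfold dcoef, l in E. rewrite E. ring.
Qed.

Lemma Cmod_log_coeff f F gamma c : class_A f -> is_starlike_quotient f F -> is_log_coeffs f gamma ->
  has_coefs F c -> forall n, Cmod (gamma (S n)) = Cmod (c (S n)) / (2 * INR (S n)).
Proof.
intros Hf HQ Hg Hc n. rewrite <- (log_coeffs_starlike_quotient f F gamma c Hf HQ Hg Hc n).
rewrite !Cmod_mult, !Cmod_R, (Rabs_pos_eq (INR _)), (Rabs_pos_eq 2) by (try apply pos_INR; lra).
field. apply not_0_INR; lia.
Qed.

(** Divide the [n]-th coefficient of [F] by [n]. *)
Lemma log_primitive F : analytic_on_disk F -> F (RtoC 0) = RtoC 1 ->
  exists L l L', has_coefs L l /\ l 0%nat = RtoC 0 /\
    forall z, in_disk z -> cderive L z (L' z) /\ (z * L' z)%C = (F z - 1)%C.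
Proof.
intros HF F0. assert (Hc := analytic_coefs F (/ 2) HF ltac:(lra)). set (c := coef F (/ 2)) in *.
set (l := fun n => match n with O => RtoC 0 | S _ => c n / RtoC (INR n) end%C).
assert (Hb : bounded_coefs l).
{ intros rho Hr. destruct (has_coefs_bounded F c Hc rho Hr) as [M HM]. exists M. intros n.
  eapply Rle_trans; [|apply (HM n)]. apply Rmult_le_compat_r. apply pow_le; lra.
  destruct n. simpl. rewrite Cmod_0. apply Cmod_ge_0. unfold l.
  assert (1 <= INR (S n)) by (rewrite S_INR; pose proof (pos_INR n); lra).
  rewrite Cmod_div. rewrite Cmod_R, Rabs_pos_eq by apply pos_INR. apply Rle_div_l; [lra|].
  pose proof (Cmod_ge_0 (c (S n))). nra.
  intros E. apply RtoC_inj in E. lra. }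
assert (HL := series_fun_correct l Hb). destruct (has_coefs_derivative _ _ HL) as [Hd Hd'].
exists (series_fun l), l, (series_fun (dcoef l)). split; auto. split; auto.
intros z Hz. split; auto.
assert (H1 := series_on_shift 1 _ _ Hd). specialize (H1 z Hz).
assert (H2 := series_on_minus 1 _ _ _ _ Hc (series_on_const 1 (RtoC 1)) z Hz).
eapply cseries_unique. exact H1. eapply cseries_ext; [|exact H2].
intros n. cbv beta. f_equal. destruct n.
- rewrite <- (series_on_0 1 F c) by (auto; lra). rewrite F0. simpl. ring.
- unfold dcoef, l, const_coefs. field. intros E. apply RtoC_inj in E. apply (not_0_INR (S n)); auto; lia.
Qed.

(** Let [L] solve [z L' = F - 1].  The product [p = f exp(-L)] satisfies
[z p' = p], hence [n p_n = p_n] for its coefficients: [p] is a multiple of [z],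
and the normalization of [f] gives [p = z]. *)
Lemma log_coeffs_exist f F : class_A f -> is_starlike_quotient f F -> exists gamma, is_log_coeffs f gamma.
Proof.
intros (Hf & f0 & fd0) (HF & F0 & HQ).
destruct (log_primitive F HF F0) as (L & l & L' & HL & l0 & HL').
assert (HLa := has_coefs_analytic L l HL).
assert (L0 : L (RtoC 0) = RtoC 0) by (rewrite (series_on_0 1 L l); auto; lra).
set (p := fun z => (f z * Cexp (- L z))%C).
set (p' := fun z => (C_derive f z * Cexp (- L z) + f z * ((0 - L' z) * Cexp (- L z)))%C).
assert (Dp : forall z, in_disk z -> cderive p z (p' z)).
{ intros z Hz. apply (cderive_mult f (fun z => Cexp (- L z))%C). apply C_derive_eq; auto.
  apply (cderive_comp Cexp (fun z => - L z)%C). apply cderive_Cexp.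
  apply (cderive_ext_loc (fun w => 0 - L w)%C _ z _ 1); [lra| |].
  intros; ring. apply cderive_minus. apply cderive_const. apply HL'; auto. }
assert (Hpa : analytic_on_disk p) by (intros z Hz; eexists; apply Dp; auto).
assert (Hpc := analytic_coefs p (/ 2) Hpa ltac:(lra)). set (q := coef p (/ 2)) in *.
assert (Hdc := derivative_coefs p p' q Hpc Dp).
assert (Hq : forall n, match n with O => RtoC 0 | S n => dcoef q n end = q n).
{ apply (coefs_unique 1 p); auto; [lra|].
  eapply series_on_ext; [|intros; reflexivity|apply (series_on_shift 1 _ _ Hdc)].
  intros z Hz. cbv beta. unfold p', p. destruct (HL' z Hz) as [_ E].
  transitivity ((z * C_derive f z - f z * (z * L' z)) * Cexp (- L z))%C; [ring|]. rewrite E.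
  destruct (Ceq_dec z (RtoC 0)) as [->|Hn]. rewrite f0. ring.
  destruct (HQ z Hz Hn) as [Hfz ->]. field. auto. }
assert (q1 : q 1%nat = RtoC 1).
{ specialize (Hq 1%nat). simpl in Hq. rewrite <- Hq.
  rewrite <- (series_on_0 1 p' (dcoef q) Rlt_0_1 Hdc). unfold p'.
  rewrite fd0, f0, L0. replace (- 0)%C with (RtoC 0) by ring. rewrite Cexp_0. ring. }
assert (qn : forall n, n <> 1%nat -> q n = RtoC 0).
{ intros n Hn. specialize (Hq n). destruct n as [|n]; auto. unfold dcoef in Hq.
  assert (E : (RtoC (INR n) * q (S n))%C = RtoC 0).
  { rewrite S_INR, RtoC_plus in Hq.
    replace (RtoC (INR n) * q (S n))%C with ((RtoC (INR n) + 1) * q (S n) - q (S n))%C by ring.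
    rewrite Hq. ring. }
  destruct (Ceq_dec (q (S n)) (RtoC 0)) as [|Hne]; auto. exfalso.
  apply (Cmult_neq_0 (RtoC (INR n)) (q (S n))); auto.
  intros E'. apply RtoC_inj in E'. apply (not_0_INR n); auto. }
assert (Hp : forall z, in_disk z -> p z = z).
{ intros z Hz. apply (cseries_unique (fun n => q n * z ^ n)%C). apply (Hpc z Hz).
  assert (Hfin := cseries_finite (fun n => q n * z ^ n)%C 1).
  rewrite csum_S, csum_0, q1, (qn 0%nat) in Hfin by lia.
  replace (0 * z ^ 0 + 1 * z ^ 1)%C with z in Hfin by (simpl; ring).
  apply Hfin. intros k Hk. rewrite qn by lia. ring. }
exists (fun n => l n / RtoC 2)%C, L. split.
- split; auto. split; auto. intros z Hz Hn. assert (E := Hp z Hz). unfold p in E.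
  rewrite Cexp_opp in E. transitivity (f z / (f z * / Cexp (L z)))%C.
  + field. split. apply Cexp_neq_0. apply (HQ z Hz Hn).
  + rewrite E. auto.
- intros z Hz. exists (L z / RtoC 2)%C. split.
  2: field.
  change (cseries (fun k => l (k + 1)%nat / RtoC 2 * z ^ (k + 1))%C (L z / RtoC 2)%C).
  assert (H := cseries_scal (/ RtoC 2)%C _ _ (HL z Hz)).
  apply (cseries_ext (fun k => (fun n => / RtoC 2 * (l n * z ^ n))%C (S k))).
  { intros n. cbv beta. rewrite Nat.add_1_r. unfold Cdiv. ring. }
  apply (@is_series_incr_1 C_AbsRing C_NormedModule (fun n => / RtoC 2 * (l n * z ^ n))%C).
  change (cseries (fun n => / RtoC 2 * (l n * z ^ n))%C (L z / RtoC 2 + / RtoC 2 * (l 0%nat * z ^ 0))%C).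
  rewrite l0. replace (L z / RtoC 2 + / RtoC 2 * (0 * z ^ 0))%C with (/ RtoC 2 * L z)%C by (unfold Cdiv; ring).
  exact H.
Qed.

(** The solution is [f = z exp(L)] with [z L' = F - 1]. *)
Lemma starlike_quotient_realized F : analytic_on_disk F -> F (RtoC 0) = RtoC 1 ->
  exists f, class_A f /\ is_starlike_quotient f F.
Proof.
intros HF F0. destruct (log_primitive F HF F0) as (L & l & L' & HL & l0 & HL').
assert (L0 : L (RtoC 0) = RtoC 0) by (rewrite (series_on_0 1 L l); auto; lra).
set (f := fun z => (z * Cexp (L z))%C).
assert (D : forall z, in_disk z -> cderive f z (1 * Cexp (L z) + z * (L' z * Cexp (L z)))%C).
{ intros z Hz. apply (cderive_mult (fun w => w) (fun w => Cexp (L w))). apply cderive_id. apply (cderive_comp Cexp L).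
  apply cderive_Cexp. apply HL'; auto. }
assert (Dv : forall z, in_disk z -> C_derive f z = (1 * Cexp (L z) + z * (L' z * Cexp (L z)))%C).
{ intros z Hz. apply is_C_derive_unique. apply D; auto. }
exists f. split.
- split; [|split].
  + intros z Hz. eexists. apply D; auto.
  + unfold f. ring.
  + rewrite Dv by apply in_disk_0. rewrite L0, Cexp_0. ring.
- split; [|split]; auto. intros z Hz Hn. split.
  + unfold f. apply Cmult_neq_0; auto. apply Cexp_neq_0.
  + rewrite Dv by auto. unfold f. destruct (HL' z Hz) as [_ E].
    replace (F z) with (F z - 1 + 1)%C by ring. rewrite <- E. field. split; auto. apply Cexp_neq_0.
Qed.

(** * The two inequalities *)

(** Telescoping comparison with [1/(k (k+1))]. *)
Lemma ex_series_inv_sqr : ex_series (fun k => / INR (k + 1) ^ 2).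
Proof.
destruct (ex_finite_lim_seq_incr (rsum (fun k => / INR (k + 1) ^ 2)) 2) as [l Hl].
- intros n. rewrite rsum_S. assert (0 < INR (S n + 1)) by (apply lt_0_INR; lia).
  assert (0 < / INR (S n + 1) ^ 2) by (apply Rinv_0_lt_compat, pow_lt; auto). lra.
- intros n. assert (H : rsum (fun k => / INR (k + 1) ^ 2) n <= 2 - / INR (n + 1)).
  { induction n. rewrite rsum_0. simpl. lra.
    rewrite rsum_S. assert (H1 : 0 < INR (n + 1)) by (apply lt_0_INR; lia).
    replace (S n + 1)%nat with (S (n + 1)) by lia. rewrite S_INR. set (x := INR (n + 1)) in *.
    assert (/ (x + 1) ^ 2 <= / x - / (x + 1)); [|lra].
    replace (/ x - / (x + 1)) with (/ (x * (x + 1))) by (field; lra).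
    apply Rinv_le_contravar; nra. }
  assert (H1 : 0 < INR (n + 1)) by (apply lt_0_INR; lia).
  assert (0 < / INR (n + 1)) by (apply Rinv_0_lt_compat; auto). lra.
- exists l. exact Hl.
Qed.

Lemma ex_series_comparison u v : (forall n, 0 <= u n <= v n) -> ex_series v -> ex_series u.
Proof.
intros H. apply (ex_series_le (K := R_AbsRing) (V := R_CompleteNormedModule)).
intros n. change (Rabs (u n) <= v n). rewrite Rabs_pos_eq; apply H.
Qed.

Lemma Series_le_bound u M : ex_series u -> (forall N, rsum u N <= M) -> Series u <= M.
Proof.
intros He H. apply (is_lim_seq_le (rsum u) (fun _ => M) (Series u) M); auto.
exact (Series_correct u He). apply is_lim_seq_const.
Qed.

Lemma strongly_starlike_values alpha f : strongly_starlike alpha f ->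
  class_A f /\ exists F phi, is_starlike_quotient f F /\ analytic_on_disk phi /\ phi (RtoC 0) = RtoC 0 /\
    (forall z, in_disk z -> Cmod (phi z) < 1) /\ (forall z, in_disk z -> F z = sector_map alpha (phi z)).
Proof.
intros [Hf [F [HQ (_ & _ & phi & H1 & H2 & H3 & H4)]]]. split; auto. exists F, phi. auto.
Qed.

Lemma sector_map_in_sector alpha w : 0 < alpha <= 1 -> in_disk w -> in_sector alpha (sector_map alpha w).
Proof. intros Ha Hw. apply Cpower_in_sector; auto. apply cayley_Re_pos; auto. Qed.

(** The sector map has its values in the sector, so the coefficient bound applies
to it. *)
Lemma A_coeff_bound alpha m : 0 < alpha <= 1 -> Rabs (A_coeff alpha (S m)) <= 2 * alpha.
Proof.
intros Ha. assert (HB := analytic_coefs _ (/ 2) (sector_map_analytic alpha) ltac:(lra)).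
rewrite <- Cmod_R, <- (sector_map_coefs alpha _ HB m).
apply (sector_coef_bound alpha (sector_map alpha)); auto. lia. apply sector_map_0.
intros; apply sector_map_in_sector; auto.
Qed.

Lemma ex_series_A alpha : 0 < alpha <= 1 ->
  ex_series (fun k => Rabs (A_coeff alpha (k + 1)) ^ 2 / INR (k + 1) ^ 2).
Proof.
intros Ha. apply (ex_series_comparison _ (fun k => (2 * alpha) ^ 2 * / INR (k + 1) ^ 2)).
- intros n. assert (H : 0 < INR (n + 1)) by (apply lt_0_INR; lia).
  assert (Hi : 0 < / INR (n + 1) ^ 2) by (apply Rinv_0_lt_compat, pow_lt; auto).
  split. apply Rmult_le_pos; [apply pow2_ge_0|lra].
  apply Rmult_le_compat_r; [lra|]. apply pow_incr. split. apply Rabs_pos.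
  rewrite Nat.add_1_r. apply A_coeff_bound; auto.
- apply (ex_series_scal_l (K := R_AbsRing) ((2 * alpha) ^ 2) (fun k => / INR (k + 1) ^ 2)).
  apply ex_series_inv_sqr.
Qed.

Lemma starlike_inequalities alpha f gamma : 0 < alpha <= 1 -> strongly_starlike alpha f -> is_log_coeffs f gamma ->
  (forall n, (1 <= n)%nat -> Cmod (gamma n) <= alpha / INR n) /\
  ex_series (fun k => Cmod (gamma (k + 1)%nat) ^ 2) /\
  Series (fun k => Cmod (gamma (k + 1)%nat) ^ 2)
    <= 1 / 4 * Series (fun k => Rabs (A_coeff alpha (k + 1)) ^ 2 / INR (k + 1) ^ 2).
Proof.
intros Ha Hs Hg.
destruct (strongly_starlike_values alpha f Hs) as [Hf (F & phi & HQ & Hphi & phi0 & Hb & HFphi)].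
assert (HF := proj1 HQ). assert (F0 := proj1 (proj2 HQ)).
assert (Hc := analytic_coefs F (/ 2) HF ltac:(lra)). set (c := coef F (/ 2)) in *.
assert (HB := analytic_coefs _ (/ 2) (sector_map_analytic alpha) ltac:(lra)).
set (B := coef (sector_map alpha) (/ 2)) in *.
assert (Eg := Cmod_log_coeff f F gamma c Hf HQ Hg Hc).
assert (EB := sector_map_coefs alpha B HB).
assert (c0 : c 0%nat = RtoC 1) by (rewrite <- (series_on_0 1 F c); auto; lra).
assert (B0 : B 0%nat = RtoC 1) by (rewrite <- (series_on_0 1 _ B Rlt_0_1 HB); apply sector_map_0).
assert (I1 : forall n, (1 <= n)%nat -> Cmod (gamma n) <= alpha / INR n).
{ intros n Hn. destruct n; [lia|]. rewrite Eg.
  assert (H : 0 < INR (S n)) by (apply lt_0_INR; lia).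
  assert (H' := sector_coef_bound alpha F c (S n) Ha Hn Hc F0).
  apply Rle_div_l; [lra|]. replace (alpha / INR (S n) * (2 * INR (S n))) with (2 * alpha) by (field; lra).
  apply H'. intros z Hz. rewrite HFphi by auto. apply sector_map_in_sector; auto. apply Hb; auto. }
split; auto.
assert (Ex : ex_series (fun k => Cmod (gamma (k + 1)%nat) ^ 2)).
{ apply (ex_series_comparison _ (fun k => alpha ^ 2 * / INR (k + 1) ^ 2)).
  - intros n. split. apply pow2_ge_0.
    assert (H : 0 < INR (n + 1)) by (apply lt_0_INR; lia).
    replace (alpha ^ 2 * / INR (n + 1) ^ 2) with ((alpha / INR (n + 1)) ^ 2) by (field; lra).
    apply pow_incr. split. apply Cmod_ge_0. apply I1. lia.
  - apply (ex_series_scal_l (K := R_AbsRing) (alpha ^ 2) (fun k => / INR (k + 1) ^ 2)).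
    apply ex_series_inv_sqr. }
split; auto.
apply Series_le_bound; auto. intros N.
(* The weights of [|c_(k+1)|^2] in the sum of the squares of the logarithmic
   coefficients. *)
set (w := fun k => / (2 * INR (S k)) ^ 2).
assert (Hw : forall n, 0 <= w (S n) <= w n).
{ intros n. unfold w. assert (H : 0 < INR (S n)) by (apply lt_0_INR; lia).
  rewrite (S_INR (S n)). split. left; apply Rinv_0_lt_compat, pow_lt; lra.
  apply Rinv_le_contravar. apply pow_lt; lra. apply pow_incr; lra. }
rewrite (rsum_ext _ (fun k => w k * Cmod (c (S k)) ^ 2)).
2: { intros k _. rewrite Nat.add_1_r, Eg. unfold w. field. apply not_0_INR; lia. }
eapply Rle_trans. apply (weighted_rsum_le _ (fun k => Cmod (B (S k)) ^ 2)); auto.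
{ intros n. assert (R := rogosinski phi F (sector_map alpha) B c (S n) Hphi Hb phi0 HFphi HB Hc).
  rewrite !rsum_shift, c0, B0 in R. lra. }
rewrite (rsum_ext _ (fun k => 1 / 4 * (Rabs (A_coeff alpha (k + 1)) ^ 2 / INR (k + 1) ^ 2))).
2: { intros k _. rewrite Nat.add_1_r, EB, Cmod_R. unfold w. field. apply not_0_INR; lia. }
rewrite (rsum_scal (1 / 4) (fun k => Rabs (A_coeff alpha (k + 1)) ^ 2 / INR (k + 1) ^ 2)).
apply Rmult_le_compat_l; [lra|]. apply rsum_le_Series.
- intros k. apply Rdiv_le_0_compat. apply pow2_ge_0. apply pow_lt, lt_0_INR; lia.
- apply ex_series_A; auto.
Qed.

(** * The extremal functions *)

Lemma in_disk_pow n z : (1 <= n)%nat -> in_disk z -> in_disk (z ^ n)%C.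
Proof.
unfold in_disk. intros Hn Hz. rewrite Cmod_pow. pose proof (Cmod_ge_0 z).
apply pow_lt_1_compat; [lra|lia].
Qed.

Lemma pow_0 n : (1 <= n)%nat -> (RtoC 0 ^ n)%C = RtoC 0.
Proof. intros Hn. destruct n; [lia|]. simpl. ring. Qed.

Lemma sector_map_pow_analytic alpha n : (1 <= n)%nat -> analytic_on_disk (fun z => sector_map alpha (z ^ n)%C).
Proof.
intros Hn z Hz. eexists. apply (cderive_comp (sector_map alpha) (fun z => z ^ n)%C).
apply cderive_sector_map, in_disk_pow; auto. apply cderive_pow.
Qed.

Lemma sector_map_pow_0 alpha n : (1 <= n)%nat -> sector_map alpha (RtoC 0 ^ n)%C = RtoC 1.
Proof. intros Hn. rewrite pow_0 by auto. apply sector_map_0. Qed.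

Lemma subordinate_pow alpha n F : (1 <= n)%nat -> (forall z, F z = sector_map alpha (z ^ n)%C) ->
  subordinate F (sector_map alpha).
Proof.
intros Hn E. split; [|split].
- intros z Hz. destruct (analytic_cderive _ z (sector_map_pow_analytic alpha n Hn) Hz) as [l Hl].
  exists l. apply (cderive_ext_loc (fun z => sector_map alpha (z ^ n)%C) F z l 1); auto. lra.
- apply sector_map_analytic.
- exists (fun z => z ^ n)%C. split; [|split; [|split]].
  + intros z Hz. eexists. apply cderive_pow.
  + apply pow_0; auto.
  + intros z Hz. apply in_disk_pow; auto.
  + auto.
Qed.

(** [G (z^n) = 1 + 2 alpha z^n + O(z^(2n))], and [2n > n]. *)
Lemma sector_map_pow_coef alpha n c : (1 <= n)%nat -> has_coefs (fun z => sector_map alpha (z ^ n)%C) c ->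
  c n = RtoC (2 * alpha).
Proof.
intros Hn Hc.
assert (HB := analytic_coefs _ (/ 2) (sector_map_analytic alpha) ltac:(lra)).
set (B := coef (sector_map alpha) (/ 2)) in *.
destruct (vanish_bigO 1 _ _ 2 Rlt_0_1 (series_on_minus _ _ _ _ _ HB (series_on_cpoly 1 B 1))) as [M HM].
{ intros k Hk. rewrite trunc_le by lia. ring. }
set (mono := fun k => if Nat.eq_dec k n then B 1%nat else if Nat.eq_dec k 0 then B 0%nat else RtoC 0).
assert (Em : forall z, cpoly mono n z = cpoly B 1 (z ^ n)%C).
{ intros z. rewrite cpoly_gap; auto.
  - unfold mono, cpoly. rewrite csum_S, csum_0.
    destruct (Nat.eq_dec 0 n); [lia|]. destruct (Nat.eq_dec n n); [|lia]. simpl. ring.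
  - intros k Hk. unfold mono. destruct (Nat.eq_dec k n); [lia|]. destruct (Nat.eq_dec k 0); [lia|auto]. }
rewrite <- (sector_map_coef_1 alpha B HB).
transitivity (trunc mono n n).
2: { rewrite trunc_le by auto. unfold mono. destruct (Nat.eq_dec n n); [auto|lia]. }
apply (coefs_small_o_eq 1 (fun z => sector_map alpha (z ^ n)%C) (cpoly mono n) _ _ n); auto;
  [lra|apply series_on_cpoly|].
apply (bigO_small_o _ n (Rabs M) (/ 4)). lra. intros z Hz. rewrite Em.
pose proof (Cmod_ge_0 z) as Hz0.
assert (Hz1 : forall j, Cmod z ^ j <= 1) by (intros j; rewrite <- (pow1 j); apply pow_incr; lra).
assert (Hzn : Cmod (z ^ n)%C <= 1 / 4).
{ rewrite Cmod_pow. destruct n; [lia|]. simpl. specialize (Hz1 n). assert (0 <= Cmod z ^ n) by (apply pow_le; auto). nra. }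
eapply Rle_trans. apply (HM _ Hzn). rewrite Cmod_pow, <- pow_mult.
apply Rle_trans with (Rabs M * Cmod z ^ (n * 2)).
- apply Rmult_le_compat_r. apply pow_le; auto. apply Rle_abs.
- apply Rmult_le_compat_l. apply Rabs_pos.
  replace (n * 2)%nat with (S n + pred n)%nat by lia. rewrite pow_add.
  rewrite <- (Rmult_1_r (Cmod z ^ S n)) at 2. apply Rmult_le_compat_l. apply pow_le; auto. auto.
Qed.

Theorem theorem2p6 (alpha : R) (Halpha : 0 < alpha <= 1) :
  (* the two inequalities *)
  (forall f : C -> C, strongly_starlike alpha f ->
    (exists gamma : nat -> C, is_log_coeffs f gamma) /\
    (forall gamma : nat -> C, is_log_coeffs f gamma ->
      (forall n : nat, (1 <= n)%nat -> Cmod (gamma n) <= alpha / INR n) /\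
      ex_series (fun k : nat => Cmod (gamma (k + 1)%nat) ^ 2) /\
      ex_series (fun k : nat =>
        Rabs (A_coeff alpha (k + 1)) ^ 2 / INR (k + 1) ^ 2) /\
      Series (fun k : nat => Cmod (gamma (k + 1)%nat) ^ 2)
        <= 1 / 4 * Series (fun k : nat =>
             Rabs (A_coeff alpha (k + 1)) ^ 2 / INR (k + 1) ^ 2))) /\
  (* sharpness of the first inequality *)
  (forall n : nat, (1 <= n)%nat ->
    (exists f : C -> C, class_A f /\
       is_starlike_quotient f (fun z : C => sector_map alpha (z ^ n)%C)) /\
    (forall f : C -> C, class_A f ->
       is_starlike_quotient f (fun z : C => sector_map alpha (z ^ n)%C) ->
       strongly_starlike alpha f /\
       forall gamma : nat -> C, is_log_coeffs f gamma ->
         Cmod (gamma n) = alpha / INR n)) /\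
  (* sharpness of the second inequality *)
  ((exists f : C -> C, class_A f /\
      is_starlike_quotient f (sector_map alpha)) /\
   (forall f : C -> C, class_A f ->
      is_starlike_quotient f (sector_map alpha) ->
      strongly_starlike alpha f /\
      forall gamma : nat -> C, is_log_coeffs f gamma ->
        Series (fun k : nat => Cmod (gamma (k + 1)%nat) ^ 2)
          = 1 / 4 * Series (fun k : nat =>
              Rabs (A_coeff alpha (k + 1)) ^ 2 / INR (k + 1) ^ 2))).
Proof.
split; [|split].
- intros f Hf. split.
  + destruct (strongly_starlike_values alpha f Hf) as [Hf' (F & phi & HQ & _)].
    apply (log_coeffs_exist f F Hf' HQ).
  + intros gamma Hg. destruct (starlike_inequalities alpha f gamma Halpha Hf Hg) as (H1 & H2 & H3).
    split; auto. split; auto. split; auto. apply ex_series_A; auto.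
- intros n Hn. split.
  + apply starlike_quotient_realized. apply sector_map_pow_analytic; auto. apply sector_map_pow_0; auto.
  + intros f Hf HQ. split.
    * split; auto. eexists. split. exact HQ. apply (subordinate_pow alpha n); auto.
    * intros gamma Hg.
      assert (Hc := analytic_coefs _ (/ 2) (sector_map_pow_analytic alpha n Hn) ltac:(lra)).
      assert (E := sector_map_pow_coef alpha n _ Hn Hc).
      destruct n as [|m]; [lia|]. rewrite (Cmod_log_coeff f _ gamma _ Hf HQ Hg Hc), E.
      rewrite Cmod_R, Rabs_pos_eq by lra. field. apply not_0_INR; lia.
- split.
  + apply starlike_quotient_realized. apply sector_map_analytic. apply sector_map_0.
  + intros f Hf HQ. split.
    * split; auto. eexists. split. exact HQ. apply (subordinate_pow alpha 1); auto.
      intros z. simpl. rewrite Cmult_1_r. auto.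
    * intros gamma Hg.
      assert (HB := analytic_coefs _ (/ 2) (sector_map_analytic alpha) ltac:(lra)).
      rewrite <- Series_scal_l. apply Series_ext. intros k. rewrite Nat.add_1_r.
      rewrite (Cmod_log_coeff f _ gamma _ Hf HQ Hg HB), (sector_map_coefs alpha _ HB), Cmod_R.
      field. apply not_0_INR; lia.
Qed.
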